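(* Let $n\ge 5$. For $0\le a\le n-2$ let $\{k_3,\ldots,k_n\}=\{0,1,\ldots,n-2\}\setminus\{a\}$, and define integers $\lambda_i^{(m,a)}$ ($0\le i\le n$, $m\ge 0$) by \[ \lambda_0^{(0,a)}=1,\quad \lambda_1^{(0,a)}=\frac{t_{n-1}}{y_a},\quad \lambda_2^{(0,a)}=1,\quad \lambda_i^{(0,a)}=\frac{t_{n-1}}{y_{k_i}}\ (3\le i\le n), \] and, for $m\ge1$, \[ \lambda_0^{(m,a)}=\lambda_2^{(m-1,a)},\qquad \lambda_1^{(m,a)}=\lambda_1^{(m-1,a)},\qquad \lambda_2^{(m,a)}=\frac{\big(\lambda_1^{(m-1,a)}+\lambda_2^{(m-1,a)}\big)^2}{\lambda_0^{(m-1,a)}}, \] \[ \lambda_i^{(m,a)}=\frac{\lambda_i^{(m-1,a)}\big(\lambda_1^{(m-1,a)}+\lambda_2^{(m-1,a)}\big)}{\lambda_0^{(m-1,a)}}\quad(3\le i\le n). \] Set $X_n^{(m,a)}:=\mathbb{P}\big(\lambda_0^{(m,a)},\lambda_1^{(m,a)},\ldots,\lambda_n^{(m,a)}\big)$ and $X_n:=\mathbb{P}\big(1,1,\tfrac{t_{n-1}}{y_{n-2}},\ldots,\tfrac{t_{n-1}}{y_0}\big)$. Then: (i) $X_n^{(0,a)}=X_n$ for all $a$; (ii) if $m>0$ and $X$ is a weighted projective space with a non-trivial mutation to $X_n^{(m,a)}$, then either $X=X_n^{(m-1,a)}$ or $X=X_n^{(m+1,a)}$; (iii) $X_n^{(m,a)}$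 is not terminal for any $m\ge1$. In other words, the graph of mutations between weighted projective spaces starting at $X_n$ (whose vertices are the weighted projective spaces reachable from $X_n$ by a sequence of non-trivial mutations through weighted projective spaces, and whose edges are non-trivial mutations) is a subtree of the tree with root $X_n$ and, for each $a\in\{0,\ldots,n-2\}$, one infinite branch $X_n - X_n^{(1,a)} - X_n^{(2,a)} - X_n^{(3,a)} - \cdots$, and the only terminal weighted projective space in this graph is $X_n$.
   Context: Sylvester numbers: $y_0=2$, $y_n=1+\prod_{i=0}^{n-1}y_i$ for $n\ge1$; $t_n:=y_n-1$. $N\cong\mathbb{Z}^n$ is a lattice, $M=\mathrm{Hom}(N,\mathbb{Z})$, $N_{\mathbb{Q}}=N\otimes_{\mathbb{Z}}\mathbb{Q}$. A convex lattice polytope $P\subset N_{\mathbb{Q}}$ is Fano if $\dim P=n$, the origin lies in the strict interior of $P$, and the vertices of $P$ are primitive lattice points. $P\cong P'$ means there is a change of basis of $N$ sending $P$ to $P'$. For a Fano $n$-simplex $P=\mathrm{conv}\{v_0,\ldots,v_n\}$, its weights are the unique coprime positive integers with $\sum\lambda_iv_i=\mathbf{0}$, its multiplicity is $[N:\sum\mathbb{Z}v_i]$, and $X_P$ is the toric variety of the fan spanned by the faces of $P$. $X_P$ is the weighted projective space $\mathbb{P}(\lambda_0,\ldots,\lambda_n)$ exactly when the multiplicity is $1$, i.e. the $v_i$ generate $N$. Weighted projective spaces are considered up to isomorphism (reordering the weights). Mutation: let $w\in M$ be primitive. Put $H_{w,h}=\{v\in N_{\mathbb{Q}}: w(v)=h\}$,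 $w_h(P)=\mathrm{conv}(H_{w,h}\cap P\cap N)$ (possibly empty), $h_{\min}=\min_{v\in P}w(v)$, $h_{\max}=\max_{v\in P}w(v)$. A factor of $P$ with respect to $w$ is a lattice polytope $F\subset N_{\mathbb{Q}}$ with $w(F)=0$ such that for every integer $h$ with $h_{\min}\le h<0$ there is a (possibly empty) lattice polytope $G_h$ with $H_{w,h}\cap\mathrm{vert}(P)\subseteq G_h+(-h)F\subseteq w_h(P)$. The mutation is \[\mathrm{mut}_w(P,F)=\mathrm{conv}\Big(\bigcup_{h=h_{\min}}^{-1}G_h\cup\bigcup_{h=0}^{h_{\max}}\big(w_h(P)+hF\big)\Big),\] known to be independent of the $G_h$. There is a non-trivial mutation from $X_P$ to $X_Q$ if $Q\cong\mathrm{mut}_w(P,F)$ for some $w,F$ and $P\not\cong Q$. (Mutations are invertible.) A (fake) weighted projective space is terminal if it has at worst terminal singularities, i.e. every cone $\sigma$ of its fan is terminal: the primitive generators $\rho_1,\ldots,\rho_r$ of the rays of $\sigma$ lie in an affine hyperplane $\{v: u(v)=1\}$ for some $u\in M\otimes\mathbb{Q}$, and $N\cap\sigma\cap\{v: u(v)\le1\}=\{\mathbf{0},\rho_1,\ldots,\rho_r\}$. *)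

(* Defs.v *)
From mathcomp Require Import all_boot all_order all_algebra.
From mathcomp Require Import classical_sets.

Set Implicit Arguments.
Unset Strict Implicit.
Unset Printing Implicit Defensive.

Import Order.TTheory GRing.Theory Num.Theory.
Local Open Scope classical_set_scope.
Local Open Scope ring_scope.

(* The lattice N is 'rV[int]_n, its dual M is 'cV[int]_n, and N_Q and M_Q are
   'rV[rat]_n and 'cV[rat]_n; the pairing is the matrix product. *)

Definition toQ (p q : nat) (v : 'M[int]_(p, q)) : 'M[rat]_(p, q) :=
  map_mx intr v.

Definition ev (n : nat) (u : 'cV[rat]_n) (x : 'rV[rat]_n) : rat :=
  (x *m u) 0 0.

(* Excludes 0, since 0 = k *: 0 for every k. *)
Definition primitive (p q : nat) (v : 'M[int]_(p, q)) : Prop :=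
  forall (k : int) (u : 'M[int]_(p, q)), v = k *: u -> k \is a GRing.unit.

Definition conv_hull (n : nat) (A : set 'rV[rat]_n) : set 'rV[rat]_n :=
  [set x | exists (m : nat) (c : 'I_m -> rat) (p : 'I_m -> 'rV[rat]_n),
     [/\ forall i, 0 <= c i, \sum_i c i = 1, forall i, A (p i)
       & x = \sum_i c i *: p i]].

Definition conic_hull (n : nat) (A : set 'rV[rat]_n) : set 'rV[rat]_n :=
  [set x | exists (m : nat) (c : 'I_m -> rat) (p : 'I_m -> 'rV[rat]_n),
     [/\ forall i, 0 <= c i, forall i, A (p i) & x = \sum_i c i *: p i]].

Definition extreme_points (n : nat) (A : set 'rV[rat]_n) : set 'rV[rat]_n :=
  [set x | A x /\ forall (y z : 'rV[rat]_n) (t : rat),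
     A y -> A z -> 0 < t < 1 -> x = t *: y + (1 - t) *: z -> y = x /\ z = x].

Definition minkowski_sum (n : nat) (A B : set 'rV[rat]_n) : set 'rV[rat]_n :=
  [set x + y | x in A & y in B].

Definition dilate (n : nat) (c : rat) (A : set 'rV[rat]_n) : set 'rV[rat]_n :=
  [set c *: x | x in A].

(* Possibly empty. *)
Definition lattice_polytope (n : nat) (A : set 'rV[rat]_n) : Prop :=
  exists s : seq 'rV[int]_n, A = conv_hull [set toQ v | v in [set` s]].

(* The affine span is everything: no nonzero functional is constant on A. *)
Definition full_dimensional (n : nat) (A : set 'rV[rat]_n) : Prop :=
  forall (u : 'cV[rat]_n) (c : rat), (forall x, A x -> ev u x = c) -> u = 0.

Definition in_interior (n : nat) (x : 'rV[rat]_n) (A : set 'rV[rat]_n) : Prop :=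
  exists2 e : rat, 0 < e &
    forall y : 'rV[rat]_n, (forall i, `|y 0 i - x 0 i| < e) -> A y.

Definition fano (n : nat) (P : set 'rV[rat]_n) : Prop :=
  [/\ lattice_polytope P, full_dimensional P, in_interior 0 P
    & forall x, extreme_points P x -> exists2 v : 'rV[int]_n, primitive v & x = toQ v].

Definition polytope_iso (n : nat) (P P' : set 'rV[rat]_n) : Prop :=
  exists2 g : 'M[int]_n, g \in unitmx & P' = [set x *m toQ g | x in P].

(* A weighted projective space of dimension n is given by its tuple of n + 1
   weights, and isomorphism is [perm_eq].  [is_wps_polytope l P] says that X_P
   is P(l): P is a Fano n-simplex with weights l and multiplicity 1. *)
Definition is_wps_polytope (n : nat) (l : n.+1.-tuple nat)
    (P : set 'rV[rat]_n) : Prop :=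
  exists v : 'I_n.+1 -> 'rV[int]_n,
    [/\ P = conv_hull (range (fun i => toQ (v i))) /\ fano P,
        forall i, (0 < tnth l i)%N,
        \big[gcdn/0%N]_i tnth l i = 1%N,
        \sum_i (tnth l i)%:Z *: v i = 0
      & forall x : 'rV[int]_n,
          exists c : 'I_n.+1 -> int, x = \sum_i c i *: v i].

Definition is_wps (n : nat) (l : n.+1.-tuple nat) : Prop :=
  exists P : set 'rV[rat]_n, is_wps_polytope l P.

Definition hyperplane (n : nat) (w : 'cV[int]_n) (h : int) : set 'rV[rat]_n :=
  [set x | ev (toQ w) x = h%:~R].

Definition slice (n : nat) (w : 'cV[int]_n) (h : int) (P : set 'rV[rat]_n) :
    set 'rV[rat]_n :=
  conv_hull (hyperplane w h `&` P `&` range (@toQ 1 n)).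

(* The extremal heights of a lattice polytope are attained at vertices, hence
   are integers. *)
Definition is_min_height (n : nat) (w : 'cV[int]_n) (P : set 'rV[rat]_n)
    (h : int) : Prop :=
  (exists2 x, P x & ev (toQ w) x = h%:~R)
  /\ forall x, P x -> h%:~R <= ev (toQ w) x.

Definition is_max_height (n : nat) (w : 'cV[int]_n) (P : set 'rV[rat]_n)
    (h : int) : Prop :=
  (exists2 x, P x & ev (toQ w) x = h%:~R)
  /\ forall x, P x -> ev (toQ w) x <= h%:~R.

(* Q = mut_w(P, F), for a primitive w and a factor F of P with respect to w.
   The family G witnesses that F is a factor; the mutation does not depend on
   its choice. *)
Definition is_mutation (n : nat) (w : 'cV[int]_n) (F P Q : set 'rV[rat]_n) :
    Prop :=
  primitive w /\
  [/\ lattice_polytope F, F !=set0 & forall x, F x -> ev (toQ w) x = 0] /\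
  exists (hmin hmax : int) (G : int -> set 'rV[rat]_n),
    [/\ is_min_height w P hmin,
        is_max_height w P hmax,
        forall h : int, hmin <= h < 0 ->
          [/\ lattice_polytope (G h),
              hyperplane w h `&` extreme_points P
                `<=` minkowski_sum (G h) (dilate (- h)%:~R F)
            & minkowski_sum (G h) (dilate (- h)%:~R F) `<=` slice w h P]
      & Q = conv_hull
              (\bigcup_(h in [set h : int | hmin <= h < 0]) G h `|`
               \bigcup_(h in [set h : int | 0 <= h <= hmax])
                  minkowski_sum (slice w h P) (dilate h%:~R F))].

(* A non-trivial mutation from P(l) to P(l'). *)
Definition wps_mutation (n : nat) (l l' : n.+1.-tuple nat) : Prop :=
  exists P Q : set 'rV[rat]_n,
    [/\ is_wps_polytope l P, is_wps_polytope l' Q,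
        exists (w : 'cV[int]_n) (F Q' : set 'rV[rat]_n),
          is_mutation w F P Q' /\ polytope_iso Q Q'
      & ~ polytope_iso P Q].

(* The vertices of the graph of mutations between weighted projective spaces
   starting at P(l). *)
Inductive mutation_reachable (n : nat) (l : n.+1.-tuple nat) :
    n.+1.-tuple nat -> Prop :=
| reachable_start l' :
    is_wps l' -> perm_eq l l' -> mutation_reachable l l'
| reachable_step l' l'' :
    mutation_reachable l l' -> wps_mutation l' l'' -> mutation_reachable l l''.

Definition proper_face (n : nat) (P E : set 'rV[rat]_n) : Prop :=
  E <> P /\
  exists (u : 'cV[rat]_n) (c : rat),
    (forall x, P x -> ev u x <= c) /\ E = P `&` [set x | ev u x = c].

(* The cones of the fan spanned by the faces of P; the empty face gives {0}. *)
Definition face_fan (n : nat) (P : set 'rV[rat]_n) : set (set 'rV[rat]_n) :=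
  [set conic_hull E | E in proper_face P].

Definition ray_generator (n : nat) (sigma : set 'rV[rat]_n) (rho : 'rV[int]_n) :
    Prop :=
  [/\ primitive rho, sigma (toQ rho)
    & forall x y, sigma x -> sigma y -> x + y = toQ rho ->
        exists2 t : rat, 0 <= t & x = t *: toQ rho].

Definition terminal_cone (n : nat) (sigma : set 'rV[rat]_n) : Prop :=
  exists u : 'cV[rat]_n,
    (forall rho : 'rV[int]_n, ray_generator sigma rho -> ev u (toQ rho) = 1)
    /\ forall x : 'rV[int]_n,
         (sigma (toQ x) /\ ev u (toQ x) <= 1) <->
         (x = 0 \/ ray_generator sigma x).

(* The choice of P does not matter: it is unique up to [polytope_iso]. *)
Definition terminal_wps (n : nat) (l : n.+1.-tuple nat) : Prop :=
  exists2 P : set 'rV[rat]_n, is_wps_polytope l P &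
    forall sigma, face_fan P sigma -> terminal_cone sigma.

Local Open Scope nat_scope.

Fixpoint sylvester (n : nat) : nat :=
  if n is m.+1 then 1 + sylvester m * (sylvester m).-1 else 2.

Lemma sylvesterE (n : nat) : sylvester n = 1 + \prod_(i < n) sylvester i.
Proof.
elim: n => [|n IHn]; first by rewrite big_ord0.
by rewrite big_ord_recr /= {2}IHn add1n /= mulnC.
Qed.

Definition sylvester_pred (n : nat) : nat := sylvester n - 1.

(* [lambda n a k m i] is lambda_i^(m,a), with k enumerating
   {0, ..., n-2} \ {a} on the indices 3, ..., n.  All the divisions are exact,
   see [lambda_exact]. *)
Fixpoint lambda (n a : nat) (k : nat -> nat) (m i : nat) : nat :=
  match m, i with
  | 0, 0 => 1
  | 0, 1 => sylvester_pred n.-1 %/ sylvester a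
  | 0, 2 => 1
  | 0, _ => sylvester_pred n.-1 %/ sylvester (k i)
  | m'.+1, 0 => lambda n a k m' 2
  | m'.+1, 1 => lambda n a k m' 1
  | m'.+1, 2 =>
      (lambda n a k m' 1 + lambda n a k m' 2) ^ 2 %/ lambda n a k m' 0
  | m'.+1, _ =>
      lambda n a k m' i * (lambda n a k m' 1 + lambda n a k m' 2)
        %/ lambda n a k m' 0
  end.

(* The defining formulas of the lambda_i^(m,a) give integers. *)
Definition lambda_exact (n a : nat) (k : nat -> nat) (m : nat) : Prop :=
  [/\ sylvester a %| sylvester_pred n.-1,
      forall i, 3 <= i <= n -> sylvester (k i) %| sylvester_pred n.-1,
      lambda n a k m 0
        %| (lambda n a k m 1 + lambda n a k m 2) ^ 2
    & forall i, 3 <= i <= n ->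
        lambda n a k m 0
          %| lambda n a k m i * (lambda n a k m 1 + lambda n a k m 2)].

Definition Xma (n a : nat) (k : nat -> nat) (m : nat) : n.+1.-tuple nat :=
  [tuple lambda n a k m i | i < n.+1].

(* P(1, 1, t_{n-1}/y_{n-2}, ..., t_{n-1}/y_0) *)
Definition Xroot (n : nat) : n.+1.-tuple nat :=
  [tuple (if i < 2 then 1 else sylvester_pred n.-1 %/ sylvester (n - i))
     | i < n.+1].

(* Main.v *)
(** A mutation between Fano simplices has a rigid shape.  Let [v_i] be the
    vertices of [P] and suppose that the factor [F] is not a point (otherwise the
    mutation is a shear).  Every vertex [v_i] of negative height [h] lies in
    [G_h + (-h) F], so it is [g + (-h) phi_i] with [phi_i] in [F] minimising all
    barycentric coordinates but the [i]-th on [F]; hence [F] is homothetic to the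
    face of minimal height, and all vertices of negative height are on that face.
    Every linear functional attains its maximum over the mutation at one of the
    points [v_j + w(v_j) phi_i]; since the mutation is again a simplex and has no
    two parallel edges, [P] has one vertex of positive height, and the bottom face
    collapses to one vertex.

    Comparing the relations between the vertices, and using that they generate
    the lattice, a mutation which changes the weights is over an edge, and the
    weights [(h^2 d, l_a, l_b, h m_k)] with [l_a + l_b = h h' d] become
    [(h'^2 d, l_a, l_b, h' m_k)].

    With [L = t_{n-1} / y_a], [r_0 = r_1 = 1] and [r_{m+2} = (L + 2) r_{m+1} - r_m]
    one has [r_m r_{m+2} = L + r_{m+1}^2], and the weights of [X_n^(m,a)] are
    [r_m^2, L, r_{m+1}^2, (t_{n-1} / y_k) r_m r_{m+1}].  A common divisor of [l_a]
    and [l_b] divides [d], and a prime dividing [h^2 d] divides [l_a + l_b]; as the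
    Sylvester numbers are pairwise coprime, this leaves only the two expected
    exchanges.  The lattice contains a point in the open edge between the vertices
    of weights [r_m^2] and [L] when [m > 0], so [X_n^(m,a)] is then not terminal. *)

Require Import Defs.
From mathcomp Require Import all_boot all_order all_algebra fingroup perm.
From mathcomp Require Import boolp classical_sets.
From mathcomp Require Import zify ring lra.

Set Implicit Arguments.
Unset Strict Implicit.
Unset Printing Implicit Defensive.

Import Order.TTheory GRing.Theory Num.Theory.

(** * Convex hulls and barycentric coordinates *)

Section Convexity.
Local Open Scope classical_set_scope.
Local Open Scope ring_scope.

(** The weights determine a lattice simplex of multiplicity 1 up to a change of basis, so once the
    shape of a mutation is known the classification of neighbours is about integers only, and
    mutations are inverted only on weights. The shape is read off linear functionals, because the
    definition of a mutation does not tell which points of the hull are vertices: a vertex of [Q] is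
    found by maximising its own barycentric coordinate, and candidates are confirmed by exposing
    functionals.

    If the bottom face has three or more vertices, divisibility along its edges makes both heights 1
    and the weights stay the same; this leaves the edge. The sequence [r] is Vieta jumping on x^2 +
    y^2 + L = (L + 2) x y. The same equation makes the exchange of [L] over the edge with weights
    r_m^2 and r_{m+1}^2 the delicate one: it would force [L] to divide 4. The bound n >= 5 gives L >
    4 and three tail indices, so that some Sylvester number avoids two given ones; m > 0 gives
    r_{m+1} > 1. The root is terminal because its weights sum to t_{n-1} + 1, by the Egyptian
    fraction identity sum_{j < n-1} 1/y_j = 1 - 1/t_{n-1}. *)

Lemma evD n (u : 'cV[rat]_n) x y : ev u (x + y) = ev u x + ev u y.
Proof. by rewrite /ev mulmxDl mxE. Qed.

Lemma evZ n (u : 'cV[rat]_n) c x : ev u (c *: x) = c * ev u x.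
Proof. by rewrite /ev -scalemxAl mxE. Qed.

Lemma evB n (u : 'cV[rat]_n) x y : ev u (x - y) = ev u x - ev u y.
Proof. by rewrite evD -scaleN1r evZ mulN1r. Qed.

Lemma ev0 n (u : 'cV[rat]_n) : ev u 0 = 0.
Proof. by rewrite /ev mul0mx mxE. Qed.

Lemma ev_sum n (u : 'cV[rat]_n) (I : finType) (p : I -> 'rV[rat]_n) :
  ev u (\sum_i p i) = \sum_i ev u (p i).
Proof. by rewrite /ev mulmx_suml summxE. Qed.

Lemma evDu n (u v : 'cV[rat]_n) x : ev (u + v) x = ev u x + ev v x.
Proof. by rewrite /ev mulmxDr mxE. Qed.

Lemma evZu n (u : 'cV[rat]_n) c x : ev (c *: u) x = c * ev u x.
Proof. by rewrite /ev -scalemxAr mxE. Qed.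

Lemma toQ_inj p q : injective (@toQ p q).
Proof.
move=> x y /matrixP e; apply/matrixP => i j.
by have := e i j; rewrite !mxE => /intr_inj.
Qed.

Lemma toQD p q (x y : 'M[int]_(p, q)) : toQ (x + y) = toQ x + toQ y.
Proof. by rewrite /toQ map_mxD. Qed.

Lemma toQB p q (x y : 'M[int]_(p, q)) : toQ (x - y) = toQ x - toQ y.
Proof. by rewrite /toQ map_mxB. Qed.

Lemma toQZ p q c (x : 'M[int]_(p, q)) : toQ (c *: x) = c%:~R *: toQ x.
Proof. by rewrite /toQ map_mxZ. Qed.

Lemma toQM p q r (x : 'M[int]_(p, q)) (y : 'M[int]_(q, r)) :
  toQ (x *m y) = toQ x *m toQ y.
Proof. by rewrite /toQ map_mxM. Qed.

Lemma toQ_sum p q (I : finType) (x : I -> 'M[int]_(p, q)) :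
  toQ (\sum_i x i) = \sum_i toQ (x i).
Proof. by rewrite /toQ raddf_sum. Qed.

Lemma toQ0 p q : toQ (0 : 'M[int]_(p, q)) = 0.
Proof. by rewrite /toQ map_mx0. Qed.

Lemma toQ1 n : toQ (1%:M : 'M[int]_n) = 1%:M.
Proof. by rewrite /toQ map_mx1. Qed.

Definition height n (w : 'cV[int]_n) (x : 'rV[int]_n) : int := (x *m w) 0 0.

Lemma ev_toQ n (w : 'cV[int]_n) (x : 'rV[int]_n) :
  ev (toQ w) (toQ x) = (height w x)%:~R.
Proof. by rewrite /ev -toQM mxE. Qed.

Lemma conv_hull_in n (A : set 'rV[rat]_n) x : A x -> conv_hull A x.
Proof.
move=> Ax; exists 1%N, (fun=> 1), (fun=> x); split=> //.
- by rewrite big_ord1.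
- by rewrite big_ord1 scale1r.
Qed.

Lemma conv_hull_le n (A : set 'rV[rat]_n) u C :
  (forall y, A y -> ev u y <= C) -> forall x, conv_hull A x -> ev u x <= C.
Proof.
move=> AC x [m [c [p [c0 c1 Ap ->]]]].
rewrite ev_sum -[C]mul1r -c1 mulr_suml ler_sum // => i _.
by rewrite evZ ler_wpM2l // AC.
Qed.

Lemma conv_hull_ge n (A : set 'rV[rat]_n) u C :
  (forall y, A y -> C <= ev u y) -> forall x, conv_hull A x -> C <= ev u x.
Proof.
move=> AC x [m [c [p [c0 c1 Ap ->]]]].
rewrite ev_sum -[C]mul1r -c1 mulr_suml ler_sum // => i _.
by rewrite evZ ler_wpM2l // AC.
Qed.

(** The gaps [ev u x - ev u (p i)] are nonnegative with weighted sum zero, so each point of nonzero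
    coefficient attains the maximum and is [x] itself. *)
Lemma conv_hull_exposed n (A : set 'rV[rat]_n) u x :
  (forall y, A y -> ev u y <= ev u x) ->
  (forall y, A y -> ev u y = ev u x -> y = x) -> conv_hull A x -> A x.
Proof.
move=> le_x eq_x [m [c [p [c0 c1 Ap xE]]]].
have [i ci|c_eq0] := pickP (fun i => c i != 0); last first.
  move: c1; rewrite big1; first by move/eqP; rewrite eq_sym oner_eq0.
  by move=> i _; have /eqP := negbFE (c_eq0 i).
have s0 : \sum_i c i * (ev u x - ev u (p i)) = 0.
  rewrite (eq_bigr (fun i => c i * ev u x - ev u (c i *: p i))); last first.
    by move=> j _; rewrite evZ mulrBr.
  by rewrite sumrB -mulr_suml c1 mul1r -ev_sum -xE subrr.
have ge0 j : true -> 0 <= c j * (ev u x - ev u (p j)).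
  by move=> _; rewrite mulr_ge0 // subr_ge0 le_x.
have /eqP := psumr_eq0P ge0 s0 (i := i) isT.
rewrite mulf_eq0 (negbTE ci) /= subr_eq0 => /eqP e.
by rewrite -(eq_x (p i)).
Qed.

Lemma conv_hull_sum n (A : set 'rV[rat]_n) m (c : 'I_m -> rat) p :
  (forall i, 0 <= c i) -> \sum_i c i = 1 -> (forall i, A (p i)) ->
  conv_hull A (\sum_i c i *: p i).
Proof. by move=> c0 c1 Ap; exists m, c, p. Qed.

End Convexity.

Section Barycentric.
Local Open Scope classical_set_scope.
Local Open Scope ring_scope.

(** Linear parts [u] and constants [b] are kept apart because the mutation acts on linear
    functionals; [b i] is the i-th coordinate of the origin. *)
Definition barycentric n (v : 'I_n.+1 -> 'rV[rat]_n) (u : 'I_n.+1 -> 'cV[rat]_n)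
    (b : 'I_n.+1 -> rat) : Prop :=
  [/\ forall x, \sum_i (ev (u i) x + b i) *: v i = x,
      forall x, \sum_i (ev (u i) x + b i) = 1
    & forall i j, ev (u i) (v j) + b i = (i == j)%:R].

Section Simplex.
Variables (n : nat) (v : 'I_n.+1 -> 'rV[rat]_n) (u : 'I_n.+1 -> 'cV[rat]_n)
  (b : 'I_n.+1 -> rat).
Hypothesis vub : barycentric v u b.

Lemma bary_sum x : \sum_i (ev (u i) x + b i) *: v i = x.
Proof. by have [] := vub. Qed.

Lemma bary_sum1 x : \sum_i (ev (u i) x + b i) = 1.
Proof. by have [] := vub. Qed.

Lemma bary_vert i j : ev (u i) (v j) = (i == j)%:R - b i.
Proof. by have [_ _ /(_ i j) <-] := vub; rewrite addrK. Qed.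

Lemma bary_lin d : \sum_i ev (u i) d *: v i = d.
Proof.
have b0 : \sum_i b i *: v i = 0.
  by rewrite -[RHS]bary_sum; apply: eq_bigr => i _; rewrite ev0 add0r.
transitivity (\sum_i ev (u i) d *: v i + \sum_i b i *: v i).
  by rewrite b0 addr0.
by rewrite -[RHS]bary_sum -big_split /=; apply: eq_bigr => i _; rewrite scalerDl.
Qed.

Lemma bary_lin0 d : \sum_i ev (u i) d = 0.
Proof.
have b1 : \sum_i b i = 1.
  by rewrite -(bary_sum1 0); apply: eq_bigr => i _; rewrite ev0 add0r.
by apply: (addIr 1); rewrite -{1}b1 -big_split /= bary_sum1 add0r.
Qed.

Lemma bary_inj d : (forall i, ev (u i) d = 0) -> d = 0.
Proof. by move=> d0; rewrite -[d]bary_lin big1 // => i _; rewrite d0 scale0r. Qed.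

Lemma simplexP x :
  conv_hull (range v) x <-> forall i, 0 <= ev (u i) x + b i.
Proof.
split=> [hx i|x0]; last first.
  rewrite -[x]bary_sum; apply: conv_hull_sum => //; exact: bary_sum1.
rewrite addrC -lerBlDl sub0r; move: x hx; apply: conv_hull_ge => _ [j _ <-].
by rewrite bary_vert; case: eqP => _ /=; lra.
Qed.

Lemma bary_vertE x i : (forall j, 0 <= ev (u j) x + b j) ->
  1 <= ev (u i) x + b i -> x = v i.
Proof.
move=> x0 xi; have := bary_sum1 x; rewrite (bigD1 i) //= => s1.
have s0 : \sum_(j | j != i) (ev (u j) x + b j) = 0.
  apply/eqP; rewrite eq_le sumr_ge0 // andbT; move: s1 xi; set s := bigop _ _ _.
  by lra.
have z j : j != i -> ev (u j) x + b j = 0.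
  by move=> ji; apply: (psumr_eq0P _ s0) => // k _.
rewrite -[LHS]bary_sum (bigD1 i) //= big1 => [|j /z ->]; last by rewrite scale0r.
by move: s1; rewrite s0 addr0 => ->; rewrite scale1r addr0.
Qed.

Lemma bary_vert_inj : injective v.
Proof.
move=> i j e; have := bary_vert i i; rewrite {1}e bary_vert eqxx.
by case: (eqVneq i j) => //= _ /eqP; rewrite (inj_eq (addIr _)) eq_sym oner_eq0.
Qed.

Lemma extreme_vert x : extreme_points (conv_hull (range v)) x <-> exists i, x = v i.
Proof.
have fld (t X Y D : rat) : 1 - t != 0 ->
    (1 - t)^-1 * (X - t * (D - Y)) + Y = (1 - t)^-1 * (X + Y - t * D).
  by move=> t1; field.
split=> [[hx ext]|[i ->]].
  have x0 := (simplexP x).1 hx.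
  have [i xi|no] := pickP (fun i => 0 < ev (u i) x + b i); last first.
    have := bary_sum1 x; rewrite big1 => [/eqP|i _]; first by rewrite eq_sym oner_eq0.
    by apply/eqP; rewrite eq_le x0 leNgt no.
  exists i; case: (leP 1 (ev (u i) x + b i)) => x1; first exact: bary_vertE x1.
  pose t := ev (u i) x + b i; rewrite -/t in xi x1.
  (* [z] is the projection of [x] from [v i] onto the opposite facet, so [x] lies strictly between
     [v i] and [z]. *)
  pose z := (1 - t)^-1 *: (x - t *: v i).
  have t1 : 1 - t != 0 by apply/eqP; lra.
  have xE : x = t *: v i + (1 - t) *: z.
    by rewrite scalerA mulfV // scale1r addrC subrK.
  have hv : conv_hull (range v) (v i) by apply: conv_hull_in; exists i.
  have hz : conv_hull (range v) z.
    apply/simplexP => j; have xj := x0 j.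
    have -> : ev (u j) z + b j = (1 - t)^-1 * (ev (u j) x + b j - t * (j == i)%:R).
      by rewrite evZ evB evZ bary_vert fld.
    apply: mulr_ge0; first by rewrite invr_ge0 subr_ge0 ltW.
    by rewrite subr_ge0; case: (eqVneq j i) => [->|_]; rewrite ?mulr1 ?mulr0.
  by have [] := ext _ _ t hv hz _ xE; rewrite ?xi ?x1.
split=> [|y z t /simplexP hy /simplexP hz /andP[t0 t1] e].
  by apply: conv_hull_in; exists i.
have k j : t * (ev (u j) y + b j) + (1 - t) * (ev (u j) z + b j) = (j == i)%:R.
  by rewrite -(subrK (b j) (j == i)%:R) -bary_vert e evD !evZ; ring.
have s p : (forall j, 0 <= ev (u j) p + b j) -> ev (u i) p + b i <= 1.
  by move=> p0; rewrite -(bary_sum1 p) (bigD1 i) //= lerDl sumr_ge0.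
have := k i; rewrite eqxx mulr1n => ki.
have [sy sz] := (s y hy, s z hz).
split; apply: (bary_vertE (i := i)) => //; nra.
Qed.

End Simplex.
End Barycentric.

(** * Mutations of simplices *)

Section MutationOfSimplex.
Local Open Scope classical_set_scope.
Local Open Scope ring_scope.

Definition vertQ n (v : 'I_n.+1 -> 'rV[int]_n) (i : 'I_n.+1) : 'rV[rat]_n := toQ (v i).

Section Slices.
Variables (n : nat) (v : 'I_n.+1 -> 'rV[int]_n) (u : 'I_n.+1 -> 'cV[rat]_n)
  (b : 'I_n.+1 -> rat).
Hypothesis vub : barycentric (vertQ v) u b.
Local Notation P := (conv_hull (range (vertQ v))).
Variable w : 'cV[int]_n.

Lemma vert_in i : P (vertQ v i).
Proof. by apply: conv_hull_in; exists i. Qed.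

Lemma slice_sub h x : slice w h P x -> P x.
Proof.
move=> hx; apply/(simplexP vub) => i; rewrite addrC -lerBlDl sub0r.
move: x hx; apply: conv_hull_ge => y [[_ Py] _].
by rewrite lerNl -subr_ge0 opprK addrC; exact: (simplexP vub y).1.
Qed.

Lemma slice_height h x : slice w h P x -> ev (toQ w) x = h%:~R.
Proof.
move=> hx; apply/eqP; rewrite eq_le; apply/andP; split; move: x hx.
  by apply: conv_hull_le => y [[-> _] _].
by apply: conv_hull_ge => y [[-> _] _].
Qed.

(* The last item is the duality: the mutation acts on functionals by the piecewise
   linear map [U |-> U + (max_F U) w]. *)
Lemma mutation_data F Q : is_mutation w F P Q ->
  [/\ exists2 hmin, (exists i, height w (v i) = hmin) &
        forall i, hmin <= height w (v i),
      forall i, height w (v i) < 0 -> exists phi, [/\ F phi,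
        Q (vertQ v i + (height w (v i))%:~R *: phi) &
        forall psi, F psi ->
          P (vertQ v i + (height w (v i))%:~R *: (phi - psi))],
      forall i phi, 0 <= height w (v i) -> F phi ->
        Q (vertQ v i + (height w (v i))%:~R *: phi) &
      forall U phi C, F phi -> (forall psi, F psi -> ev U psi <= ev U phi) ->
        (forall x, P x -> ev U x + ev (toQ w) x * ev U phi <= C) ->
        forall x, Q x -> ev U x <= C].
Proof.
move=> [wprim [[Flat [f0 Ff0] Fw] [hmin [hmax [G [[[x0 Px0 x0E] hminP] [_ hmaxP] GP ->]]]]]].
have hv_ge i : hmin <= height w (v i).
  by rewrite -(ler_int rat) -ev_toQ hminP //; exact: vert_in.
have hv_le i : height w (v i) <= hmax.
  by rewrite -(ler_int rat) -ev_toQ hmaxP //; exact: vert_in.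
split.
- exists hmin => //; have [i /eqP ?|no] := pickP (fun i => height w (v i) == hmin).
    by exists i.
  have := (bary_sum vub x0); move/(congr1 (ev (toQ w))); rewrite x0E ev_sum.
  (* Heights of vertices are integers: if none equals [hmin], all are at least [hmin + 1], and so is
     the height of [x0]. *)
  have gt i : hmin + 1 <= height w (v i).
    by rewrite lezD1 lt_neqAle eq_sym no hv_ge.
  have : (hmin + 1)%:~R <= \sum_i ev (toQ w) ((ev (u i) x0 + b i) *: vertQ v i).
    rewrite -[leLHS]mul1r -{1}(bary_sum1 vub x0) mulr_suml ler_sum // => i _.
    rewrite evZ ev_toQ ler_wpM2l ?ler_int //.
    exact: (simplexP vub x0).1.
  by move=> h e; move: h; rewrite e ler_int; lia.
- move=> i hi; have hm : hmin <= height w (v i) < 0 by rewrite hv_ge.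
  have [_ sub1 sub2] := GP _ hm.
  have [|g Gg [_ [phi Fphi <-] E]] := sub1 (vertQ v i).
    split; first exact: ev_toQ.
    by apply/(extreme_vert vub); exists i.
  have E' : vertQ v i + (height w (v i))%:~R *: phi = g.
    by rewrite -E intrN scaleNr subrK.
  exists phi; split=> //.
    by rewrite E'; apply: conv_hull_in; left; exists (height w (v i)).
  move=> psi Fpsi; rewrite scalerBr addrA E'.
  apply: (@slice_sub (height w (v i))); apply: sub2; exists g => //.
  exists ((- height w (v i))%:~R *: psi); first by exists psi.
  by rewrite intrN scaleNr.
- move=> i phi hi Fphi; apply: conv_hull_in; right.
  exists (height w (v i)); first by rewrite /= hi hv_le.
  exists (vertQ v i).
    by apply: conv_hull_in; split; [split; [exact: ev_toQ|exact: vert_in]|exists (v i)].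
  by exists ((height w (v i))%:~R *: phi) => //; exists phi.
- move=> U phi C Fphi Umax UP; apply: conv_hull_le => y [[h hh Gy]|[h /= /andP[h0 _] [x sx [_ [psi Fpsi <-] <-]]]].
    have [_ _ sub2] := GP _ hh.
    have s : slice w h P (y + (- h)%:~R *: phi).
      by apply: sub2; exists y => //; exists ((- h)%:~R *: phi) => //; exists phi.
    have := UP _ (slice_sub s); rewrite (slice_height s) evD evZ intrN mulNr.
    by rewrite subrK.
  have := UP _ (slice_sub sx); rewrite (slice_height sx) evD evZ.
  apply: le_trans; rewrite lerD2l ler_wpM2l ?ler0z //; exact: Umax.
Qed.

End Slices.
End MutationOfSimplex.

(** * Rigidity of a mutation from a simplex to a simplex *)

Section MutationBetweenSimplices.
Local Open Scope classical_set_scope.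
Local Open Scope ring_scope.

Variables (n : nat) (v q : 'I_n.+1 -> 'rV[int]_n)
  (u u' : 'I_n.+1 -> 'cV[rat]_n) (b b' : 'I_n.+1 -> rat).
Hypotheses (vub : barycentric (vertQ v) u b) (qub : barycentric (vertQ q) u' b').
Variables (w : 'cV[int]_n) (F : set 'rV[rat]_n).
Local Notation P := (conv_hull (range (vertQ v))).
Local Notation Q := (conv_hull (range (vertQ q))).
Hypothesis mut : is_mutation w F P Q.
Local Notation hv i := (height w (v i)).

Lemma factor_height0 x : F x -> ev (toQ w) x = 0.
Proof. by have [_ [[_ _ +] _]] := mut; apply. Qed.

Lemma point_mutation f : (forall x, F x -> x = f) -> polytope_iso P Q.
Proof.
move=> Ff; have [_ [[[s Fs] [f1 Ff1] _] _]] := mut.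
have f1E := Ff _ Ff1; rewrite {}f1E {f1} in Ff1.
have [fz fzE] : exists fz, f = toQ fz.
  have := Ff1; rewrite {1}Fs => -[[|m] [c [p [_ c1 ps _]]]].
    by move: c1; rewrite big_ord0 => /eqP; rewrite eq_sym oner_eq0.
  have /Ff <- : F (p ord0) by rewrite Fs; apply: conv_hull_in; exact: ps.
  by have [z _ <-] := ps ord0; exists z.
have fw0 : fz *m w = 0.
  have := factor_height0 Ff1; rewrite fzE ev_toQ => /eqP; rewrite intr_eq0 => /eqP h0.
  by apply/matrixP => i j; rewrite !ord1 [RHS]mxE.
have shE x : x *m toQ (1%:M + w *m fz) = x + ev (toQ w) x *: f.
  rewrite toQD toQ1 toQM mulmxDr mulmx1 mulmxA [x *m _]mx11_scalar.
  by rewrite mul_scalar_mx fzE.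
(* The inverse of this shear is [1%:M - w *m fz], since [fz *m w = 0]. *)
exists (1%:M + w *m fz).
  have : (1%:M + w *m fz) *m (1%:M - w *m fz) = 1%:M.
    rewrite mulmxDl !mulmxBr !mul1mx mulmx1 mulmxA -(mulmxA w) fw0 mulmx0 mul0mx.
    by rewrite subr0 subrK.
  by case/mulmx1_unit.
have [_ dneg dpos dsup] := mutation_data vub mut.
apply/seteqP; split=> [x Qx|_ [x Px <-]]; last first.
  rewrite -(bary_sum vub x) mulmx_suml.
  rewrite (eq_bigr (fun i => (ev (u i) x + b i) *: (vertQ v i *m toQ (1%:M + w *m fz)))).
    2: by move=> i _; rewrite scalemxAl.
  have b0 := (simplexP vub x).1 Px.
  have vQ i : Q (vertQ v i *m toQ (1%:M + w *m fz)).
    rewrite shE ev_toQ; have [hi|hi] := ltP (hv i) 0; last exact: dpos.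
    by have [phi [/Ff -> //]] := dneg _ hi.
  apply/(simplexP qub) => k.
  rewrite ev_sum -[b' k]mul1r -(bary_sum1 vub x) mulr_suml -big_split /=.
  apply: sumr_ge0 => i _; rewrite evZ -mulrDr mulr_ge0 //.
  exact: (simplexP qub _).1.
exists (x - ev (toQ w) x *: f); last first.
  by rewrite shE evB evZ (factor_height0 Ff1) mulr0 subr0 subrK.
apply/(simplexP vub) => i.
(* [U] is chosen so that U(x) + w(x) U(f) = - u_i(x): the duality then carries the i-th facet
   inequality of [P] to the sheared simplex. *)
pose U := (-1) *: u i + ev (u i) f *: toQ w.
have := dsup U f (b i) Ff1; rewrite !evDu !evZu (factor_height0 Ff1) => /(_ _ _ x Qx) h.
suff : -1 * ev (u i) x + ev (u i) f * ev (toQ w) x <= b i.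
  by rewrite evB evZ; lra.
rewrite -evZu -evZu -evDu; apply: h => [psi /Ff -> //|y Py].
  by rewrite !evDu !evZu (factor_height0 Ff1).
rewrite evDu !evZu.
by have := (simplexP vub y).1 Py i; lra.
Qed.

(** In the labelling by [s], the label [j0] goes to the point onto which the bottom face collapses,
    and each label in [A] to a translate of the top vertex. With this crossed labelling the weights
    on [A] turn out unchanged. *)
Definition mutation_shape : Prop :=
  exists (s : {perm 'I_n.+1}) (j0 : 'I_n.+1) (A : {set 'I_n.+1})
    (H h0 : int) (f : 'I_n.+1 -> 'rV[int]_n),
  [/\ (1 < #|A|)%N, 0 < H /\ 0 < h0, hv j0 = h0, forall i, i \in A -> hv i = - H
    & forall i, i \notin A -> i != j0 -> hv i = 0] /\
  [/\ forall i, i \in A -> height w (f i) = 0,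
      forall i, i \in A -> q (s j0) = v i - H *: f i,
      forall i, i \in A -> q (s i) = v j0 + h0 *: f i
    & forall i, i \notin A -> i != j0 -> q (s i) = v i].

Hypothesis F2 : exists x y, [/\ F x, F y & x <> y].

(** The linear parts sum to zero, so they are all nonnegative only on the zero direction. *)
Lemma min_unique x y :
  (forall j, ev (u j) x <= ev (u j) y) -> y = x.
Proof.
move=> le; apply/eqP; rewrite -subr_eq0; apply/eqP/(bary_inj vub).
have ge0 j : true -> 0 <= ev (u j) (y - x) by rewrite evB subr_ge0.
by move=> j; apply: (psumr_eq0P ge0 (bary_lin0 vub _)).
Qed.

Let hmin := hv [arg min_(i < ord0) hv i]%O.
Let B := [set i | hv i == hmin]%SET.

Hypotheses (neg : exists i, hv i < 0) (pos : exists i, 0 < hv i).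

Lemma hmin_le i : hmin <= hv i.
Proof. by rewrite /hmin; case: arg_minP => //= j _ ->. Qed.

Lemma hmin_lt0 : hmin < 0.
Proof. by have [i] := neg; apply: le_lt_trans (hmin_le i). Qed.

#[local] Hint Resolve hmin_le hmin_lt0 : core.

Lemma bottomE i : i \in B -> hv i = hmin.
Proof. by rewrite inE => /eqP. Qed.

Lemma minimizer_exists : exists phi : 'I_n.+1 -> 'rV[rat]_n, forall i, hv i < 0 ->
  [/\ F (phi i), Q (vertQ v i + (hv i)%:~R *: phi i) &
      forall psi, F psi -> P (vertQ v i + (hv i)%:~R *: (phi i - psi))].
Proof.
suff /choice [phi phiH] : forall i, exists f, hv i < 0 -> [/\ F f,
    Q (vertQ v i + (hv i)%:~R *: f) &
    forall psi, F psi -> P (vertQ v i + (hv i)%:~R *: (f - psi))] by exists phi.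
move=> i; have [_ dneg _ _] := mutation_data vub mut.
by case: (ltP (hv i) 0) => [/dneg [f ?]|_]; [exists f|exists 0].
Qed.

Section Phi.
Variable phi : 'I_n.+1 -> 'rV[rat]_n.
Hypothesis phiH : forall i, hv i < 0 ->
  [/\ F (phi i), Q (vertQ v i + (hv i)%:~R *: phi i) &
      forall psi, F psi -> P (vertQ v i + (hv i)%:~R *: (phi i - psi))].

(** The point of [P] supplied by [phiH] has j-th coordinate [h_i u_j(phi_i - psi)], with
    [h_i < 0]. *)
Lemma phi_min i psi j : hv i < 0 -> F psi -> j != i -> ev (u j) (phi i) <= ev (u j) psi.
Proof.
move=> hi Fpsi ji; have [_ _ /(_ _ Fpsi)/(simplexP vub)/(_ j)] := phiH hi.
rewrite evD (bary_vert vub) (negbTE ji) evZ evB sub0r addrAC addNr add0r.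
by rewrite nmulr_rge0 ?ltrz0 // subr_le0.
Qed.

Lemma minimizer_in i : i \in B -> F (phi i).
Proof. by move/bottomE => h; have [|] := phiH (i := i); rewrite ?h ?hmin_lt0. Qed.

Lemma bottom_neg i : i \in B -> hv i < 0.
Proof. by move/bottomE => ->; exact: hmin_lt0. Qed.

(** For [d = psi - phi i], the terms [u_k(d) (h_k - hmin)] are nonnegative: at [k = i] the second
    factor vanishes, elsewhere [phi_min] applies. Their sum is [w(d) - hmin * 0 = 0], so each is
    zero. *)
Lemma phi_off i psi j : i \in B -> F psi -> j \notin B -> ev (u j) (phi i) = ev (u j) psi.
Proof.
move=> iB Fpsi jB; set d := psi - phi i.
have ge0 k : true -> 0 <= ev (u k) d * ((hv k)%:~R - hmin%:~R).
  move=> _; have [->|ki] := eqVneq k i; first by rewrite (bottomE iB) subrr mulr0.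
  rewrite mulr_ge0 ?subr_ge0 ?ler_int // evB subr_ge0; apply: phi_min => //.
  exact: bottom_neg.
have s0 : \sum_k ev (u k) d * ((hv k)%:~R - hmin%:~R) = 0 :> rat.
  under eq_bigr do rewrite mulrBr.
  rewrite sumrB -mulr_suml (bary_lin0 vub) mul0r subr0.
  have dw : ev (toQ w) d = 0 by rewrite evB !factor_height0 ?subrr //; exact: minimizer_in.
  transitivity (ev (toQ w) (\sum_k ev (u k) d *: vertQ v k)).
    by rewrite ev_sum; apply: eq_bigr => k _; rewrite evZ ev_toQ.
  by rewrite (bary_lin vub).
have /eqP := psumr_eq0P ge0 s0 (i := j) isT.
rewrite mulf_eq0 subr_eq0 eqr_int; move: jB; rewrite inE => /negbTE ->.
by rewrite orbF evB subr_eq0 => /eqP.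
Qed.

(** Off the bottom, [u i] is constant on [F] by [phi_off]; then [phi i] would minimise every
    coordinate and [F] would be a point. *)
Lemma neg_in_B i : hv i < 0 -> i \in B.
Proof.
move=> hi; apply: contraT => iB; have [x [y [Fx Fy xy]]] := F2.
have [i0 i0B] : exists i0, i0 \in B.
  by exists [arg min_(i < ord0) hv i]%O; rewrite inE.
have all_eq psi : F psi -> psi = phi i.
  move=> Fpsi; apply: min_unique => j; have [->|ji] := eqVneq j i.
    have [Fi _ _] := phiH hi.
    by rewrite -(phi_off i0B Fi iB) -(phi_off i0B Fpsi iB).
  exact: phi_min.
by case: xy; rewrite (all_eq x) // (all_eq y).
Qed.

Lemma phi_eq i i' j : i \in B -> i' \in B -> j != i -> j != i' ->
  ev (u j) (phi i) = ev (u j) (phi i').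
Proof.
move=> iB i'B ji ji'; apply/le_anti/andP.
by split; apply: phi_min => //; [exact: bottom_neg|exact: minimizer_in|exact: bottom_neg|exact: minimizer_in].
Qed.

Let spread i i' := ev (u i) (phi i) - ev (u i) (phi i').

Lemma spread_sym i i' : i \in B -> i' \in B -> i != i' -> spread i i' = spread i' i.
Proof.
move=> iB i'B ii'; have := bary_lin0 vub (phi i - phi i').
rewrite (bigD1 i) //= (bigD1 i') 1?eq_sym //= big1; last first.
  by move=> k /andP[ki ki']; rewrite evB (phi_eq iB i'B) ?subrr.
by rewrite !evB /spread; lra.
Qed.

Lemma spread_eq i i' i'' : i \in B -> i' \in B -> i'' \in B -> i != i' -> i != i'' ->
  spread i i' = spread i i''.
Proof. by move=> iB i'B i''B h h'; rewrite /spread (phi_eq i'B i''B). Qed.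

Lemma two_in_B i : i \in B -> exists2 j, j \in B & i != j.
Proof.
move=> iB; have [j /andP[]|no] := pickP (fun j => (j \in B) && (i != j)).
  by exists j.
have [x [y [Fx Fy xy]]] := F2.
have off psi j : F psi -> j != i -> ev (u j) (psi - phi i) = 0.
  move=> Fpsi ji; rewrite evB -(phi_off iB Fpsi) ?subrr //.
  by apply/negP => jB; have := no j; rewrite jB eq_sym ji.
have all_eq psi : F psi -> psi = phi i.
  move=> Fpsi; apply: min_unique => j; have [->|ji] := eqVneq j i.
    have := bary_lin0 vub (psi - phi i); rewrite (bigD1 i) //= big1.
      by rewrite addr0 evB => /eqP; rewrite subr_eq0 => /eqP ->.
    by move=> k; exact: off.
  by apply: phi_min => //; exact: bottom_neg.
by case: xy; rewrite (all_eq x) // (all_eq y).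
Qed.

(** Two minimisers differ only in their own two coordinates, by opposite amounts. This amount is
    symmetric in the pair and, by [spread_eq], does not depend on the second index, so it is one
    constant; were it zero, [F] would be a point. *)
Lemma homothety : exists2 c, 0 < c & forall i i' j, i \in B -> i' \in B ->
  ev (u j) (phi i) - ev (u j) (phi i') = c * ((j == i)%:R - (j == i')%:R).
Proof.
pose i0 := [arg min_(i < ord0) hv i]%O.
have i0B : i0 \in B by rewrite inE.
have [i1 i1B i01] := two_in_B i0B.
have cE i i' : i \in B -> i' \in B -> i != i' -> spread i i' = spread i0 i1.
  move=> iB i'B ii'; have [ei|ni] := eqVneq i i0.
    by rewrite -ei; apply: spread_eq => //; rewrite ei.
  rewrite (@spread_eq _ i' i0) // (@spread_sym i i0) //.
  by apply: spread_eq => //; rewrite eq_sym.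
exists (spread i0 i1).
  have ge0 : 0 <= spread i0 i1.
    by rewrite subr_ge0; apply: phi_min => //; [exact: bottom_neg|exact: minimizer_in].
  rewrite lt_neqAle ge0 andbT eq_sym subr_eq0.
  apply/negP => /eqP e; have [x [y [Fx Fy xy]]] := F2.
  have all_eq psi : F psi -> psi = phi i0.
    move=> Fpsi; apply: min_unique => j; have [->|ji] := eqVneq j i0.
      by rewrite e; apply: phi_min => //; exact: bottom_neg.
    by apply: phi_min => //; exact: bottom_neg.
  by case: xy; rewrite (all_eq x) // (all_eq y).
move=> i i' j iB i'B; have [->|ii'] := eqVneq i i'; first by rewrite !subrr mulr0.
have [->|ji] := eqVneq j i.
  by rewrite (negbTE ii') subr0 mulr1; exact: cE.
have [->|ji'] := eqVneq j i'.
  by rewrite sub0r mulrN1 -opprB; congr (- _); apply: cE => //; rewrite eq_sym.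
by rewrite (phi_eq iB i'B) // !subrr mulr0.
Qed.

Variable c : rat.
Hypotheses (c0 : 0 < c) (phi_c : forall i i' j, i \in B -> i' \in B ->
  ev (u j) (phi i) - ev (u j) (phi i') = c * ((j == i)%:R - (j == i')%:R)).

Lemma phi_diff i i' : i \in B -> i' \in B ->
  phi i - phi i' = c *: (vertQ v i - vertQ v i').
Proof.
move=> iB i'B; apply/eqP; rewrite -subr_eq0; apply/eqP/(bary_inj vub) => j.
by rewrite evB evB phi_c // evZ evB !(bary_vert vub); ring.
Qed.

Let pt j i := vertQ v j + (hv j)%:~R *: phi i.
(** The pairs for which [pt j i] is known to lie in [Q]: a bottom vertex is paired only with its own
    minimiser, any other vertex with all of them. *)
Let good j i := (i \in B) && ((j \notin B) || (j == i)).

Lemma height_ge0 j : j \notin B -> 0 <= hv j.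
Proof. by move=> jB; rewrite leNgt; apply: contra jB; exact: neg_in_B. Qed.

Lemma ptQ j i : good j i -> Q (pt j i).
Proof.
case/andP=> iB /orP[jB|/eqP ->]; last by have [] := phiH (bottom_neg iB).
have [_ _ dpos _] := mutation_data vub mut.
by apply: dpos; [exact: height_ge0|exact: minimizer_in].
Qed.

Lemma pt_height j i : i \in B -> ev (toQ w) (pt j i) = (hv j)%:~R.
Proof. by move=> iB; rewrite evD evZ ev_toQ factor_height0 ?mulr0 ?addr0 //; exact: minimizer_in. Qed.

Lemma argmin_bottom : [arg min_(i < ord0) hv i]%O \in B.
Proof. by rewrite inE. Qed.

#[local] Hint Resolve argmin_bottom : core.

(* The functional [U + U(phi_s) w], for [s] maximising [U(phi_i)], is bounded on
   [P] by the maximum of [U] over the points [pt j i]. *)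
Lemma pt_sup U : exists j i, good j i /\ forall x, Q x -> ev U x <= ev U (pt j i).
Proof.
pose is_ := [arg max_(i > [arg min_(i < ord0) hv i]%O in B) ev U (phi i)]%O.
have [sB smax] : is_ \in B /\ forall i, i \in B -> ev U (phi i) <= ev U (phi is_).
  by rewrite /is_; case: arg_maxP; [exact: argmin_bottom|].
(* Expand [psi - phi is_] in the vertices. For [j] in [B] other than [is_] the coefficient is
   nonnegative by [phi_min], while [U(v_j) - U(v_is_)] has the sign of [U(phi_j) - U(phi_is_)] by
   [phi_diff]; off [B] the coefficient vanishes. *)
have Fmax psi : F psi -> ev U psi <= ev U (phi is_).
  move=> Fpsi; rewrite -subr_le0 -evB -(bary_lin vub (psi - phi is_)) ev_sum.
  have -> : \sum_j ev U (ev (u j) (psi - phi is_) *: vertQ v j) =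
      \sum_j ev (u j) (psi - phi is_) * (ev U (vertQ v j) - ev U (vertQ v is_)).
    under [RHS]eq_bigr do rewrite mulrBr.
    rewrite sumrB -mulr_suml (bary_lin0 vub) mul0r subr0.
    by apply: eq_bigr => j _; rewrite evZ.
  apply: sumr_le0 => j _; have [->|js] := eqVneq j is_; first by rewrite subrr mulr0.
  have [jB|jB] := boolP (j \in B); last first.
    by rewrite evB (phi_off sB Fpsi) // subrr mul0r.
  rewrite mulr_ge0_le0 //.
    by rewrite evB subr_ge0; apply: phi_min => //; exact: bottom_neg.
  have : ev U (phi j - phi is_) <= 0 by rewrite evB subr_le0 smax.
  by rewrite phi_diff // evZ evB pmulr_rle0.
pose p0 := ([arg min_(i < ord0) hv i]%O, [arg min_(i < ord0) hv i]%O).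
pose ps := [arg max_(p > p0 | good p.1 p.2) ev U (pt p.1 p.2)]%O.
have [gps psmax] : good ps.1 ps.2 /\
    forall j i, good j i -> ev U (pt j i) <= ev U (pt ps.1 ps.2).
  rewrite /ps; case: arg_maxP => [|p gp pm]; first by rewrite /good argmin_bottom eqxx orbT.
  by split=> // j i ji; exact: (pm (j, i)).
exists ps.1, ps.2; split=> //; have [_ _ _ dsup] := mutation_data vub mut.
apply: (dsup U (phi is_)) => //; first exact: minimizer_in.
move=> x Px; rewrite [_ * ev U _]mulrC -evZu -evDu; move: x Px.
apply: conv_hull_le => _ [j _ <-]; rewrite evDu evZu ev_toQ mulrC.
have [jB|jB] := boolP (j \in B); last first.
  rewrite -evZ -evD; apply: (psmax j is_).
  by rewrite /good sB jB.
apply: le_trans (psmax j j _); last by rewrite /good jB eqxx orbT.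
by rewrite evD evZ lerD2l ler_wnM2l ?lerz0 ?smax // ltW // bottom_neg.
Qed.

(** The k-th coordinate of [Q] reaches 1 at [q k], hence at the maximising [pt j i]; a point of [Q]
    where it is at least 1 is that vertex. *)
Lemma vert_pt k : exists j i, good j i /\ vertQ q k = pt j i.
Proof.
have [j [i [g h]]] := pt_sup (u' k); exists j, i; split=> //; apply/esym.
apply: (bary_vertE (i := k) qub) => [l|]; first exact: ((simplexP qub _).1 (ptQ g)).
have := h _ (vert_in q k); rewrite (bary_vert qub) eqxx mulr1n; lra.
Qed.

Lemma pt_expose U j i : good j i ->
  (forall j' i', good j' i' -> ev U (pt j' i') <= ev U (pt j i)) ->
  (forall j' i', good j' i' -> ev U (pt j' i') = ev U (pt j i) -> pt j' i' = pt j i) ->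
  exists k, vertQ q k = pt j i.
Proof.
move=> g le eq; suff [k _ <-] : range (vertQ q) (pt j i) by exists k.
apply: (conv_hull_exposed (u := U)); last exact: ptQ.
  by move=> _ [k _ <-]; have [j' [i' [g' ->]]] := vert_pt k; exact: le.
by move=> _ [k _ <-]; have [j' [i' [g' ->]]] := vert_pt k; exact: eq.
Qed.

(** For distinct [i], [j] in [B], the point [v_i + hmin (phi_i - phi_j)] of [P] has i-th coordinate
    [1 + hmin c]. *)
Lemma collapse_ge : -1 <= hmin%:~R * c.
Proof.
have [j jB ij] := two_in_B argmin_bottom.
have [_ _ /(_ _ (minimizer_in jB))] := phiH (bottom_neg argmin_bottom).
move/(simplexP vub)/(_ [arg min_(i < ord0) hv i]%O).
rewrite evD (bary_vert vub) eqxx evZ evB phi_c ?argmin_bottom // eqxx (negbTE ij).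
rewrite -/hmin mulr1n mulr0n; lra.
Qed.

(** The multiple of [w] cancels [h_j U(phi i)], which leaves only a difference of minimisers, known
    from [phi_c]. *)
Lemma shift_ev U i j i' : i' \in B ->
  ev (U + (- ev U (phi i)) *: toQ w) (pt j i') =
  ev U (vertQ v j) + (hv j)%:~R * (ev U (phi i') - ev U (phi i)).
Proof. by move=> i'B; rewrite evDu evZu pt_height // evD evZ; ring. Qed.

Lemma notin_bottom_neq i j : i \in B -> j \notin B -> (j == i) = false.
Proof. by move=> iB jB; apply/negP => /eqP e; move: jB; rewrite e iB. Qed.

Lemma good_cases j i : good j i -> i \in B /\ (j \notin B \/ j = i).
Proof. by case/andP=> iB /orP[|/eqP]; auto. Qed.

(* The exposing functional is [2 l_j + l_i], with [l] the linear parts of the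
   barycentric coordinates, corrected by a multiple of [w]. *)
Lemma top_vert j i : 0 < hv j -> i \in B -> exists k, vertQ q k = pt j i.
Proof.
move=> hj iB; have jB : j \notin B.
  by apply: contraL hj => /bottomE ->; rewrite -leNgt ltW.
pose U := 2 *: u j + u i.
have UE j' i' : i' \in B -> ev (U + (- ev U (phi i)) *: toQ w) (pt j' i') =
    2 * (j == j')%:R + (i == j')%:R + (hv j')%:~R * (c * ((i == i')%:R - 1))
    - 2 * b j - b i.
  move=> i'B; rewrite shift_ev // /U !evDu !evZu !(bary_vert vub).
  have := phi_c j i'B iB; have := phi_c i i'B iB.
  rewrite eqxx (notin_bottom_neq i'B jB) (notin_bottom_neq iB jB) mulr0n mulr1n subr0 mulr0 => e1 /eqP.
  rewrite subr_eq0 => /eqP ->; rewrite -e1; ring.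
have UE0 : ev (U + (- ev U (phi i)) *: toQ w) (pt j i) = 2 - 2 * b j - b i.
  by rewrite UE // !eqxx eq_sym (notin_bottom_neq iB jB) mulr0n mulr1n; ring.
have hcj : 0 < (hv j)%:~R * c by rewrite mulr_gt0 ?ltr0z.
have lt j' i' : good j' i' -> (j', i') <> (j, i) ->
   ev (U + (- ev U (phi i)) *: toQ w) (pt j' i') < 2 - 2 * b j - b i.
  move=> /good_cases[i'B [j'B|->]] ne; rewrite UE //.
    rewrite [i == j']eq_sym (notin_bottom_neq iB j'B) mulr0n.
    have hj' : 0 <= (hv j')%:~R * c.
      by rewrite mulr_ge0 ?ler0z ?height_ge0 // ltW.
    have [ej|nj] := eqVneq j j'; have [ei|ni] := eqVneq i i'; rewrite ?mulr0n ?mulr1n.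
    - by case: ne; rewrite ej ei.
    - rewrite -ej; lra.
    - lra.
    - lra.
  rewrite (notin_bottom_neq i'B jB) mulr0n (bottomE i'B).
  have := collapse_ge; have [ei|ni] := eqVneq i i'; rewrite ?mulr0n ?mulr1n; lra.
apply: (@pt_expose (U + (- ev U (phi i)) *: toQ w)).
- by rewrite /good iB jB.
- move=> j' i' g; rewrite UE0; have [[-> ->]|ne] := pselect ((j', i') = (j, i)).
    by rewrite UE0.
  exact/ltW/lt.
- move=> j' i' g; rewrite UE0; have [[-> ->] //|ne] := pselect ((j', i') = (j, i)).
  by have := lt _ _ g ne => + e; rewrite e ltxx.
Qed.

Lemma bottom_vert i : -1 < hmin%:~R * c -> i \in B -> exists k, vertQ q k = pt i i.
Proof.
move=> hc1 iB.
have UE j' i' : i' \in B -> ev (u i + (- ev (u i) (phi i)) *: toQ w) (pt j' i') =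
    (i == j')%:R + (hv j')%:~R * (c * ((i == i')%:R - 1)) - b i.
  move=> i'B; rewrite shift_ev // phi_c // eqxx (bary_vert vub) mulr1n; ring.
have UE0 : ev (u i + (- ev (u i) (phi i)) *: toQ w) (pt i i) = 1 - b i.
  by rewrite UE // !eqxx mulr1n; ring.
have lt j' i' : good j' i' -> (j', i') <> (i, i) ->
   ev (u i + (- ev (u i) (phi i)) *: toQ w) (pt j' i') < 1 - b i.
  move=> /good_cases[i'B [j'B|->]] ne; rewrite UE //.
    rewrite [i == j']eq_sym (notin_bottom_neq iB j'B) mulr0n.
    have hj' : 0 <= (hv j')%:~R * c.
      by rewrite mulr_ge0 ?ler0z ?height_ge0 // ltW.
    by have [ei|ni] := eqVneq i i'; rewrite ?mulr0n ?mulr1n; lra.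
  rewrite (bottomE i'B); have [ei|ni] := eqVneq i i'; rewrite ?mulr0n ?mulr1n; last by lra.
  by case: ne; rewrite -ei.
apply: (@pt_expose (u i + (- ev (u i) (phi i)) *: toQ w)).
- by rewrite /good iB eqxx orbT.
- move=> j' i' g; rewrite UE0; have [[-> ->]|ne] := pselect ((j', i') = (i, i)).
    by rewrite UE0.
  exact/ltW/lt.
- move=> j' i' g; rewrite UE0; have [[-> ->] //|ne] := pselect ((j', i') = (i, i)).
  by have := lt _ _ g ne => + e; rewrite e ltxx.
Qed.

(** The linear part of coordinate [k1] is 1 on the left; on the right it is positive only if
    [k1 = k3]. *)
Lemma edge_parallel k1 k2 k3 k4 x : 0 < x -> k1 != k2 ->
  vertQ q k1 - vertQ q k2 = x *: (vertQ q k3 - vertQ q k4) -> k1 = k3.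
Proof.
move=> x0 n12 /(congr1 (ev (u' k1))); rewrite evZ !evB !(bary_vert qub) eqxx.
rewrite (negbTE n12); have [//|n13] := eqVneq k1 k3.
by case: (k1 == k4); rewrite ?mulr0n ?mulr1n => h; exfalso; lra.
Qed.

Lemma pt_inj j i i' : i \in B -> i' \in B -> hv j != 0 -> i != i' -> pt j i <> pt j i'.
Proof.
move=> iB i'B hj ii' /addrI /(scalerI _).
rewrite intr_eq0 => /(_ hj) e; have := phi_c i iB i'B.
by rewrite e subrr eqxx (negbTE ii') subr0 mulr1 => e0; move: c0; rewrite -e0 ltxx.
Qed.

Lemma ptB j i i' : i \in B -> i' \in B ->
  pt j i - pt j i' = ((hv j)%:~R * c) *: (vertQ v i - vertQ v i').
Proof.
by move=> iB i'B; rewrite /pt opprD addrACA subrr add0r -scalerBr phi_diff // scalerA.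
Qed.

Lemma ptBB i i' : i \in B -> i' \in B ->
  pt i i - pt i' i' = (1 + hmin%:~R * c) *: (vertQ v i - vertQ v i').
Proof.
move=> iB i'B; rewrite /pt !bottomE // opprD addrACA -scalerBr phi_diff // scalerA.
by rewrite scalerDl scale1r.
Qed.

(** Otherwise [Q] has an edge at height [hmin] and one at positive height, both positive multiples
    of the same [v_i0 - v_i]; by [edge_parallel] they would share an endpoint. *)
Lemma collapse_eq : hmin%:~R * c = -1.
Proof.
apply/eqP; rewrite eq_le collapse_ge andbT leNgt; apply/negP => hc1.
have [j hj] := pos; have [i iB ni] := two_in_B argmin_bottom.
set i0 := [arg min_(i < ord0) hv i]%O in ni; have i0B : i0 \in B := argmin_bottom.
have [k1 e1] := bottom_vert hc1 i0B; have [k2 e2] := bottom_vert hc1 iB.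
have [k3 e3] := top_vert hj i0B; have [k4 e4] := top_vert hj iB.
have n34 : k3 != k4.
  apply/eqP => e; apply: (pt_inj i0B iB _ ni (j := j)); first by rewrite gt_eqF.
  by rewrite -e3 -e4 e.
have hcj : 0 < (hv j)%:~R * c by rewrite mulr_gt0 ?ltr0z.
pose x := (hv j)%:~R * c / (1 + hmin%:~R * c).
have x0 : 0 < x by rewrite divr_gt0 //; lra.
have := edge_parallel x0 n34 (k3 := k1) (k4 := k2); rewrite e1 e2 e3 e4.
have -> : pt j i0 - pt j i = x *: (pt i0 i0 - pt i i).
  by rewrite ptB // ptBB // scalerA divfK // gt_eqF //; lra.
move=> /(_ erefl) e; have := pt_height j i0B; rewrite -e3 e e1 pt_height // => /eqP.
by rewrite eqr_int bottomE // => /eqP e'; have := hmin_lt0; rewrite e'; lia.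
Qed.

(** Each positive vertex yields an edge of [Q] parallel to a fixed bottom edge of [P]. The two edges
    share an endpoint, which fixes first the height and then the vertex. *)
Lemma top_uniq j j' : 0 < hv j -> 0 < hv j' -> j = j'.
Proof.
move=> hj hj'; have [i iB ni] := two_in_B argmin_bottom.
set i0 := [arg min_(i < ord0) hv i]%O in ni; have i0B : i0 \in B := argmin_bottom.
have [k1 e1] := top_vert hj i0B; have [k2 e2] := top_vert hj iB.
have [k3 e3] := top_vert hj' i0B; have [k4 e4] := top_vert hj' iB.
have n12 : k1 != k2.
  apply/eqP => e; apply: (pt_inj i0B iB _ ni (j := j)); first by rewrite gt_eqF.
  by rewrite -e1 -e2 e.
have x0 : 0 < (hv j)%:~R / (hv j')%:~R :> rat by rewrite divr_gt0 ?ltr0z.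
have := edge_parallel x0 n12 (k3 := k3) (k4 := k4); rewrite e1 e2 e3 e4.
have -> : pt j i0 - pt j i = ((hv j)%:~R / (hv j')%:~R) *: (pt j' i0 - pt j' i).
  by rewrite !ptB // scalerA mulrA divfK // intr_eq0 gt_eqF.
move=> /(_ erefl) e; have e' : pt j i0 = pt j' i0 by rewrite -e1 e e3.
have hh : hv j = hv j'.
  by apply/eqP; rewrite -(eqr_int rat) -(pt_height j i0B) e' pt_height.
move: e'; rewrite /pt hh => /addIr; exact: (bary_vert_inj vub).
Qed.

(** Minimising all other coordinates, [phi i] is the unique maximiser of [u i] on [F], hence one of
    the lattice points spanning [F]. *)
Lemma phi_int i : i \in B -> exists f, phi i = toQ f.
Proof.
move=> iB; have [_ [[[s Fs] _ _] _]] := mut.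
have inF y : [set toQ f | f in [set` s]] y -> F y.
  by move=> sy; rewrite Fs; apply: conv_hull_in.
have le j psi : F psi -> j != i -> ev (u j) (phi i) <= ev (u j) psi.
  by move=> Fpsi ji; apply: phi_min => //; exact: bottom_neg.
have max psi : F psi -> ev (u i) psi <= ev (u i) (phi i).
  move=> Fpsi; have := bary_lin0 vub (psi - phi i); rewrite (bigD1 i) //= evB.
  have : 0 <= \sum_(j | j != i) ev (u j) (psi - phi i).
    by apply: sumr_ge0 => j ji; rewrite evB subr_ge0 le.
  by set t := bigop _ _ _; lra.
suff [f _ <-] : [set toQ f | f in [set` s]] (phi i) by exists f.
apply: (conv_hull_exposed (u := u i)); last by rewrite -Fs; exact: minimizer_in.
  by move=> y /inF; exact: max.
move=> y /inF Fy e; apply: min_unique => j; have [->|ji] := eqVneq j i.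
  by rewrite e.
exact: le.
Qed.

Lemma shape_of_phi : mutation_shape.
Proof.
have [j0 hj0] := pos; have [i1 i1B ni] := two_in_B argmin_bottom.
set i0 := [arg min_(i < ord0) hv i]%O in ni; have i0B : i0 \in B := argmin_bottom.
have j0B : j0 \notin B by apply: contraL hj0 => /bottomE ->; rewrite -leNgt ltW.
have [f fP] : exists f : 'I_n.+1 -> 'rV[int]_n, forall i, i \in B -> phi i = toQ (f i).
  suff /choice [f fP] : forall i, exists z, i \in B -> phi i = toQ z by exists f.
  by move=> i; have [/phi_int[z]|_] := boolP (i \in B); [exists z|exists 0].
have hz i : i \notin B -> i != j0 -> hv i = 0.
  move=> iB ij; apply/eqP; rewrite eq_le height_ge0 // andbT leNgt.
  by apply: contra ij => h; apply/eqP; exact: top_uniq.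
pose tau i := if i == j0 then pt i0 i0 else if i \in B then pt j0 i else vertQ v i.
have bot i : i \in B -> pt i i = pt i0 i0.
  move=> iB; apply/eqP; rewrite -subr_eq0 ptBB // collapse_eq.
  by rewrite addrN scale0r.
(* There are only n + 1 candidates [tau] for the n + 1 distinct vertices of [Q], so [rho] is a
   permutation. *)
have [rho rhoP] : exists rho : 'I_n.+1 -> 'I_n.+1, forall k, vertQ q k = tau (rho k).
  suff /choice [rho rhoP] : forall k, exists l, vertQ q k = tau l by exists rho.
  move=> k; have [j [i [/good_cases[iB jB] ->]]] := vert_pt k.
  have [jB'|jB'] := boolP (j \in B).
    case: jB => [|->]; first by rewrite jB'.
    by exists j0; rewrite /tau eqxx bot.
  have [ej|nj] := eqVneq j j0.
    by exists i; rewrite /tau ej iB eq_sym (notin_bottom_neq iB j0B).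
  exists j; rewrite /tau (negbTE nj) (negbTE jB') /pt hz //.
  by rewrite scale0r addr0.
have rho_inj : injective rho.
  by move=> k l e; apply: (bary_vert_inj qub); rewrite !rhoP e.
have sE i : vertQ q ((perm rho_inj)^-1%g i) = tau i.
  by rewrite rhoP -(permE rho_inj) permKV.
exists (perm rho_inj)^-1%g, j0, B, (- hmin), (hv j0), f; split; split.
- by apply/card_gt1P; exists i0, i1.
- by rewrite oppr_gt0.
- by [].
- by move=> i /bottomE ->; rewrite opprK.
- exact: hz.
- move=> i iB; apply/eqP; rewrite -(intr_eq0 rat) -ev_toQ -fP // factor_height0 //.
  exact: minimizer_in.
- move=> i iB; apply: toQ_inj; rewrite -/(vertQ q _) sE /tau eqxx -(bot i) //.
  by rewrite /pt toQB toQZ bottomE // fP // intrN scaleNr opprK.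
- move=> i iB; apply: toQ_inj; rewrite -/(vertQ q _) sE /tau.
  by rewrite eq_sym (notin_bottom_neq iB j0B) iB /pt toQD toQZ fP.
- move=> i iB ij; apply: toQ_inj; rewrite -/(vertQ q _) sE /tau.
  by rewrite (negbTE ij) (negbTE iB).
Qed.

End Phi.

Lemma mutation_shapeP : mutation_shape.
Proof.
have [phi phiH] := minimizer_exists; have [c c0 phi_c] := homothety phiH.
exact: (@shape_of_phi phi phiH c).
Qed.

End MutationBetweenSimplices.

(** * Weights of a simplex *)

Section WeightSystems.
Local Open Scope classical_set_scope.
Local Open Scope ring_scope.

Lemma bezout_gcdn_seq (I : eqType) (r : seq I) (l : I -> nat) : uniq r ->
  exists z : I -> int, \sum_(i <- r) z i * (l i)%:Z = (\big[gcdn/0%N]_(i <- r) l i)%:Z.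
Proof.
elim: r => [|i r IHr] /=; first by exists (fun=> 0); rewrite !big_nil.
case/andP=> ir /IHr[z zE]; rewrite !big_cons.
have [x [y xy]] := Bezoutz (l i)%:Z (\big[gcdn/0%N]_(i <- r) l i)%:Z.
exists (fun j => if j == i then x else y * z j).
rewrite big_cons eqxx big_seq (eq_bigr (fun j => y * (z j * (l j)%:Z))); last first.
  by move=> j jr; case: eqP => [ej|_]; [move: ir; rewrite -ej jr|rewrite mulrA].
by rewrite -big_seq -mulr_sumr zE xy.
Qed.

Definition wps_vectors n (l : 'I_n.+1 -> nat) (v : 'I_n.+1 -> 'rV[int]_n) : Prop :=
  [/\ forall i, (0 < l i)%N, \big[gcdn/0%N]_i l i = 1%N,
      \sum_i (l i)%:Z *: v i = 0
    & forall x : 'rV[int]_n, exists c : 'I_n.+1 -> int, x = \sum_i c i *: v i].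

Lemma gcdn_big1 n (l : 'I_n.+1 -> nat) d :
  \big[gcdn/0%N]_i l i = 1%N -> (forall i, (d %| l i)%N) -> d = 1%N.
Proof.
move=> l1 dl; apply/eqP; rewrite -dvdn1 -l1.
by elim/big_rec: _ => // i x _ dx; rewrite dvdn_gcd dl.
Qed.

Lemma wps_perm n (l : 'I_n.+1 -> nat) v (s : {perm 'I_n.+1}) :
  wps_vectors l v -> wps_vectors (l \o s) (v \o s).
Proof.
move=> [l0 l1 lv gen]; split=> [i||| x] /=; first exact: l0.
- by rewrite -[RHS]l1 [RHS](reindex_inj (@perm_inj _ s)).
- by rewrite -[RHS]lv [RHS](reindex_inj (@perm_inj _ s)).
have [c ->] := gen x; exists (c \o s).
by rewrite (reindex_inj (@perm_inj _ s)).
Qed.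

Section Weights.
Variables (n : nat) (l : 'I_n.+1 -> nat) (v : 'I_n.+1 -> 'rV[int]_n).
Hypothesis lv : wps_vectors l v.

Let V : 'M[rat]_(n.+1, n) := \matrix_i vertQ v i.

Lemma mul_rowV (c : 'rV[rat]_n.+1) : c *m V = \sum_i c 0 i *: vertQ v i.
Proof. by rewrite mulmx_sum_row; apply: eq_bigr => i _; rewrite rowK. Qed.

Lemma vectors_row_full : row_full V.
Proof.
rewrite -sub1mx; apply/row_subP => i; rewrite rowE mulmx1.
have [_ _ _ gen] := lv; have [c cE] := gen (delta_mx 0 i).
have -> : delta_mx 0 i = (\row_j (c j)%:~R) *m V.
  rewrite mul_rowV; have := congr1 (@toQ 1 n) cE.
  rewrite /toQ map_delta_mx -/(toQ _) toQ_sum => ->.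
  by apply: eq_bigr => j _; rewrite toQZ mxE.
exact: submxMl.
Qed.

Lemma wps_kernel (c : 'I_n.+1 -> rat) :
  \sum_i c i *: vertQ v i = 0 -> exists t, forall i, c i = t * (l i)%:R.
Proof.
have [l0 _ lv0 _] := lv.
pose L : 'rV[rat]_n.+1 := \row_i (l i)%:R.
have LV : (L <= kermx V)%MS.
  apply/sub_kermxP; rewrite mul_rowV.
  rewrite -[RHS](toQ0 1 n) -lv0 toQ_sum.
  by apply: eq_bigr => i _; rewrite mxE toQZ.
have Lr : \rank L = 1%N.
  apply/eqP; rewrite eqn_leq rank_leq_row lt0n mxrank_eq0.
  apply/eqP => /matrixP/(_ 0 ord0); rewrite !mxE => /eqP.
  by rewrite pnatr_eq0 -leqn0 leqNgt l0.
have kr : \rank (kermx V) = 1%N.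
  by rewrite mxrank_ker (eqP vectors_row_full) subSnn.
have VL : (kermx V <= L)%MS by rewrite -(mxrank_leqif_sup LV) Lr kr.
move=> c0; have : (\row_i c i <= kermx V)%MS.
  apply/sub_kermxP; rewrite mul_rowV -[RHS]c0.
  by apply: eq_bigr => i _; rewrite mxE.
move=> /submx_trans/(_ VL)/sub_rVP[t tE]; exists t => i.
by have /matrixP/(_ 0 i) := tE; rewrite !mxE.
Qed.

Lemma wps_kernel_int (c : 'I_n.+1 -> int) :
  \sum_i c i *: v i = 0 -> exists t, forall i, c i = t * (l i)%:Z.
Proof.
move=> c0; have [_ l1 _ _] := lv.
have [|t tE] := @wps_kernel (fun i => (c i)%:~R).
  rewrite -[RHS](toQ0 1 n) -c0 toQ_sum; apply: eq_bigr => i _.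
  by rewrite toQZ.
have [z] := @bezout_gcdn_seq _ (index_enum 'I_n.+1) l (index_enum_uniq _).
(* The rational factor [t] is integral: pairing [c = t l] with Bezout coefficients [z] of the
   weights gives [t] itself. *)
rewrite l1 => zE; exists (\sum_i z i * c i) => i.
apply: (@intr_inj rat); rewrite intrM tE; congr (_ * _).
transitivity (t * (\sum_j z j * (l j)%:Z)%:~R); first by rewrite zE mulr1.
rewrite !rmorph_sum /= mulr_sumr.
by apply: eq_bigr => j _; rewrite !intrM tE mulrCA.
Qed.

(** The matrix of homogeneous coordinates [(1, v_i)] is invertible, because a relation among its
    rows is a multiple of the weights and these have positive sum. Its inverse contains the
    coordinate functions as columns. *)
Lemma wps_bary : exists u b, barycentric (vertQ v) u b.
Proof.
pose W : 'M[rat]_(n.+1, 1 + n) := row_mx (const_mx 1) V.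
have Wfree : row_free W.
  apply: inj_row_free => c; rewrite mul_mx_row -[0]row_mx0 => /eq_row_mx[c1 cV].
  move: cV; rewrite mul_rowV => /wps_kernel[t tE].
  have s0 : \sum_i c 0 i = 0.
    have := congr1 (fun M : 'M_1 => M 0 0) c1; rewrite !mxE => s1.
    by rewrite -[RHS]s1; apply: eq_bigr => i _; rewrite mxE mulr1.
  have t0 : t = 0.
    move: s0; under eq_bigr do rewrite tE.
    rewrite -mulr_sumr => /eqP; rewrite mulf_eq0 => /orP[/eqP //|].
    rewrite -natr_sum pnatr_eq0 sum_nat_eq0 => /forallP/(_ ord0) /=.
    by have [l0 _ _ _] := lv; rewrite eqn0Ngt (l0 ord0).
  by apply/rowP => i; rewrite tE t0 mul0r row_mx0 mxE.
pose Y : 'M[rat]_(1 + n, n.+1) := invmx (W : 'M_n.+1).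
have WY : W *m Y = 1%:M by apply: mulmxV; rewrite -row_free_unit.
have YW : Y *m W = 1%:M by apply: mulVmx; rewrite -row_free_unit.
exists (fun i => col i (dsubmx Y)), (fun i => usubmx Y 0 i).
pose be x : 'rV_n.+1 := row_mx 1%:M x *m Y.
have beE x i : ev (col i (dsubmx Y)) x + usubmx Y 0 i = be x 0 i.
  have -> : be x = usubmx Y + x *m dsubmx Y.
    by rewrite /be -[in LHS](vsubmxK Y) mul_row_col mul1mx.
  rewrite [in RHS]mxE addrC; congr (_ + _).
  by rewrite /ev !mxE; apply: eq_bigr => j _; rewrite mxE.
have beW x : be x *m W = row_mx 1%:M x by rewrite -mulmxA YW mulmx1.
have [be1 beV] : (forall x, be x *m const_mx 1 = 1%:M :> 'M_1) /\
    (forall x, be x *m V = x).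
  by split=> x; have := beW x; rewrite mul_mx_row => /eq_row_mx[].
split=> [x|x|i j].
- rewrite -[RHS]beV mul_rowV; by apply: eq_bigr => i _; rewrite beE.
- have := congr1 (fun M : 'M_1 => M 0 0) (be1 x); rewrite !mxE eqxx mulr1n => <-.
  by apply: eq_bigr => i _; rewrite beE [const_mx _ _ _]mxE mulr1.
rewrite beE /be.
have -> : row_mx 1%:M (vertQ v j) = row j W.
  rewrite row_row_mx rowK; congr row_mx.
  by apply/matrixP => p q; rewrite !mxE !ord1.
by rewrite -row_mul WY !mxE eq_sym.
Qed.

Lemma wps_lift : exists C : 'M[int]_(n, n.+1), C *m (\matrix_i v i) = 1%:M.
Proof.
have [_ _ _ gen] := lv.
have [C CE] : exists C : 'I_n -> 'I_n.+1 -> int,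
    forall i, delta_mx 0 i = \sum_j C i j *: v j.
  by suff /choice[C CE] : forall i, exists c : 'I_n.+1 -> int,
    delta_mx 0 i = \sum_j c j *: v j; [exists C|move=> i; exact: gen].
exists (\matrix_(i, j) C i j); apply/row_matrixP => i.
rewrite row_mul mulmx_sum_row [RHS]rowE mulmx1 CE.
by apply: eq_bigr => j _; rewrite rowK !mxE.
Qed.

(** Such a [d] is coprime to [l i], as all weights have gcd 1, and the relation makes [l_i v_i]
    divisible by [d]; so [v_i] is divisible by [d]. *)
Lemma wps_well_formed i d : primitive (v i) ->
  (forall k, k != i -> (d %| l k)%N) -> d = 1%N.
Proof.
move=> vi dl; have [l0 l1 lv0 _] := lv.
have cop : coprime d (l i).
  apply/eqP; apply: (gcdn_big1 l1) => k; have [->|ki] := eqVneq k i.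
    exact: dvdn_gcdr.
  exact: dvdn_trans (dvdn_gcdl _ _) (dl k ki).
have [y yE] : exists y, (l i)%:Z *: v i = d%:Z *: y.
  exists (- \sum_(k | k != i) (l k %/ d)%:Z *: v k).
  rewrite scalerN scaler_sumr; move: lv0; rewrite (bigD1 i) //= => /eqP.
  rewrite addr_eq0 => /eqP ->; congr (- _); apply: eq_bigr => k ki.
  by rewrite scalerA -PoszM mulnC divnK ?dl.
have [x [z xz]] := Bezoutz d%:Z (l i)%:Z.
have : gcdz d%:Z (l i)%:Z = 1 by rewrite /gcdz /= (eqP cop).
move=> g1; have /vi : v i = d%:Z *: (x *: v i + z *: y).
  rewrite scalerDr [d%:Z *: (z *: _)]scalerA mulrC -scalerA -yE !scalerA -scalerDl.
  by rewrite [_ * x]mulrC xz g1 scale1r.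
by case/orP=> /eqP; lia.
Qed.

(** Writing [f] in the generators gives a relation with coefficient [h c_a - 1] at [a] and [h c_k]
    away from the edge. It is [t] times the weights, so [h] is coprime to [t l_a] and divides
    [t l_k]. *)
Lemma edge_divisibility a b h f : a != b -> v a - v b = h%:Z *: f ->
  (forall k, k != a -> k != b -> (h %| l k)%N) /\ coprime h (l a).
Proof.
move=> ab; have [_ _ _ gen] := lv; have [c ->] := gen f => e.
pose d k := h%:Z * c k - (k == a)%:R + (k == b)%:R.
have [|t tE] := @wps_kernel_int d.
  rewrite (eq_bigr (fun k => h%:Z *: (c k *: v k) - (k == a)%:R *: v k
      + (k == b)%:R *: v k)); last first.
    by move=> k _; rewrite scalerDl scalerBl scalerA.
  rewrite big_split sumrB /= -scaler_sumr -e.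
  have pick x : \sum_k (k == x)%:R *: v k = v x.
    rewrite (bigD1 x) //= eqxx scale1r big1 ?addr0 // => k /negbTE ->.
    by rewrite scale0r.
  by rewrite !pick addrAC subrK subrr.
have tE' k : h%:Z * c k - (k == a)%:R + (k == b)%:R = t * (l k)%:Z by exact: tE.
have ha : coprimez h%:Z (t * (l a)%:Z).
  apply/coprimezP; exists (c a, -1) => /=.
  by rewrite -tE' eqxx (negbTE ab) /=; ring.
move: ha; rewrite coprimezMr => /andP[ht hla]; split=> // k ka kb.
have := tE' k; rewrite (negbTE ka) (negbTE kb) subr0 addr0 => ek.
have : (h%:Z %| t * (l k)%:Z)%Z by rewrite -ek dvdz_mulr.
by rewrite Gauss_dvdzr.
Qed.

End Weights.
End WeightSystems.

Section WeightsUnderMutation.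
Local Open Scope classical_set_scope.
Local Open Scope ring_scope.

Lemma polytope_iso_sym n (P Q : set 'rV[rat]_n) : polytope_iso P Q -> polytope_iso Q P.
Proof.
case=> g gu ->; exists (invmx g); first by rewrite unitmx_inv.
apply/seteqP; split=> [x Px|_ [_ [x Px <-] <-]].
  exists (x *m toQ g); first by exists x.
  by rewrite -mulmxA -toQM mulmxV // toQ1 mulmx1.
by rewrite -mulmxA -toQM mulmxV // toQ1 mulmx1.
Qed.

Lemma polytope_iso_trans n (P Q R : set 'rV[rat]_n) :
  polytope_iso P Q -> polytope_iso Q R -> polytope_iso P R.
Proof.
case=> g gu -> [h hu ->]; exists (g *m h); first by rewrite unitmx_mul gu.
apply/seteqP; split=> [_ [_ [x Px <-] <-]|_ [x Px <-]].
  by exists x => //; rewrite toQM mulmxA.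
by exists (x *m toQ g); [exists x|rewrite toQM mulmxA].
Qed.

Lemma polytope_iso_conv n (v q : 'I_n.+1 -> 'rV[int]_n) (g : 'M[int]_n) :
  (forall i, q i = v i *m g) ->
  conv_hull (range (vertQ q)) = [set x *m toQ g | x in conv_hull (range (vertQ v))].
Proof.
move=> qE; apply/seteqP; split=> [x [m [c [p [c0 c1 pr ->]]]]|_ [_ [m [c [p [c0 c1 pr ->]]]] <-]].
  have /choice[s sE] : forall i, exists k, vertQ q k = p i.
    by move=> i; have [k _ <-] := pr i; exists k.
  exists (\sum_i c i *: vertQ v (s i)); first by exists m, c, (vertQ v \o s).
  rewrite mulmx_suml; apply: eq_bigr => i _.
  by rewrite -scalemxAl -sE /vertQ -toQM -qE.
rewrite mulmx_suml; exists m, c, (fun i => p i *m toQ g); split=> //.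
  by move=> i; have [k _ <-] := pr i; exists k => //; rewrite /vertQ qE toQM.
by apply: eq_bigr => i _; rewrite -scalemxAl.
Qed.

Lemma wps_transport n (l : 'I_n.+1 -> nat) v (g : 'M[int]_n) : g \in unitmx ->
  wps_vectors l v -> wps_vectors l (fun i => v i *m g).
Proof.
move=> gu [l0 l1 lv gen]; split=> // [|x].
  under eq_bigr do rewrite scalemxAl.
  by rewrite -mulmx_suml lv mul0mx.
have [c cE] := gen (x *m invmx g); exists c.
rewrite -[x](mulmxKV gu) cE mulmx_suml.
by apply: eq_bigr => i _; rewrite scalemxAl.
Qed.

Lemma primitive_transport n (x : 'rV[int]_n) (g : 'M[int]_n) : g \in unitmx ->
  primitive x -> primitive (x *m g).
Proof.
move=> gu xp k y e; apply: (xp k (y *m invmx g)).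
by rewrite scalemxAl -e mulmxK.
Qed.

(** Lift the basis to combinations of the [v i], then map by the same combinations of the [q i]. The
    error on each [v i] is a relation among the [v], hence a multiple of the weights, hence a
    relation among the [q]. *)
Lemma wps_iso n (l : 'I_n.+1 -> nat) v q : wps_vectors l v -> wps_vectors l q ->
  exists2 g : 'M[int]_n, g \in unitmx & forall i, q i = v i *m g.
Proof.
move=> lv lq; have [C CV] := wps_lift lv; have [D DQ] := wps_lift lq.
have key (x y : 'I_n.+1 -> 'rV[int]_n) E : wps_vectors l x -> wps_vectors l y ->
    E *m (\matrix_i x i) = 1%:M ->
    (\matrix_i x i) *m (E *m (\matrix_i y i)) = \matrix_i y i.
  move=> lx ly EX; rewrite mulmxA; apply/eqP; rewrite -subr_eq0.
  rewrite -{2}[\matrix_i y i]mul1mx -mulmxBl; apply/eqP/row_matrixP => i.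
  set M := _ - _; have /(wps_kernel_int lx)[t tE] : \sum_j M i j *: x j = 0.
    have : row i M *m (\matrix_i x i) = 0.
      by rewrite -row_mul mulmxBl -mulmxA EX mulmx1 mul1mx subrr row0.
    rewrite mulmx_sum_row => e; rewrite -[RHS]e; apply: eq_bigr => j _.
    by rewrite rowK [row i M 0 j]mxE.
  rewrite row_mul mulmx_sum_row row0.
  have [_ _ ly0 _] := ly.
  rewrite -[RHS](scaler0 _ t) -[X in t *: X]ly0 scaler_sumr; apply: eq_bigr => j _.
  by rewrite rowK [row i M 0 j]mxE tE scalerA.
exists (C *m \matrix_i q i).
  have : (C *m \matrix_i q i) *m (D *m \matrix_i v i) = 1%:M.
    by rewrite -mulmxA key.
  by case/mulmx1_unit.
move=> i; have /(congr1 (row i)) := key _ _ _ lv lq CV.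
by rewrite row_mul !rowK => ->.
Qed.

Lemma height_sum n (w : 'cV[int]_n) (I : finType) (c : I -> int) (x : I -> 'rV[int]_n) :
  height w (\sum_i c i *: x i) = \sum_i c i * height w (x i).
Proof.
rewrite /height mulmx_suml summxE; apply: eq_bigr => i _.
by rewrite -scalemxAl mxE.
Qed.

Lemma heightD n (w : 'cV[int]_n) x y : height w (x + y) = height w x + height w y.
Proof. by rewrite /height mulmxDl mxE. Qed.

Lemma height0 n (w : 'cV[int]_n) : height w 0 = 0.
Proof. by rewrite /height mul0mx mxE. Qed.

Lemma heightZ n (w : 'cV[int]_n) c x : height w (c *: x) = c * height w x.
Proof. by rewrite /height -scalemxAl mxE. Qed.

Lemma heightB n (w : 'cV[int]_n) x y : height w (x - y) = height w x - height w y.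
Proof. by rewrite /height mulmxBl !mxE. Qed.

Lemma primitive_heights n (l : 'I_n.+1 -> nat) v (w : 'cV[int]_n) d :
  wps_vectors l v -> primitive w -> (forall i, (d %| height w (v i))%Z) ->
  d \is a GRing.unit.
Proof.
move=> [_ _ _ gen] wp dw.
apply: (wp d (\col_i divz (height w (delta_mx 0 i)) d)).
apply/colP => i; rewrite !mxE mulrC divzK.
  by rewrite /height -rowE mxE.
have [c ->] := gen (delta_mx 0 i).
by rewrite height_sum rpred_sum // => j _; rewrite dvdz_mull.
Qed.

(** The heights average to zero with positive weights, and they are not all zero because [w] is
    primitive and the [v i] generate. *)
Lemma heights_sign n (l : 'I_n.+1 -> nat) v (w : 'cV[int]_n) :
  wps_vectors l v -> primitive w ->
  (exists i, height w (v i) < 0) /\ (exists i, 0 < height w (v i)).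
Proof.
move=> lv wp; have [l0 _ lv0 _] := lv.
have s0 : \sum_i (l i)%:Z * height w (v i) = 0.
  by rewrite -height_sum lv0 height0.
have contra : ~ (forall i, height w (v i) = 0).
  move=> h; have /(primitive_heights lv wp) : forall i, (0 %| height w (v i))%Z.
    by move=> i; rewrite h.
  by rewrite unitr0.
have pos i : (0 < (l i)%:Z) by rewrite ltz_nat.
split.
  have [i hi|no] := pickP (fun i => height w (v i) < 0); first by exists i.
  case: contra => i.
  have ge j : true -> 0 <= (l j)%:Z * height w (v j).
    by move=> _; rewrite pmulr_rge0 // leNgt no.
  have /eqP := psumr_eq0P ge s0 (i := i) isT.
  by rewrite mulf_eq0 gt_eqF //= => /eqP.
have [i hi|no] := pickP (fun i => 0 < height w (v i)); first by exists i.
case: contra => i.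
have ge j : true -> 0 <= - ((l j)%:Z * height w (v j)).
  by move=> _; rewrite oppr_ge0 pmulr_rle0 // leNgt no.
have sN : \sum_i - ((l i)%:Z * height w (v i)) = 0 by rewrite sumrN s0 oppr0.
have /eqP := psumr_eq0P ge sN (i := i) isT.
by rewrite oppr_eq0 mulf_eq0 gt_eqF //= => /eqP.
Qed.

(* The weights change as in a mutation over the edge [a b], where [e] is the vertex
   of positive height; [h] and [h'] are the heights of the two ends. *)
Definition edge_mutation n (l l' : 'I_n.+1 -> nat) : Prop :=
  exists (e a b : 'I_n.+1) (h h' d : nat),
  [/\ [/\ e != a, e != b & a != b], [/\ (0 < h)%N, (0 < h')%N & coprime h h'],
      [/\ l e = (h * h * d)%N, l' e = (h' * h' * d)%N
        & (l a + l b = h * h' * d)%N],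
      [/\ l' a = l a, l' b = l b, coprime (h * h') (l a) & coprime (h * h') (l b)]
    & forall k, k != e -> k != a -> k != b ->
        (h %| l k)%N /\ (h * l' k = h' * l k)%N].

End WeightsUnderMutation.

(** * Weights before and after a mutation of the rigid shape *)

Section ShapeArithmetic.
Local Open Scope ring_scope.
Variables (n : nat) (l N : 'I_n.+1 -> nat) (v q : 'I_n.+1 -> 'rV[int]_n)
  (w : 'cV[int]_n) (j0 : 'I_n.+1) (A : {set 'I_n.+1}) (H h0 : nat)
  (f : 'I_n.+1 -> 'rV[int]_n).
Hypotheses (lv : wps_vectors l v) (Nq : wps_vectors N q) (wp : primitive w)
  (vp : primitive (v j0)) (qp : primitive (q j0)).
Hypotheses (A2 : (1 < #|A|)%N) (H0 : (0 < H)%N) (h00 : (0 < h0)%N)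
  (hj0 : height w (v j0) = h0%:Z)
  (hA : forall i, i \in A -> height w (v i) = - H%:Z)
  (hz : forall i, i \notin A -> i != j0 -> height w (v i) = 0)
  (hf : forall i, i \in A -> height w (f i) = 0)
  (qj0 : forall i, i \in A -> q j0 = v i - H%:Z *: f i)
  (qA : forall i, i \in A -> q i = v j0 + h0%:Z *: f i)
  (qz : forall i, i \notin A -> i != j0 -> q i = v i).

Lemma top_notin : j0 \notin A.
Proof. by apply/negP => /hA; rewrite hj0; lia. Qed.

Let S : int := \sum_(k in A) (N k)%:Z.

Lemma sum_bottom : \sum_(k | k != j0) (k \in A)%:R * (N k)%:Z = S.
Proof.
rewrite /S [RHS]big_mkcond [RHS](bigD1 j0) //= (negbTE top_notin) add0r.
by apply: eq_bigr => k _; case: (k \in A); rewrite ?mul1r ?mul0r.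
Qed.

(** Apply [w] to the relation among the [q]: the collapsed vertex has height [-H], the translates of
    the top have height [h0], the rest 0. *)
Lemma heights_rel : S * h0%:Z = (N j0)%:Z * H%:Z.
Proof.
have [a aA] : exists a, a \in A by apply/card_gt0P; exact: ltnW.
have [_ _ Nq0 _] := Nq; have := congr1 (height w) Nq0.
rewrite height_sum height0 (bigD1 j0) //= (qj0 aA).
rewrite heightB hA // heightZ hf // mulr0 subr0.
rewrite (eq_bigr (fun k => (k \in A)%:R * (N k)%:Z * h0%:Z)).
  by rewrite -mulr_suml sum_bottom mulrN => /eqP; rewrite addrC subr_eq0 => /eqP.
move=> k kj; have [kA|kA] := boolP (k \in A).
  by rewrite qA // heightD heightZ hf // hj0 mulr0 addr0 mul1r.
by rewrite qz // hz // mulr0 !mul0r.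
Qed.

(** Eliminating [f] gives [H q_k = h0 v_k + H v_j0 - h0 q_j0] on [A]. Substituted in [H] times the
    relation of the [q], the terms in [q_j0] cancel by [heights_rel], and a relation among the [v]
    remains. *)
Lemma weights_rel : exists t : int, [/\ S * H%:Z = t * (l j0)%:Z,
  forall k, k \in A -> h0%:Z * (N k)%:Z = t * (l k)%:Z &
  forall k, k \notin A -> k != j0 -> H%:Z * (N k)%:Z = t * (l k)%:Z].
Proof.
have [a aA] : exists a, a \in A by apply/card_gt0P; exact: ltnW.
pose c k := if k == j0 then S * H%:Z else
  if k \in A then h0%:Z * (N k)%:Z else H%:Z * (N k)%:Z.
have [|t tE] := wps_kernel_int lv (c := c).
  have [_ _ Nq0 _] := Nq; have : H%:Z *: (\sum_i (N i)%:Z *: q i) = 0.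
    by rewrite Nq0 scaler0.
  rewrite (bigD1 j0) //= scalerDr scaler_sumr.
  rewrite (eq_bigr (fun k => c k *: v k + ((k \in A)%:R * (N k)%:Z) *:
     (H%:Z *: v j0 - h0%:Z *: q j0))); last first.
    move=> k kj; rewrite /c (negbTE kj); have [kA|kA] := boolP (k \in A).
      rewrite qA // (qj0 kA) mul1r scalerBr !scalerDr !scalerN !scalerA.
      by apply/rowP => i; rewrite !mxE; ring.
    by rewrite qz // mul0r scale0r addr0 scalerA.
  rewrite big_split /= -scaler_suml sum_bottom => e.
  rewrite -[RHS]e (bigD1 j0) //= {1}/c eqxx.
  have := heights_rel => hr; apply/rowP => i; rewrite !mxE.
  have -> : H%:Z * ((N j0)%:Z * q j0 0 i) = S * h0%:Z * q j0 0 i by rewrite hr; ring.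
  ring.
exists t; split=> [|k kA|k kA kj]; rewrite -tE /c ?eqxx //.
  by rewrite kA; case: eqP => // e; move: top_notin; rewrite -e kA.
by rewrite (negbTE kA) (negbTE kj).
Qed.

Lemma bottom_edge a b : a \in A -> b \in A -> v a - v b = H%:Z *: (f a - f b).
Proof.
move=> aA bA; have := qj0 aA; rewrite (qj0 bA) => /eqP.
rewrite subr_eq addrAC eq_sym subr_eq => /eqP e.
apply/eqP; rewrite subr_eq scalerBr; apply/eqP.
rewrite -[LHS](addrK (H%:Z *: f b)).
move: e; set x := _ *: f a; set y := _ *: f b.
by move=> e; rewrite e; apply/rowP => i; rewrite !mxE; ring.
Qed.

Lemma top_edge a b : a \in A -> b \in A -> q a - q b = h0%:Z *: (f a - f b).
Proof. by move=> aA bA; rewrite !qA // opprD addrACA subrr add0r scalerBr. Qed.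

Lemma coprime_heights : coprime H h0.
Proof.
have u : (gcdn H h0)%:Z \is a GRing.unit.
  apply: (primitive_heights lv wp) => i.
  have [iA|iA] := boolP (i \in A).
    by rewrite hA // dvdzE /= abszN dvdn_gcdl.
  have [->|ij] := eqVneq i j0; first by rewrite hj0 dvdzE /= dvdn_gcdr.
  by rewrite hz // dvdz0.
by rewrite /coprime; case/orP: u => /eqP // [->].
Qed.

Lemma shape_weights : (forall k, N k = l k) \/ edge_mutation l N.
Proof.
have [t [t0 tA tz]] := weights_rel; have hr := heights_rel.
have [l0 l1 _ _] := lv; have [N0 N1 _ _] := Nq.
have Sge : 0 <= S by apply: sumr_ge0.
have tge : 0 <= t.
  by rewrite -(pmulr_lge0 _ (x := (l j0)%:Z)) ?ltz_nat // -t0 mulr_ge0.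
have [tn tnE] : exists tn : nat, t = tn%:Z by exists `|t|%N; lia.
rewrite {}tnE {tge} in t0 tA tz.
have [A3|A3] := ltnP 2 #|A|; [left|right].
  have [a [b [c [[aA bA cA] [ab bc ca]]]]] := card_gt2P A3.
  have cb : c != b by rewrite eq_sym.
  have H1 : H = 1%N.
    have [d _] := edge_divisibility lv ab (bottom_edge aA bA).
    have [_ cop] := edge_divisibility lv ca (bottom_edge cA aA).
    by move: cop; rewrite /coprime (gcdn_idPl (d c ca cb)) => /eqP.
  have h1 : h0 = 1%N.
    have [d _] := edge_divisibility Nq ab (top_edge aA bA).
    have [_ cop] := edge_divisibility Nq ca (top_edge cA aA).
    by move: cop; rewrite /coprime (gcdn_idPl (d c ca cb)) => /eqP.
  have NE k : N k = (tn * l k)%N.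
    apply/eqP; rewrite -eqz_nat; apply/eqP; rewrite PoszM.
    have [kA|kA] := boolP (k \in A); first by have := tA k kA; rewrite h1 mul1r.
    have [->|kj] := eqVneq k j0; last by have := tz k kA kj; rewrite H1 mul1r.
    by rewrite -t0 H1; move: hr; rewrite h1 H1 !mulr1.
  have t1 : tn = 1%N by apply: (gcdn_big1 N1) => i; rewrite NE dvdn_mulr.
  by move=> k; rewrite NE t1 mul1n.
have /cards2P[a [b [ab AE]]] : #|A| == 2%N by rewrite eqn_leq A3 A2.
have aA : a \in A by rewrite AE !inE eqxx.
have bA : b \in A by rewrite AE !inE eqxx orbT.
have SE : S = (N a + N b)%N%:Z.
  by rewrite /S AE big_setU1 ?inE //= big_set1 PoszD.
have notA k : k != a -> k != b -> k \notin A.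
  by rewrite AE !inE => /negbTE -> /negbTE ->.
have ja : j0 != a by apply: contraNneq top_notin => ->.
have jb : j0 != b by apply: contraNneq top_notin => ->.
have ba : b != a by rewrite eq_sym.
have {}t0 : ((N a + N b) * H = tn * l j0)%N by move: t0; rewrite SE; lia.
have {}hr : ((N a + N b) * h0 = N j0 * H)%N by move: hr; rewrite SE; lia.
have ta : (h0 * N a = tn * l a)%N by have := tA a aA; lia.
have tb : (h0 * N b = tn * l b)%N by have := tA b bA; lia.
have {tA}tz k : k != j0 -> k != a -> k != b -> (H * N k = tn * l k)%N.
  by move=> kj ka kb; have := tz k (notA k ka kb) kj; lia.
have [dl cla] := edge_divisibility lv ab (bottom_edge aA bA).
have [_ clb] := edge_divisibility lv ba (bottom_edge bA aA).
have [dN cNa] := edge_divisibility Nq ab (top_edge aA bA).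
have [_ cNb] := edge_divisibility Nq ba (top_edge bA aA).
have tn0 : (0 < tn)%N by have := muln_gt0 h0 (N a); rewrite ta h00 N0 muln_gt0 => /andP[].
(* Reduce [tn / h0] to lowest terms [x / y]; the aim is [x = y = 1]. *)
have [d0 dE] : (0 < gcdn tn h0)%N /\ exists t' h', [/\ tn = (t' * gcdn tn h0)%N,
    h0 = (h' * gcdn tn h0)%N & coprime t' h'].
  split; first by rewrite gcdn_gt0 tn0.
  exists (tn %/ gcdn tn h0)%N, (h0 %/ gcdn tn h0)%N.
  rewrite !divnK ?dvdn_gcdl ?dvdn_gcdr //; split=> //.
  rewrite /coprime -(eqn_pmul2r (m := gcdn tn h0)) ?gcdn_gt0 ?tn0 // muln_gcdl.
  by rewrite !divnK ?dvdn_gcdl ?dvdn_gcdr // mul1n.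
have [x [y [xE yE xy]]] := dE; set d := gcdn tn h0 in d0 xE yE {dE}.
have red m1 m2 : (h0 * m1 = tn * m2)%N -> (y * m1 = x * m2)%N.
  by rewrite xE yE -!mulnA ![(d * _)%N]mulnC !mulnA => /eqP; rewrite eqn_pmul2r // => /eqP.
have ra := red _ _ ta; have rb := red _ _ tb.
have rz k : k != j0 -> k != a -> k != b ->
    exists lk, l k = (lk * H)%N /\ N k = (tn * lk)%N.
  move=> kj ka kb; have /dvdnP[lk lkE] := dl k ka kb; exists lk; split=> //.
  have := tz k kj ka kb; rewrite lkE mulnA [RHS]mulnC => /eqP.
  by rewrite eqn_pmul2l // => /eqP.
(* [y] divides every weight of [P] except possibly that of [j0], and [x] every weight of [Q] except
   possibly that of [j0]; primitivity of [v j0] and [q j0] excludes both. *)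
have y1 : y = 1%N.
  apply: (wps_well_formed lv vp) => k kj; have yx : coprime y x by rewrite coprime_sym.
  have [->|ka] := eqVneq k a; first by rewrite -(Gauss_dvdr _ yx) -ra dvdn_mulr.
  have [->|kb] := eqVneq k b; first by rewrite -(Gauss_dvdr _ yx) -rb dvdn_mulr.
  have [lk [-> NkE]] := rz k kj ka kb; apply: dvdn_mulr.
  have := dN k ka kb; rewrite NkE {1}yE {1}xE [(x * d)%N]mulnC -mulnA [(y * d)%N]mulnC.
  by rewrite dvdn_pmul2l // Gauss_dvdr.
have x1 : x = 1%N.
  apply: (wps_well_formed Nq qp) => k kj.
  have [->|ka] := eqVneq k a; first by rewrite -(Gauss_dvdr _ xy) ra dvdn_mulr.
  have [->|kb] := eqVneq k b; first by rewrite -(Gauss_dvdr _ xy) rb dvdn_mulr.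
  have [lk [_ ->]] := rz k kj ka kb; rewrite xE -mulnA; exact: dvdn_mulr.
have th : tn = h0 by rewrite xE yE x1 y1.
have Na : N a = l a by move: ra; rewrite x1 y1 !mul1n.
have Nb : N b = l b by move: rb; rewrite x1 y1 !mul1n.
have cH := coprime_heights.
have /dvdnP[E EE] : (H %| l j0)%N.
  by rewrite -(Gauss_dvdr _ cH) -th -t0 dvdn_mull.
have sE : (l a + l b = h0 * E)%N.
  move: t0; rewrite EE th Na Nb mulnA => /eqP; rewrite eqn_pmul2r // => /eqP //.
have /dvdnP[D DE] : (H %| E)%N.
  have : (H %| h0 * h0 * E)%N.
    by rewrite -mulnA -sE -Na -Nb mulnC hr dvdn_mull.
  by rewrite Gauss_dvdr // coprimeMr cH.
exists j0, a, b, H, h0, D; split; [by split|by split| | |].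
- split; first by rewrite EE DE; ring.
  + have : (N j0 * H = h0 * h0 * D * H)%N by rewrite -hr Na Nb sE DE; ring.
    by move/eqP; rewrite eqn_pmul2r // => /eqP.
  + by rewrite sE DE; ring.
- by split; rewrite // coprimeMl ?cla ?clb -?Na -?Nb ?cNa ?cNb.
- move=> k kj ka kb; split; first exact: dl.
  by rewrite tz // th.
Qed.

End ShapeArithmetic.

Section MutationsOfWeights.
Local Open Scope classical_set_scope.
Local Open Scope ring_scope.

Lemma range_perm n (q : 'I_n.+1 -> 'rV[int]_n) (s : {perm 'I_n.+1}) :
  range (vertQ (q \o s)) = range (vertQ q).
Proof.
apply/seteqP; split=> _ [k _ <-]; first by exists (s k).
by exists ((s^-1)%g k) => //; rewrite /vertQ /= permKV.
Qed.

Lemma same_weights_iso n (l m : 'I_n.+1 -> nat) v q (s : {perm 'I_n.+1}) :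
  wps_vectors l v -> wps_vectors m q -> (forall k, m (s k) = l k) ->
  polytope_iso (conv_hull (range (vertQ v))) (conv_hull (range (vertQ q))).
Proof.
move=> lv mq e; have lq : wps_vectors l (q \o s).
  by have := wps_perm s mq; congr wps_vectors; apply/funext => k /=; rewrite e.
have [g gu gE] := wps_iso lv lq; exists g => //.
by rewrite -(polytope_iso_conv gE) range_perm.
Qed.

Lemma wps_polytopeP n (l : n.+1.-tuple nat) P : is_wps_polytope l P ->
  exists v, [/\ P = conv_hull (range (vertQ v)), wps_vectors (tnth l) v
              & forall i, primitive (v i)].
Proof.
case=> v [[PE [_ _ _ vertP]] l0 l1 lv gen]; exists v.
have vl : wps_vectors (tnth l) v by split.
split=> // i; have [u [b vub]] := wps_bary vl.
have [|x xp /toQ_inj -> //] := vertP (vertQ v i).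
by rewrite PE; apply/(extreme_vert vub); exists i.
Qed.

Lemma wps_polytope_perm n (l m : n.+1.-tuple nat) P : perm_eq l m ->
  is_wps_polytope l P -> is_wps_polytope m P.
Proof.
rewrite perm_sym => /tuple_permP[s mE] [v [[PE Pf] l0 l1 lv gen]].
have vl : wps_vectors (tnth l) v by split.
have [m0 m1 mv mgen] := wps_perm s vl.
have mT i : tnth m i = tnth l (s i).
  by rewrite (_ : m = [tuple tnth l (s i) | i < n.+1]) ?tnth_mktuple //; apply: val_inj.
exists (v \o s); split=> //.
- by split=> //; rewrite PE -(range_perm v s).
- by move=> i; rewrite mT; exact: m0.
- by rewrite -[RHS]m1; apply: eq_bigr => i _; rewrite mT.
- by rewrite -[RHS]mv; apply: eq_bigr => i _; rewrite mT.
Qed.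

(** The change of basis is absorbed into the vertices [q]. Equal weights up to order would give
    isomorphic simplices by [wps_iso], so neither a one-point factor nor the weight-preserving
    alternative can occur. *)
Lemma wps_mutation_edge n (l m : n.+1.-tuple nat) : wps_mutation l m ->
  ~ perm_eq l m /\
  exists s : {perm 'I_n.+1}, edge_mutation (tnth l) (tnth m \o s).
Proof.
move=> [P [Q [/wps_polytopeP[v [-> lv vp]] /wps_polytopeP[q0 [QE mq0 q0p]]
  [w [F [Q' [mut [g gu Q'E]]]]] niso]]].
pose q i := q0 i *m g; have mq : wps_vectors (tnth m) q by exact: wps_transport.
have qp i : primitive (q i) by exact: primitive_transport.
have {}Q'E : Q' = conv_hull (range (vertQ q)).
  by rewrite Q'E QE -(polytope_iso_conv (q := q)).
have {}niso : ~ polytope_iso (conv_hull (range (vertQ v))) Q'.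
  move=> h; apply: niso; apply: polytope_iso_trans h _; apply: polytope_iso_sym.
  by exists g => //; rewrite Q'E QE -(polytope_iso_conv (q := q)).
have nsame (s : {perm 'I_n.+1}) : ~ (forall k, tnth m (s k) = tnth l k).
  by move=> e; apply: niso; rewrite Q'E; exact: same_weights_iso lv mq e.
split.
  move=> /tuple_permP[s lE]; apply: (nsame s) => k.
  rewrite [in RHS](_ : l = [tuple tnth m (s i) | i < n.+1]) ?tnth_mktuple //.
  exact: val_inj.
rewrite {}Q'E in mut niso.
have [u [b vub]] := wps_bary lv; have [u' [b' qub]] := wps_bary mq.
have wp : primitive w by case: mut.
have [neg pos] := heights_sign lv wp.
have F2 : exists x y, [/\ F x, F y & x <> y].
  have [_ [[_ [f Ff] _] _]] := mut; apply: contrapT => no; apply: niso.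
  apply: (point_mutation vub qub mut (f := f)) => x Fx.
  by apply: contrapT => xf; apply: no; exists x, f.
have [s [j0 [A [H [h0 [f [[A2 [H0 h00] hj hA hz] [hf qj0 qA qz]]]]]]]] :=
  mutation_shapeP vub qub mut F2 neg pos.
exists s; have mqs := wps_perm s mq.
case: H H0 hA qj0 => [H|//] H0 hA qj0; case: h0 h00 hj qA => [h0|//] h00 hj qA.
have [||e|//] := shape_weights lv mqs wp (vp j0) (qp (s j0)) A2 _ _ hj hA hz hf qj0 qA qz.
- by [].
- by [].
by case: (nsame s).
Qed.

End MutationsOfWeights.

(** * Sylvester numbers and the branches *)

Section Sylvester.
Local Open Scope nat_scope.

Lemma sylvester_predE m : sylvester_pred m = \prod_(i < m) sylvester i.
Proof. by rewrite /sylvester_pred sylvesterE add1n subn1. Qed.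

Lemma sylvester_gt1 m : 1 < sylvester m.
Proof.
rewrite sylvesterE add1n ltnS; elim/big_ind: _ => // [x y|i _].
  by rewrite muln_gt0 => -> ->.
by case: (nat_of_ord i) => [|j] //=; rewrite add1n.
Qed.

Lemma sylvester_coprime i j : i != j -> coprime (sylvester i) (sylvester j).
Proof.
wlog ij : i j / i < j => [h|_].
  by rewrite neq_ltn => /orP[ij|ji]; [|rewrite coprime_sym]; apply: h; rewrite // neq_ltn ?ij ?ji.
rewrite [sylvester j]sylvesterE (bigD1 (Ordinal ij)) //=.
by rewrite /coprime addnC mulnC gcdnMDl gcdn1.
Qed.

Definition cofactor_syl n j := sylvester_pred n.-1 %/ sylvester j.

Section Cofactors.
Variable n : nat.
Local Notation cof := (cofactor_syl n).

Lemma sylvester_dvd j : j < n.-1 -> sylvester j %| sylvester_pred n.-1.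
Proof. by move=> jn; rewrite sylvester_predE (bigD1 (Ordinal jn)) //= dvdn_mulr. Qed.

Lemma cofE j : j < n.-1 -> cof j * sylvester j = sylvester_pred n.-1.
Proof. by move=> jn; rewrite divnK // sylvester_dvd. Qed.

Lemma cof_gt0 j : j < n.-1 -> 0 < cof j.
Proof.
move=> jn; rewrite divn_gt0 ?(ltnW (sylvester_gt1 _)) // dvdn_leq ?sylvester_dvd //.
by rewrite sylvester_predE prodn_gt0 // => i; apply: ltnW (sylvester_gt1 _).
Qed.

Lemma cof_dvd i j : i < n.-1 -> j < n.-1 -> i != j -> sylvester i %| cof j.
Proof.
move=> inn jn ij; rewrite -(Gauss_dvdl _ (sylvester_coprime ij)) cofE //.
exact: sylvester_dvd.
Qed.

Lemma cof_coprime j : j < n.-1 -> coprime (sylvester j) (cof j).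
Proof.
move=> jn; have -> : cof j = \prod_(i < n.-1 | i != j :> nat) sylvester i.
  apply/eqP; rewrite -(eqn_pmul2r (ltnW (sylvester_gt1 j))) cofE //.
  by rewrite sylvester_predE (bigD1 (Ordinal jn)) //= mulnC.
elim/big_rec: _ => [|i x ij cx]; first exact: coprimen1.
by rewrite coprimeMr cx sylvester_coprime // eq_sym.
Qed.

Lemma cof_inj i j : i < n.-1 -> j < n.-1 -> cof i = cof j -> i = j.
Proof.
move=> inn jn e; apply/eqP; apply: contraT => ij.
have := cof_coprime inn; rewrite e => c; have := cof_dvd inn jn ij.
move: c; rewrite /coprime => /eqP c d; move: c; rewrite (gcdn_idPl d).
by have := sylvester_gt1 i; lia.
Qed.

Lemma cof_gt4 j : 5 <= n -> j < n.-1 -> 4 < cof j.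
Proof.
move=> n5 jn; have [->|j3] := eqVneq j 3.
  have : sylvester 2 %| cof 3 by apply: cof_dvd => //; lia.
  move/dvdn_leq; rewrite cof_gt0; last by lia.
  by move=> /(_ isT); apply: leq_trans.
have : sylvester 3 %| cof j by apply: cof_dvd => //; [lia|rewrite eq_sym].
move/dvdn_leq; rewrite cof_gt0 // => /(_ isT); apply: leq_trans.
by [].
Qed.

End Cofactors.

(* The pair (r_m, r_{m+1} - r_m), where r_0 = r_1 = 1 and
   r_{m+2} = (L + 2) r_{m+1} - r_m; differences avoid the subtraction. *)
Definition branch_step L (p : nat * nat) := (p.1 + p.2, p.2 + L * (p.1 + p.2)).
Definition branch L m := (iter m (branch_step L) (1, 0)).1.
Definition branch_diff L m := (iter m (branch_step L) (1, 0)).2.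

Section Branch.
Variable L : nat.
Local Notation r := (branch L).
Local Notation d := (branch_diff L).

Lemma branchS m : r m.+1 = r m + d m. Proof. by []. Qed.
Lemma branch_diffS m : d m.+1 = d m + L * r m.+1. Proof. by []. Qed.

Lemma branch_gt0 m : 0 < r m.
Proof. by elim: m => // m IH; rewrite branchS addn_gt0 IH. Qed.

Lemma branch_rec m : r m.+2 + r m = (L + 2) * r m.+1.
Proof. by rewrite branchS branch_diffS !branchS; ring. Qed.

(** The invariant of the recursion: [r_m] and [r_{m+2}] are the two roots of X^2 - (L + 2) r_{m+1} X
    + r_{m+1}^2 + L, with sum [branch_rec] and product [branch_prod]. *)
Lemma branch_quad m : r m.+1 ^ 2 + r m ^ 2 + L = (L + 2) * (r m * r m.+1).
Proof.
elim: m => [|m IH]; first by rewrite /branch /=; ring.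
have h := branch_rec m.
have e2 : (L + 2) * r m.+1 * r m.+2 = r m.+2 ^ 2 + r m * r m.+2 by rewrite -h; ring.
have e1 : (L + 2) * (r m * r m.+1) = r m * r m.+2 + r m ^ 2.
  by rewrite mulnCA -h; ring.
lia.
Qed.

Lemma branch_prod m : r m * r m.+2 = L + r m.+1 ^ 2.
Proof.
have h := branch_rec m; have q := branch_quad m.
have e1 : (L + 2) * (r m * r m.+1) = r m * r m.+2 + r m ^ 2.
  by rewrite mulnCA -h; ring.
lia.
Qed.

Lemma branch_coprime m : coprime (r m) (r m.+1).
Proof.
have h : coprime (r m) (d m).
  elim: m => [|m IH]; first by rewrite /branch /= /coprime gcd1n.
  rewrite branch_diffS /coprime addnC gcdnMDl -/(coprime _ _) branchS.
  by rewrite coprime_sym /coprime gcdnDr gcdnC.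
by rewrite branchS /coprime gcdnDl.
Qed.

(** All differences are divisible by [L], so every term is 1 modulo [L]. *)
Lemma branch_coprimeL m : coprime (r m) L.
Proof.
have [] : r m = 1 %[mod L] /\ L %| d m; last first.
  by move=> h _; rewrite /coprime gcdnC -gcdn_modr h gcdn_modr gcdn1.
elim: m => [//|m [IH1 IH2]]; split.
  by rewrite branchS -modnDmr (eqP IH2) addn0.
by rewrite branch_diffS dvdn_addr // dvdn_mulr.
Qed.

(** Modulo [L + 2] the recursion reads [r_{m+2} = - r_m]. *)
Lemma branch_coprimeL2 m : coprime (r m) (L + 2).
Proof.
have [//] : coprime (r m) (L + 2) /\ coprime (r m.+1) (L + 2).
elim: m => [|m [IH1 IH2]]; first by rewrite /branch /= /coprime gcd1n.
split=> //; rewrite /coprime; set g := gcdn _ _.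
have gl : g %| L + 2 by exact: dvdn_gcdr.
have : g %| (L + 2) * r m.+1 by exact: dvdn_mulr.
rewrite -branch_rec dvdn_addr ?dvdn_gcdl // => gr.
by rewrite -dvdn1 -(eqP IH1) dvdn_gcd gr.
Qed.

Lemma branch_coprime2 m : coprime (r m) (r m.+2).
Proof.
have h := branch_rec m.
have : coprime (r m) ((L + 2) * r m.+1).
  by rewrite coprimeMr branch_coprimeL2 branch_coprime.
by rewrite -h /coprime gcdnDr.
Qed.

Lemma branch_gt1 m : 0 < L -> 0 < m -> r m < r m.+1 /\ 1 < r m.+1.
Proof.
move=> L0; case: m => // m _; rewrite [r m.+2]branchS branch_diffS.
have := branch_gt0 m.+1; nia.
Qed.

End Branch.
End Sylvester.

(** * Exchanges on a branch *)

Section Classification.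
Local Open Scope nat_scope.

Definition branch_weight L (c : nat -> nat) m i :=
  match i with
  | 0 => branch L m ^ 2
  | 1 => L
  | 2 => branch L m.+1 ^ 2
  | _ => c i * (branch L m * branch L m.+1)
  end.

Lemma branch_mul_divK L m c :
  c * (branch L m * branch L m.+1) * (L + branch L m.+1 ^ 2) %/ branch L m ^ 2
  = c * (branch L m.+1 * branch L m.+2).
Proof.
rewrite -branch_prod; set x := branch L m; set y := branch L m.+1.
set z := branch L m.+2; rewrite (_ : _ * _ = c * (y * z) * x ^ 2); last by ring.
by rewrite mulnK // expn_gt0 branch_gt0.
Qed.

Lemma lambdaE n a k m i : lambda n a k m i =
  branch_weight (cofactor_syl n a) (fun i => cofactor_syl n (k i)) m i.
Proof.
elim: m i => [|m IH] [|[|[|i]]] //=; rewrite ?muln1 ?IH //=.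
- rewrite -branch_prod expnMn mulKn // expn_gt0 branch_gt0 //.
- exact: branch_mul_divK.
Qed.

Lemma lambda_exactP n a k m : a < n.-1 -> (forall i, 3 <= i <= n -> k i < n.-1) ->
  lambda_exact n a k m.
Proof.
move=> an kn; split.
- exact: sylvester_dvd.
- by move=> i /kn; exact: sylvester_dvd.
- by rewrite !lambdaE /= -branch_prod expnMn dvdn_mulr.
case=> [|[|[|i]]] // _; rewrite !lambdaE [branch_weight _ _ _ i.+3]/=.
rewrite [branch_weight _ _ _ 0]/= [branch_weight _ _ _ 1]/= [branch_weight _ _ _ 2]/=.
rewrite -branch_prod; set x := branch _ m; set y := branch _ m.+1.
rewrite (_ : _ * _ = cofactor_syl n (k i.+3) * (y * branch (cofactor_syl n a) m.+2) * x ^ 2).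
  exact: dvdn_mull.
by ring.
Qed.

Section NatEdges.
Variables (n : nat) (W : nat -> nat) (e a b h h' d : nat).
Hypotheses (We : W e = h * h * d) (Wab : W a + W b = h * h' * d).
Hypotheses (ca : coprime (h * h') (W a)) (cb : coprime (h * h') (W b)).

Lemma common_dvd_exchange x : x %| W a -> x %| W b -> x %| W e.
Proof.
move=> xa xb; have : x %| h * h' * d by rewrite -Wab dvdn_add.
rewrite Gauss_dvdr; first by rewrite We => /dvdn_mull ->.
by rewrite coprime_sym; apply: coprime_dvdr ca.
Qed.

Lemma prime_dvd_exchange p : prime p -> p %| W e -> p %| W a + W b.
Proof.
move=> pp; rewrite We Wab !Euclid_dvdM // => /orP[/orP[]|] ->; rewrite ?orbT //.
Qed.

Lemma prime_of_dvd x y : 1 < x -> x %| y -> y = W e ->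
  exists p, [/\ prime p, p %| x & p %| W a + W b].
Proof.
move=> x1 xy yE; exists (pdiv x); have pp := pdiv_prime x1; split=> //.
  exact: pdiv_dvd.
by apply: prime_dvd_exchange => //; rewrite -yE; apply: dvdn_trans xy; exact: pdiv_dvd.
Qed.

(** With [q = x / h] one has [d = q^2] and [y = h' q], so [q] divides the coprime numbers [x] and
    [y]. *)
Lemma edge_solve x y : W e = x ^ 2 -> W a + W b = x * y -> 0 < x -> coprime x y ->
  [/\ h = x, d = 1 & h' = y].
Proof.
move=> ex exy x0 cxy; have hx : h %| x.
  by rewrite -(dvdn_pexp2r _ _ (isT : 0 < 2)) -ex We -mulnn dvdn_mulr.
have /dvdnP[q qE] := hx.
have h0 : 0 < h by move: x0; rewrite qE muln_gt0 => /andP[].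
have dq : d = q ^ 2.
  apply/eqP; rewrite -(eqn_pmul2l (m := h * h)) ?muln_gt0 ?h0 // -We ex qE.
  by apply/eqP; ring.
have yq : h' * q = y.
  case: (posnP q) => [q0|q0]; first by move: x0; rewrite qE q0.
  apply/eqP; rewrite -(eqn_pmul2l (m := h * q)) ?muln_gt0 ?h0 //.
  by rewrite mulnC mulnA -[h * q]mulnC -qE -exy Wab dq; apply/eqP; ring.
have q1 : q = 1.
  apply/eqP; rewrite -dvdn1 -(eqP cxy) dvdn_gcd qE dvdn_mulr //= -yq.
  exact: dvdn_mull.
by split; [rewrite qE q1 mul1n|rewrite dq q1|rewrite -yq q1 muln1].
Qed.

End NatEdges.

Section BranchEdges.
Variables (n a : nat) (k : nat -> nat) (m : nat).
Hypotheses (n5 : 5 <= n) (an : a < n.-1) (m0 : 0 < m).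
Hypotheses (kn : forall i, 3 <= i <= n -> k i < n.-1)
  (ka : forall i, 3 <= i <= n -> k i != a)
  (k_inj : forall i j, 3 <= i <= n -> 3 <= j <= n -> k i = k j -> i = j).
Local Notation L := (cofactor_syl n a).
Local Notation c i := (cofactor_syl n (k i)).
Local Notation W := (branch_weight L (fun i => c i) m).
Local Notation y i := (sylvester (k i)).
Local Notation r := (branch L m).
Local Notation s := (branch L m.+1).

Lemma branch_weight_tail i : 3 <= i -> W i = c i * (r * s).
Proof. by case: i => [|[|[|i]]]. Qed.

Lemma sylvester_dvd_L i : 3 <= i <= n -> y i %| L.
Proof. by move=> hi; apply: cof_dvd; rewrite ?kn ?ka. Qed.

Lemma sylvester_dvd_cof i j : 3 <= i <= n -> 3 <= j <= n -> i != j -> y i %| c j.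
Proof.
move=> hi hj ij; apply: cof_dvd; rewrite ?kn //.
by apply: contra ij => /eqP/(k_inj hi hj) ->.
Qed.

Lemma sylvester_dvd_weight i j : 3 <= i <= n -> 3 <= j <= n -> i != j -> y i %| W j.
Proof.
move=> hi hj ij; rewrite branch_weight_tail; last by case/andP: hj.
by rewrite dvdn_mulr // sylvester_dvd_cof.
Qed.

Lemma dvdL_not_dvd_branch x q : 1 < x -> x %| L -> ~~ (x %| branch L q).
Proof.
move=> x1 xL; apply/negP => xr; have : x %| gcdn (branch L q) L by rewrite dvdn_gcd xr.
by rewrite (eqP (branch_coprimeL L q)) dvdn1; lia.
Qed.

Lemma next_branch_gt1 : 1 < s.
Proof. by have [] := branch_gt1 (m := m) (cof_gt0 an) m0. Qed.

Lemma third_index i j : 3 <= i <= n -> 3 <= j <= n ->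
  exists l, [/\ 3 <= l <= n, l != i & l != j].
Proof.
move=> hi hj.
have [l3|] := boolP ((3 != i) && (3 != j)).
  by exists 3; case/andP: l3; split=> //; lia.
have [l4|] := boolP ((4 != i) && (4 != j)).
  by exists 4; case/andP: l4; split=> //; lia.
by exists 5; split; lia.
Qed.

Lemma other_index i : 3 <= i <= n -> exists l, [/\ 3 <= l <= n & l != i].
Proof. by move=> hi; have [l [? ? _]] := third_index hi hi; exists l. Qed.

Variables (e f g h h' d : nat).
Hypotheses (en : e <= n) (fn : f <= n) (gn : g <= n) (fg : f < g)
  (ef : e != f) (eg : e != g).
Hypotheses (We : W e = h * h * d) (Wfg : W f + W g = h * h' * d).
Hypotheses (cf : coprime (h * h') (W f)) (cg : coprime (h * h') (W g)).

Lemma prime_dvd_sqr p x : prime p -> p %| x ^ 2 -> p %| x.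
Proof. by move=> pp; rewrite Euclid_dvdX // => /andP[]. Qed.

(** Two tests exclude most triples: a common divisor of [W f] and [W g] divides [W e], and a divisor
    of [W e] above 1 has a prime factor dividing [W f + W g]. They are fed with [s] and with [y l],
    which divides [L] and every tail weight but the l-th, and is coprime to [r] and [s]. *)
Lemma branch_edges :
  [/\ e = 0, f = 1, g = 2 & [/\ h = r, d = 1 & h' = branch L m.+2]] \/
  [/\ e = 2, f = 0, g = 1 & [/\ h = s, d = 1 & h' = branch L m.-1]].
Proof.
have cd := common_dvd_exchange We Wfg cf.
have pd x (x1 : 1 < x) (xe : x %| W e) := prime_of_dvd We Wfg x1 xe erefl.
have y1 i : 1 < y i := sylvester_gt1 _.
have s1 := next_branch_gt1; have crs := branch_coprime L m.
have pL p : prime p -> p %| L -> (p %| r) = false /\ (p %| s) = false.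
  move=> pp pL; split; apply/negbTE; apply: dvdL_not_dvd_branch => //; exact: prime_gt1.
have yL p i : prime p -> p %| y i -> 3 <= i <= n -> (p %| r) = false /\ (p %| s) = false.
  by move=> pp py hi; apply: pL => //; apply: dvdn_trans py (sylvester_dvd_L hi).
have prs p : prime p -> p %| s -> (p %| r) = false.
  move=> pp ps; apply/negP => pr; have : p %| gcdn r s by rewrite dvdn_gcd pr.
  by rewrite (eqP crs) dvdn1; have := prime_gt1 pp; lia.
have yc p i : prime p -> p %| y i -> 3 <= i <= n -> (p %| c i) = false.
  move=> pp py hi; apply/negP => pc; have : p %| gcdn (y i) (c i) by rewrite dvdn_gcd py.
  by rewrite (eqP (cof_coprime (kn hi))) dvdn1; have := prime_gt1 pp; lia.
have WgE : 3 <= g -> W g = c g * (r * s) := @branch_weight_tail g.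
have WfE : 3 <= f -> W f = c f * (r * s) := @branch_weight_tail f.
have WeE : 3 <= e -> W e = c e * (r * s) := @branch_weight_tail e.
have W0 : W 0 = r ^ 2 by [].
have W1 : W 1 = L by [].
have W2 : W 2 = s ^ 2 by [].
have nr p : prime p -> (p %| r) = false -> (p %| r ^ 2) = false.
  by move=> pp pr; apply/negP => /(prime_dvd_sqr pp); rewrite pr.
have pc p i : prime p -> p %| y i -> 3 <= i <= n -> p %| c i * (r * s) -> False.
  move=> pp py hi; have [pr ps] := yL p i pp py hi.
  by rewrite !Euclid_dvdM // pr ps (yc p i).
have sW i : 3 <= i -> s %| W i by move=> i3; rewrite branch_weight_tail // mulnA dvdn_mull.
have case3 z : z <= n -> [\/ z = 0, z = 1, z = 2 | 3 <= z <= n].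
  by case: z => [|[|[|z]]] zn; [constructor 1|constructor 2|constructor 3|constructor 4].
have [e0|e1|e2|e3] := case3 e en.
- have eW : W e = r ^ 2 by rewrite e0.
  have Tx x : 1 < x -> x %| L \/ x %| s -> x %| W f -> x %| W g -> False.
    move=> x1 xL xf xg; have pp := pdiv_prime x1.
    have px := pdiv_dvd x; have := cd _ (dvdn_trans px xf) (dvdn_trans px xg).
    rewrite eW => /(prime_dvd_sqr pp); case: xL => [xL|xs].
      by rewrite (pL _ pp (dvdn_trans px xL)).1.
    by rewrite (prs _ pp (dvdn_trans px xs)).
  have [f0|f1|f2|f3] := case3 f fn; first by move: ef; rewrite e0 f0.
  + have [g0|g1|g2|g3] := case3 g gn; [by move: fg; rewrite g0|by move: fg; rewrite f1 g1| |].
      left; split=> //; have := Wfg; rewrite f1 g2 => Wfg'.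
      apply: (edge_solve We Wfg') => //; [by rewrite W1 W2 branch_prod|exact: branch_gt0|exact: branch_coprime2].
    have [l [hl lg]] := other_index g3; case: (Tx (y l)) => //.
    + by left; exact: sylvester_dvd_L.
    + by rewrite f1; exact: sylvester_dvd_L.
    + exact: sylvester_dvd_weight.
  + have g3 : 3 <= g by have := fg; rewrite f2.
    by case: (Tx s) => //; [right|rewrite f2 W2 dvdn_mulr|exact: sW].
  + have g3 : 3 <= g by case/andP: f3 => f3 _; exact: leq_trans f3 (ltnW fg).
    by case: (Tx s) => //; [right|apply: sW; case/andP: f3|exact: sW].
- have eW : W e = L by rewrite e1.
  have Tx i : 3 <= i <= n -> exists p, [/\ prime p, p %| y i & p %| W f + W g].
    by move=> hi; apply: pd => //; rewrite eW; exact: sylvester_dvd_L.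
  have [f0|f1|f2|f3] := case3 f fn; [|by move: ef; rewrite e1 f1| |].
  + have [g0|g1|g2|g3] := case3 g gn;
      [by move: fg; rewrite g0|by move: eg; rewrite e1 g1| |].
      (* Divisibility tests say nothing here. As [h d] divides [L] and [r^2 + s^2], it divides
         [2 r s] by [branch_quad], hence 2; then [L = h^2 d] divides 4. *)
      have hdL : h * d %| L by rewrite -eW We -mulnA dvdn_mull.
      have := Wfg; rewrite f0 g2 W0 W2 => Wfg'.
      have := branch_quad L m; rewrite [s ^ 2 + _]addnC Wfg' => q.
      have hd2 : h * d %| 2.
        have : h * d %| 2 * (r * s).
          have : h * d %| h * h' * d + L.
            by rewrite dvdn_add // mulnAC dvdn_mulr.
          by rewrite q mulnDl dvdn_addr // dvdn_mulr.
        by rewrite Gauss_dvdl // coprime_sym (coprime_dvdr hdL) // coprimeMl !branch_coprimeL.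
      have : L %| 2 ^ 2.
        apply: (@dvdn_trans ((h * d) ^ 2)); last by rewrite dvdn_exp2r.
        by rewrite -eW We expnMn -!mulnn mulnA dvdn_mulr.
      by move/dvdn_leq => /(_ isT); have := cof_gt4 n5 an; lia.
    have [l [hl lg]] := other_index g3; have [p [pp py]] := Tx l hl.
    rewrite f0 W0 dvdn_addl => [/(prime_dvd_sqr pp)|]; last by rewrite (dvdn_trans py) ?sylvester_dvd_weight.
    by rewrite (yL p l pp py hl).1.
  + have g3 : 3 <= g <= n by rewrite gn andbT; have := fg; rewrite f2.
    have [l [hl lg]] := other_index g3; have [p [pp py]] := Tx l hl.
    rewrite f2 W2 dvdn_addl => [/(prime_dvd_sqr pp)|]; last by rewrite (dvdn_trans py) ?sylvester_dvd_weight.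
    by rewrite (yL p l pp py hl).2.
  + have g3 : 3 <= g <= n by case/andP: f3 => f3 _; rewrite gn andbT; exact: leq_trans f3 (ltnW fg).
    have [p [pp py]] := Tx f f3; rewrite dvdn_addl; last first.
      by rewrite (dvdn_trans py) // sylvester_dvd_weight // neq_ltn fg.
    by rewrite branch_weight_tail => [/(pc p f pp py f3)|]; last by case/andP: f3.
- have eW : W e = s ^ 2 by rewrite e2.
  have Tx x : 1 < x -> x %| L -> x %| W f -> x %| W g -> False.
    move=> x1 xL xf xg; have pp := pdiv_prime x1.
    have px := pdiv_dvd x; have := cd _ (dvdn_trans px xf) (dvdn_trans px xg).
    by rewrite eW => /(prime_dvd_sqr pp); rewrite (pL _ pp (dvdn_trans px xL)).2.
  have [f0|f1|f2|f3] := case3 f fn; [| |by move: ef; rewrite e2 f2|].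
  + have [g0|g1|g2|g3] := case3 g gn;
      [by move: fg; rewrite g0| |by move: eg; rewrite e2 g2|].
      right; split=> //; have := Wfg; rewrite f0 g1 => Wfg'.
      have mE := prednK m0.
      apply: (edge_solve We Wfg') => //; rewrite ?branch_gt0 //.
        by rewrite W0 W1 -{1}mE addnC -branch_prod mE mulnC.
      by rewrite coprime_sym -{2}mE branch_coprime2.
    have se : s %| W e by rewrite eW dvdn_mulr.
    have [p [pp ps]] := pd s s1 se.
    rewrite dvdn_addl; last by rewrite (dvdn_trans ps) // sW //; case/andP: g3.
    by rewrite f0 W0 => /(prime_dvd_sqr pp); rewrite (prs p pp ps).
  + have [g0|g1|g2|g3] := case3 g gn;
      [by move: fg; rewrite g0|by move: fg; rewrite f1 g1|by move: eg; rewrite e2 g2|].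
    have [l [hl lg]] := other_index g3; case: (Tx (y l)) => //.
    + exact: sylvester_dvd_L.
    + by rewrite f1; exact: sylvester_dvd_L.
    + exact: sylvester_dvd_weight.
  + have g3 : 3 <= g <= n by case/andP: f3 => f3 _; rewrite gn andbT; exact: leq_trans f3 (ltnW fg).
    have [l [hl lf lg]] := third_index f3 g3; case: (Tx (y l)) => //; try exact: sylvester_dvd_weight.
    exact: sylvester_dvd_L.
have Tx i : 3 <= i <= n -> i != e -> exists p, [/\ prime p, p %| y i & p %| W f + W g].
  by move=> hi ie; apply: pd => //; exact: sylvester_dvd_weight.
have [ps [pps pss psfg]] : exists p, [/\ prime p, p %| s & p %| W f + W g].
  by apply: pd => //; apply: sW; case/andP: e3.
have [f0|f1|f2|f3] := case3 f fn.
- have [g0|g1|g2|g3] := case3 g gn; first by move: fg; rewrite g0.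
  + have [l [hl le]] := other_index e3; have [p [pp py]] := Tx l hl le.
    rewrite f0 g1 W0 W1 dvdn_addl => [/(prime_dvd_sqr pp)|]; last by rewrite (dvdn_trans py) ?sylvester_dvd_L.
    by rewrite (yL p l pp py hl).1.
  + move: psfg; rewrite f0 g2 W0 W2 dvdn_addl; last by rewrite dvdn_mulr.
    by move=> /(prime_dvd_sqr pps); rewrite (prs _ pps pss).
  + have [l [hl le lg]] := third_index e3 g3; have [p [pp py]] := Tx l hl le.
    rewrite f0 W0 dvdn_addl => [/(prime_dvd_sqr pp)|]; last by rewrite (dvdn_trans py) ?sylvester_dvd_weight.
    by rewrite (yL p l pp py hl).1.
- have [g0|g1|g2|g3] := case3 g gn; [by move: fg; rewrite g0|by move: fg; rewrite f1 g1| |].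
  + have [l [hl le]] := other_index e3; have [p [pp py]] := Tx l hl le.
    rewrite f1 g2 W1 W2 dvdn_addr => [/(prime_dvd_sqr pp)|]; last by rewrite (dvdn_trans py) ?sylvester_dvd_L.
    by rewrite (yL p l pp py hl).2.
  + move: psfg; rewrite f1 W1 dvdn_addl => [psL|]; last first.
      by rewrite (dvdn_trans pss) // sW //; case/andP: g3.
    by have := (pL _ pps psL).2; rewrite pss.
- have g3 : 3 <= g <= n by rewrite gn andbT; have := fg; rewrite f2.
  have [l [hl le lg]] := third_index e3 g3; have [p [pp py]] := Tx l hl le.
  rewrite f2 W2 dvdn_addl => [/(prime_dvd_sqr pp)|]; last by rewrite (dvdn_trans py) ?sylvester_dvd_weight.
  by rewrite (yL p l pp py hl).2.
have g3 : 3 <= g <= n by case/andP: f3 => f3 _; rewrite gn andbT; exact: leq_trans f3 (ltnW fg).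
have fe : f != e by rewrite eq_sym.
have [p [pp py]] := Tx f f3 fe; rewrite dvdn_addl; last first.
  by rewrite (dvdn_trans py) // sylvester_dvd_weight // neq_ltn fg.
by rewrite branch_weight_tail => [/(pc p f pp py f3)|]; last by case/andP: f3.
Qed.

End BranchEdges.
End Classification.

Section Neighbours.
Local Open Scope nat_scope.

(** * Exchanges at the root *)

Section RootEdges.
Variable n : nat.
Hypothesis n5 : 5 <= n.
Local Notation cof := (cofactor_syl n).

(** A labelling of the root weights that favours no [a]: which branch is entered is decided only by
    the exchange. *)
Definition root_weight i := if i < 2 then 1 else cof (i - 2).
Local Notation W := root_weight.

Lemma third_below i j : exists l, [/\ l < n.-1, l != i, l != j & 0 < l].
Proof.
have [l3|] := boolP ((1 != i) && (1 != j)).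
  by exists 1; case/andP: l3; split=> //; lia.
have [l4|] := boolP ((2 != i) && (2 != j)).
  by exists 2; case/andP: l4; split=> //; lia.
by exists 3; split; lia.
Qed.

Variables (e f g h h' d : nat).
Hypotheses (en : e <= n) (fn : f <= n) (gn : g <= n) (fg : f < g)
  (ef : e != f) (eg : e != g).
Hypotheses (We : W e = h * h * d) (Wfg : W f + W g = h * h' * d).
Hypotheses (cf : coprime (h * h') (W f)) (cg : coprime (h * h') (W g)).

Lemma root_edges :
  [/\ e < 2, f < 2, 2 <= g & [/\ h = 1, d = 1 & h' = 1 + cof (g - 2)]].
Proof.
have cd := common_dvd_exchange We Wfg cf.
have pd x (x1 : 1 < x) (xe : x %| W e) := prime_of_dvd We Wfg x1 xe erefl.
have y1 i : 1 < sylvester i := sylvester_gt1 _.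
have W1 i : i < 2 -> W i = 1 by rewrite /W => ->.
have W2 i : 2 <= i -> W i = cof (i - 2) by case: i => [|[|i]].
have [e1|e2] := ltnP e 2.
  have f2 : f < 2.
    rewrite ltnNge; apply/negP => f2; have g2 : 2 <= g by exact: leq_trans f2 (ltnW fg).
    have [l [ln lf lg _]] := third_below (f - 2) (g - 2).
    have : sylvester l %| 1.
      by rewrite -(W1 e e1); apply: cd; rewrite W2 //; apply: cof_dvd; lia.
    by rewrite dvdn1; have := y1 l; lia.
  have g2 : 2 <= g by have := ef; have := eg; have := fg; lia.
  have := We; rewrite W1 // => /esym/eqP.
  rewrite -mulnA !muln_eq1 => /andP[/eqP h1 /andP[_ /eqP d1]].
  by split=> //; split=> //; have := Wfg; rewrite h1 d1 W1 // W2 // mul1n muln1.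
have yW l : l < n.-1 -> l != e - 2 -> sylvester l %| W e.
  by move=> ln le; rewrite W2 // cof_dvd //; lia.
exfalso; have [f1|f2] := ltnP f 2; last first.
  have g2 : 2 <= g by exact: leq_trans f2 (ltnW fg).
  have fe : f - 2 != e - 2 by have := ef; lia.
  have fn2 : f - 2 < n.-1 by lia.
  have [p [pp py]] := pd _ (y1 (f - 2)) (yW (f - 2) fn2 fe).
  have pg : p %| W g.
    by rewrite (dvdn_trans py) // W2 // cof_dvd //; have := fg; lia.
  rewrite dvdn_addl // => pf.
  have : p %| gcdn (sylvester (f - 2)) (cof (f - 2)) by rewrite dvdn_gcd py -W2.
  by rewrite (eqP (cof_coprime _)) ?dvdn1; [have := prime_gt1 pp; lia|lia].
have [g1|g2] := ltnP g 2.
  (* The sum of the two weights is 2, so every [sylvester l] with [l != e - 2] would be even,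
     against coprimality. *)
  have key l : l < n.-1 -> l != e - 2 -> 2 %| sylvester l.
    move=> ln le; have [p [pp py]] := pd _ (y1 l) (yW l ln le).
    rewrite W1 // W1 // => p2; suff <- : p = 2 by [].
    by apply/eqP; rewrite -(dvdn_prime2 pp).
  have [l [ln le _ _]] := third_below (e - 2) (e - 2).
  have [l' [l'n l'e l'l _]] := third_below (e - 2) l.
  have := sylvester_coprime l'l; rewrite /coprime.
  have : 2 %| gcdn (sylvester l') (sylvester l) by rewrite dvdn_gcd !key.
  by move=> h2 /eqP h1; rewrite h1 in h2.
have [l [ln le lg _]] := third_below (e - 2) (g - 2).
have [p [pp py]] := pd _ (y1 l) (yW l ln le).
rewrite W1 // dvdn_addl; last by rewrite (dvdn_trans py) // W2 // cof_dvd //; lia.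
by rewrite dvdn1; have := prime_gt1 pp; lia.
Qed.

End RootEdges.

(** Mutations into a branch node are thus handled as exchanges out of it, without inverting a
    mutation of polytopes. *)
Lemma edge_mutation_sym n (x y : 'I_n.+1 -> nat) : edge_mutation x y -> edge_mutation y x.
Proof.
case=> e [a [b [h [h' [d [ne [h0 h'0 hh] [xe ye xab] [ya yb ca cb] rest]]]]]].
exists e, a, b, h', h, d; split=> //.
- by split=> //; rewrite coprime_sym.
- by split=> //; rewrite ya yb xab [h * h']mulnC.
- by split=> //; rewrite mulnC ?ya ?yb.
move=> k ke ka kb; have [hx hy] := rest k ke ka kb; split=> //.
have c : coprime h' h by rewrite coprime_sym.
by rewrite -(Gauss_dvdr _ c) hy dvdn_mulr.
Qed.

Lemma edge_mutation_perm n (x y : 'I_n.+1 -> nat) (s : {perm 'I_n.+1}) :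
  edge_mutation x y -> edge_mutation (x \o s) (y \o s).
Proof.
case=> e [a [b [h [h' [d [[ea eb ab] h0 [xe ye xab] [ya yb ca cb] rest]]]]]].
exists ((s^-1)%g e), ((s^-1)%g a), ((s^-1)%g b), h, h', d; rewrite /= !permKV.
split=> //; first by rewrite !(inj_eq perm_inj).
move=> k ke ka kb; apply: rest.
- by apply: contra ke => /eqP <-; rewrite permK.
- by apply: contra ka => /eqP <-; rewrite permK.
- by apply: contra kb => /eqP <-; rewrite permK.
Qed.

Lemma edge_mutation_lt n (x y : 'I_n.+1 -> nat) : edge_mutation x y ->
  exists (e a b : 'I_n.+1) (h h' d : nat),
  [/\ [/\ e != a, e != b & a < b], [/\ (0 < h)%N, (0 < h')%N & coprime h h'],
      [/\ x e = (h * h * d)%N, y e = (h' * h' * d)%N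
        & (x a + x b = h * h' * d)%N],
      [/\ y a = x a, y b = x b, coprime (h * h') (x a) & coprime (h * h') (x b)]
    & forall k, k != e -> k != a -> k != b ->
        (h %| x k)%N /\ (h * y k = h' * x k)%N].
Proof.
case=> e [a [b [h [h' [d [[ea eb ab] h0 [xe ye xab] [ya yb ca cb] rest]]]]]].
have [lt|] := ltnP a b; first by exists e, a, b, h, h', d.
rewrite leq_eqVlt eq_sym (inj_eq val_inj) (negbTE ab) /= => lt.
exists e, b, a, h, h', d; split=> //; first by split=> //; rewrite addnC.
by move=> k ke kb ka; exact: rest.
Qed.

(** The enumeration [k a] is eliminated here, so that nodes of different branches can be
    compared. *)
Definition branch_list n a m := let L := cofactor_syl n a in
  [:: branch L m ^ 2, L, branch L m.+1 ^ 2 &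
    [seq cofactor_syl n j * (branch L m * branch L m.+1) | j <- iota 0 n.-1 & j != a]].

Lemma tuple_iota n (F : nat -> nat) :
  tval [tuple F i | i < n] = [seq F i | i <- iota 0 n].
Proof. by rewrite /= -val_enum_ord -map_comp. Qed.

Lemma Xma_branch_list n a k m : 2 <= n ->
  perm_eq [seq k i | i <- index_iota 3 n.+1] [seq j <- index_iota 0 n.-1 | j != a] ->
  perm_eq (Xma n a k m) (branch_list n a m).
Proof.
move=> n2 hk; rewrite /Xma tuple_iota (_ : n.+1 = 3 + (n - 2)); last by lia.
rewrite iotaD /= !lambdaE /=.
rewrite (eq_map (lambdaE n a k m)) /branch_list !perm_cons.
have -> : [seq branch_weight (cofactor_syl n a) (fun i => cofactor_syl n (k i)) m i | i <- iota 3 (n - 2)]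
  = [seq cofactor_syl n j * (branch (cofactor_syl n a) m * branch (cofactor_syl n a) m.+1) | j <- [seq k i | i <- index_iota 3 n.+1]].
  rewrite -map_comp /index_iota; have -> : n.+1 - 3 = n - 2 by lia.
  by apply/eq_in_map => -[|[|[|i]]]; rewrite mem_iota.
apply: perm_map; move: hk; rewrite /index_iota subn0; exact.
Qed.

Definition root_list n := 1 :: 1 :: [seq cofactor_syl n j | j <- iota 0 n.-1].

Lemma perm_iota_filter n a : a < n -> perm_eq (iota 0 n) (a :: [seq j <- iota 0 n | j != a]).
Proof.
move=> an; have := @perm_to_rem _ a (iota 0 n); rewrite mem_iota an => /(_ isT).
by rewrite rem_filter ?iota_uniq.
Qed.

Lemma branch_list0 n a : a < n.-1 -> perm_eq (branch_list n a 0) (root_list n).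
Proof.
move=> an; have /(perm_map (cofactor_syl n)) := perm_iota_filter an.
rewrite /root_list /branch_list /branch /= => h; rewrite perm_sym.
apply/seq.permP => p /=; have := seq.permP h p; rewrite /= => ->.
rewrite addn0 !exp1n (eq_map (g := cofactor_syl n) (f := fun j => cofactor_syl n j * (1 * 1))).
  by lia.
by move=> j; rewrite !muln1.
Qed.

Lemma Xroot_root_list n : 2 <= n -> perm_eq (Xroot n) (root_list n).
Proof.
move=> n2; rewrite /Xroot (tuple_iota n.+1 (fun i => if i < 2 then 1 else sylvester_pred n.-1 %/ sylvester (n - i))).
rewrite (_ : n.+1 = 2 + n.-1); last by lia.
rewrite iotaD /= /root_list !perm_cons.
have -> : [seq (if i < 2 then 1 else sylvester_pred n.-1 %/ sylvester (n - i)) | i <- iota 2 n.-1]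
   = [seq cofactor_syl n j | j <- [seq n - i | i <- iota 2 n.-1]].
  by rewrite -map_comp; apply/eq_in_map => -[|[|i]]; rewrite mem_iota.
apply: perm_map; apply: uniq_perm; rewrite ?iota_uniq //.
  rewrite map_inj_in_uniq ?iota_uniq // => i j; rewrite !mem_iota; lia.
move=> j; rewrite mem_iota; apply/mapP/idP => [[i]|jn].
  by rewrite mem_iota => ? ->; lia.
by exists (n - j); rewrite ?mem_iota; lia.
Qed.

Lemma tuple_inord n (y : 'I_n.+1 -> nat) :
  tval [tuple y i | i < n.+1] = [seq y (inord i) | i <- iota 0 n.+1].
Proof.
rewrite -(tuple_iota n.+1 (fun i => y (inord i))); congr tval.
by apply: eq_from_tnth => i; rewrite !tnth_mktuple inord_val.
Qed.

Lemma iota_split2 n : 0 < n -> iota 0 n.+1 = [:: 0, 1 & [seq j + 2 | j <- iota 0 n.-1]].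
Proof.
case: n => // n _ /=; congr [:: _, _ & _].
by rewrite -{1}[2]addn0 iotaDl; apply: eq_map => j; rewrite addnC.
Qed.

(** The branch is read off the index [g] of the edge's weight other than 1, namely [a = g - 2]; the
    tail is multiplied by [1 + L = r_1 r_2]. *)
Lemma root_neighbour n (x y : 'I_n.+1 -> nat) : 5 <= n ->
  (forall i, x i = root_weight n i) -> edge_mutation x y ->
  exists2 a, a < n.-1 & perm_eq [tuple y i | i < n.+1] (branch_list n a 1).
Proof.
move=> n5 xE /edge_mutation_lt[e [f [g [h [h' [d
  [[ef eg fg] _ [xe ye xab] [ya yb ca cb] rest]]]]]]].
have lt (i : 'I_n.+1) : i <= n by rewrite -ltnS.
rewrite !xE in xe xab ca cb.
have [e2 f2 g2 [h1 d1 h'E]] := root_edges n5 (lt e) (lt f) (lt g) fg ef eg xe xab ca cb.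
have gn := lt g; exists (g - 2); first by lia.
set L := cofactor_syl n (g - 2) in h'E.
rewrite tuple_inord iota_split2 /=; last by lia.
have -> : [seq y (inord i) | i <- [seq j + 2 | j <- iota 0 n.-1]] =
  [seq y (inord (j + 2)) | j <- iota 0 n.-1] by rewrite -map_comp.
have hg : g - 2 < n.-1 by lia.
have /(perm_map (fun j => y (inord (j + 2)))) := perm_iota_filter hg.
rewrite /= subnK // inord_val yb xE.
have -> : root_weight n g = L by rewrite /root_weight ifN // -leqNgt.
rewrite (_ : [seq y (inord (j + 2)) | j <- [seq j <- iota 0 n.-1 | j != g - 2]] =
  [seq cofactor_syl n j * (branch L 1 * branch L 2) | j <- iota 0 n.-1 & j != g - 2]); last first.
  apply/eq_in_map => j; rewrite mem_filter mem_iota => /andP[jg jn].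
  have jN : j + 2 < n.+1 by lia.
  have [|||_] := rest (inord (j + 2)); rewrite -?val_eqE /= ?inordK //; try lia.
  rewrite xE inordK // h1 mul1n => ->; rewrite h'E /root_weight ifN ?addnK // -?leqNgt ?leq_addl //.
  by rewrite mulnC /branch /=; congr (_ * _); ring.
move=> hp; apply/seq.permP => p /=; have := seq.permP hp p; rewrite /= => e1.
rewrite e1.
have ef' : (e : nat) != f by rewrite val_eqE.
have yf : y f = 1 by rewrite ya xE /root_weight f2.
have ye' : y e = branch L 2 ^ 2.
  by rewrite ye h'E d1 /branch /=; ring.
have b1 : branch L 1 ^ 2 = 1 by [].
have [e0|e0] : (e : nat) = 0 /\ (f : nat) = 1 \/ (e : nat) = 1 /\ (f : nat) = 0 by lia.
  have -> : inord 0 = e by rewrite -e0.1 inord_val.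
  have -> : inord 1 = f by rewrite -e0.2 inord_val.
  by rewrite yf ye' -/L b1; lia.
have -> : inord 1 = e by rewrite -e0.1 inord_val.
have -> : inord 0 = f by rewrite -e0.2 inord_val.
by rewrite yf ye' -/L b1; lia.
Qed.

End Neighbours.

Section BranchNeighbours.
Local Open Scope nat_scope.

Variables (n a : nat) (k : nat -> nat).
Hypotheses (n5 : 5 <= n) (an : a < n.-1).
Hypothesis hk : perm_eq [seq k i | i <- index_iota 3 n.+1]
                        [seq j <- index_iota 0 n.-1 | j != a].

Lemma index_mem i : 3 <= i <= n -> k i < n.-1 /\ k i != a.
Proof.
move=> hi; have : k i \in [seq j <- index_iota 0 n.-1 | j != a].
  by rewrite -(perm_mem hk) map_f // mem_index_iota ltnS.
by rewrite mem_filter mem_index_iota => /andP[-> /andP[_ ->]].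
Qed.

Lemma index_lt i : 3 <= i <= n -> k i < n.-1.
Proof. by move=> /index_mem[]. Qed.

Lemma index_neq i : 3 <= i <= n -> k i != a.
Proof. by move=> /index_mem[]. Qed.

Lemma index_inj i j : 3 <= i <= n -> 3 <= j <= n -> k i = k j -> i = j.
Proof.
move=> hi hj e; have u : uniq [seq k i | i <- index_iota 3 n.+1].
  by rewrite (perm_uniq hk) filter_uniq // iota_uniq.
have sz : size (index_iota 3 n.+1) = n - 2 by rewrite size_iota; lia.
have := nth_uniq 0 (s := [seq k i | i <- index_iota 3 n.+1]) (i := i - 3) (j := j - 3).
rewrite size_map sz => /(_ _ _ u).
rewrite !(nth_map 0) ?sz; [|lia|lia]; rewrite !nth_iota; [|lia|lia].
rewrite !subnKC; [|by case/andP: hj|by case/andP: hi].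
by rewrite e eqxx => h; have := h ltac:(lia) ltac:(lia); lia.
Qed.

Lemma iota_split3 : iota 0 n.+1 = [:: 0, 1, 2 & iota 3 (n - 2)].
Proof. by rewrite (_ : n.+1 = 3 + (n - 2)); [rewrite iotaD|lia]. Qed.

Lemma branch_neighbour m (y : 'I_n.+1 -> nat) : 0 < m ->
  edge_mutation (tnth (Xma n a k m)) y ->
  perm_eq [tuple y i | i < n.+1] (Xma n a k m.-1) \/
  perm_eq [tuple y i | i < n.+1] (Xma n a k m.+1).
Proof.
move=> m0; set L := cofactor_syl n a.
set W := branch_weight L (fun i => cofactor_syl n (k i)).
have xE i : tnth (Xma n a k m) i = W m i by rewrite tnth_mktuple lambdaE.
move=> /edge_mutation_lt[e [f [g [h [h' [d
  [[ef eg fg] _ [xe ye xfg] [yf yg cf cg] rest]]]]]]].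
have lt (i : 'I_n.+1) : i <= n by rewrite -ltnS.
rewrite !xE in xe xfg cf cg yf yg.
have XE q : tval (Xma n a k q) = [seq W q i | i <- iota 0 n.+1].
  by rewrite /Xma tuple_iota; apply: eq_map => i; rewrite lambdaE.
rewrite !XE tuple_inord iota_split3 /=.
have inordE (i : 'I_n.+1) j : nat_of_ord i = j -> y (inord j) = y i.
  by move=> <-; rewrite inord_val.
have tail q x : 0 < x -> (forall i, 3 <= i <= n -> h' * W m i = x * W q i) -> h = x ->
    [:: 0; 1; 2] =i [:: nat_of_ord e; nat_of_ord f; nat_of_ord g] ->
    [seq y (inord i) | i <- iota 3 (n - 2)] = [seq W q i | i <- iota 3 (n - 2)].
  move=> x0 hW hx efg; apply/eq_in_map => i; rewrite mem_iota => hi.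
  have iN : i < n.+1 by lia.
  have ni z : nat_of_ord z \in [:: nat_of_ord e; nat_of_ord f; nat_of_ord g] ->
      inord i != z :> 'I_n.+1.
    by rewrite -efg -val_eqE /= inordK // !inE; lia.
  have [|||_ yi] := rest (inord i); try by apply: ni; rewrite !inE eqxx ?orbT.
  by apply/eqP; rewrite -(eqn_pmul2l x0) -[x in x * y _]hx yi xE inordK // -hW //; lia.
have [[e0 f1 g2 [hr d1 h'E]]|[e2 f0 g1 [hr d1 h'E]]] :=
  branch_edges n5 an m0 index_lt index_neq index_inj (lt e) (lt f) (lt g) fg ef eg xe xfg cf cg.
  right; rewrite (tail m.+1 (branch L m)) ?branch_gt0 //; first last.
  - by move=> z; rewrite e0 f1 g2.
  - by move=> [|[|[|i]]] // _; rewrite h'E /W /=; ring.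
  rewrite (inordE e _ e0) (inordE f _ f1) (inordE g _ g2) yf yg ye f1 g2 d1 h'E.
  by apply/seq.permP => p /=; rewrite muln1 mulnn -/L; lia.
left; rewrite (tail m.-1 (branch L m.+1)) ?branch_gt0 //; first last.
- by move=> z; rewrite e2 f0 g1 !inE; lia.
- by move=> [|[|[|i]]] // _; rewrite h'E /W /= prednK //; ring.
rewrite (inordE e _ e2) (inordE f _ f0) (inordE g _ g1) yf yg ye f0 g1 d1 h'E.
by apply/seq.permP => p /=; rewrite prednK // muln1 mulnn -/L; lia.
Qed.

End BranchNeighbours.

(** * Existence and terminality of weighted projective spaces *)

Section Existence.
Local Open Scope classical_set_scope.
Local Open Scope ring_scope.

(** By the Smith form, the row of weights times the inverse of [R] vanishes outside the first
    column. The other columns give vectors related by the weights, and they generate because [R] is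
    invertible over the integers. *)
Lemma wps_vectors_exist n (l : 'I_n.+1 -> nat) :
  (forall i, (0 < l i)%N) -> \big[gcdn/0%N]_i l i = 1%N ->
  exists v, wps_vectors l v.
Proof.
move=> l0 l1; pose M : 'rV[int]_n.+1 := \row_i (l i)%:Z.
have [L Lu [R Ru [d _ ME]]] := int_Smith_normal_form M.
pose V : 'M[int]_(n.+1, n) := rsubmx (invmx R : 'M_(n.+1, 1 + n)).
have VE (c : 'rV_n.+1) : c *m V = \sum_i c 0 i *: row i V := mulmx_sum_row c V.
exists (fun i => row i V); split=> // [|x].
  have -> : \sum_i (l i)%:Z *: row i V = M *m V.
    by rewrite VE; apply: eq_bigr => i _; rewrite mxE.
  apply/rowP => j; rewrite /V mulmx_rsub mxE [RHS]mxE.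
  have -> : M *m invmx R = L *m \matrix_(i, j) (d`_i *+ (i == j :> nat)).
    by rewrite ME mulmxK.
  by rewrite !mxE big_ord1 mxE mulr0n mulr0.
pose xh : 'rV[int]_n.+1 := row_mx (0 : 'M_1) x.
exists (fun i => (xh *m R) 0 i).
rewrite -VE /V mulmx_rsub mulmxK //.
by rewrite row_mxKr.
Qed.

(** Writing [u] in the generators gives a relation with coefficient [1 - c z_i] at [i] and [- c z_k]
    elsewhere. It is [t] times the weights, so [c] is coprime to [t] and divides the other
    weights. *)
Lemma scale_kernel n (l : 'I_n.+1 -> nat) v i c (u : 'rV[int]_n) :
  wps_vectors l v -> v i = c *: u -> forall k, k != i -> (`|c| %| l k)%N.
Proof.
move=> lv vE; have [_ _ _ gen] := lv; have [z zE] := gen u.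
have [|t tE] := wps_kernel_int lv (c := fun k => (k == i)%:R - c * z k).
  under eq_bigr do rewrite scalerBl -scalerA.
  rewrite sumrB -scaler_sumr -zE -vE (bigD1 i) //= eqxx scale1r.
  by rewrite big1 ?addr0 ?subrr // => k /negbTE ->; rewrite scale0r.
have ct : coprimez c t.
  apply/coprimezP; exists (z i, (l i)%:Z) => /=.
  by have := tE i; rewrite eqxx mulr1n => h; rewrite [_ * t]mulrC -h; ring.
move=> k ki; have := tE k; rewrite (negbTE ki) sub0r => h.
have : (c %| t * (l k)%:Z)%Z by rewrite -h dvdzE abszN -dvdzE dvdz_mulr.
by rewrite Gauss_dvdzr // dvdzE.
Qed.

Definition well_formed n (l : 'I_n.+1 -> nat) : Prop :=
  forall i d, (forall k, k != i -> (d %| l k)%N) -> d = 1%N.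

Lemma well_formed_primitive n (l : 'I_n.+1 -> nat) v i :
  wps_vectors l v -> well_formed l -> primitive (v i).
Proof.
move=> lv wf c u vE; have := wf i `|c|%N (scale_kernel lv vE).
by move=> h; apply/orP; lia.
Qed.

Section Fano.
Variables (n : nat) (l : 'I_n.+1 -> nat) (v : 'I_n.+1 -> 'rV[int]_n)
  (u : 'I_n.+1 -> 'cV[rat]_n) (b : 'I_n.+1 -> rat).
Hypotheses (lv : wps_vectors l v) (vub : barycentric (vertQ v) u b).

Lemma bary0_gt0 i : 0 < b i.
Proof.
have [|t tE] := wps_kernel lv (c := b).
  rewrite -[RHS](bary_sum vub 0); apply: eq_bigr => k _; by rewrite ev0 add0r.
have := bary_sum1 vub 0; under eq_bigr do rewrite ev0 add0r tE.
have [l0 _ _ _] := lv; rewrite -mulr_sumr => e.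
rewrite tE mulr_gt0 ?ltr0n ?l0 //; rewrite ltNge; apply/negP => t0.
have : t * \sum_j (l j)%:R <= 0 by rewrite mulr_le0_ge0 // sumr_ge0.
by rewrite e ler10.
Qed.

Lemma wps_fano : (forall i, primitive (v i)) -> fano (conv_hull (range (vertQ v))).
Proof.
move=> vp; split.
- exists [seq v i | i <- enum 'I_n.+1]; congr conv_hull.
  apply/seteqP; split=> [_ [i _ <-]|_ [x /mapP[i _ ->] <-]]; last by exists i.
  by exists (v i) => //=; apply/mapP; exists i => //; rewrite mem_enum.
- move=> U c Uc.
  have U0 d : ev U d = 0.
    rewrite -(bary_lin vub d) ev_sum (eq_bigr (fun i => ev (u i) d * c)).
      by rewrite -mulr_suml (bary_lin0 vub) mul0r.
    by move=> i _; rewrite evZ Uc //; exact: vert_in.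
  apply/colP => i; have := U0 (delta_mx 0 i).
  by rewrite /ev -rowE !mxE.
(* [S i] exceeds the l1-norm of [u i], so the i-th coordinate stays nonnegative on the cube of
   half-side [b i / S i]; the 1 keeps [S i] positive. *)
- pose S i := 1 + \sum_j `|u i j 0|.
  have S0 i : 0 < S i by rewrite ltr_pwDl // sumr_ge0.
  pose i0 := [arg min_(i < ord0) (b i / S i)]%O.
  have i0min i : b i0 / S i0 <= b i / S i by rewrite /i0; case: arg_minP => // j _; apply.
  exists (b i0 / S i0); first by rewrite divr_gt0 // bary0_gt0.
  move=> y yl; apply/(simplexP vub) => i.
  have : - ev (u i) y <= b i; last by rewrite lerNl -subr_ge0 opprK addrC.
  apply: le_trans (ler_norm _) _; rewrite normrN /ev mxE.
  apply: le_trans (ler_norm_sum _ _ _) _.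
  apply: (@le_trans _ _ (\sum_j (b i / S i) * `|u i j 0|)).
    apply: ler_sum => j _; rewrite normrM ler_wpM2r //.
    by have := yl j; rewrite mxE subr0 => /ltW /le_trans; apply; exact: i0min.
  rewrite -mulr_sumr -mulrA ler_piMr ?(ltW (bary0_gt0 i)) //.
  by rewrite mulrC ler_pdivrMr // mul1r /S lerDr ler01.
- by move=> x /(extreme_vert vub)[i ->]; exists (v i).
Qed.

End Fano.

Lemma is_wps_exist n (l : n.+1.-tuple nat) :
  (forall i, (0 < tnth l i)%N) -> \big[gcdn/0%N]_i tnth l i = 1%N ->
  well_formed (tnth l) -> is_wps l.
Proof.
move=> l0 l1 wf; have [v lv] := wps_vectors_exist l0 l1.
have [u [b vub]] := wps_bary lv.
exists (conv_hull (range (vertQ v))), v; have [_ _ lv0 gen] := lv; split=> //.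
split=> //; apply: (wps_fano lv vub) => i.
exact: well_formed_primitive lv wf.
Qed.

End Existence.

(** * Cones over the faces, and terminality *)

Section Terminality.
Local Open Scope classical_set_scope.
Local Open Scope ring_scope.

(** With [t = p / q] in lowest terms and [z1 p + z2 q = 1], the vector [z1 x + z2 y] times [p] is
    [x] and times [q] is [y]. *)
Lemma primitive_ray n (x y : 'rV[int]_n) (t : rat) : primitive x -> primitive y ->
  0 < t -> toQ x = t *: toQ y -> x = y.
Proof.
move=> xp yp t0 e.
have exy : denq t *: x = numq t *: y.
  apply: toQ_inj; rewrite !toQZ e scalerA; congr (_ *: _).
  by rewrite -{2}[t]divq_num_den mulrC divfK // intr_eq0 denq_eq0.
have [z1 [z2 z]] := Bezoutz (numq t) (denq t).
have g1 : gcdz (numq t) (denq t) = 1.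
  by rewrite /gcdz; have := coprime_num_den t; rewrite /coprime => /eqP ->.
rewrite g1 in z.
have d1 : denq t \is a GRing.unit.
  apply: (yp _ (z1 *: x + z2 *: y)).
  rewrite scalerDr scalerA mulrC -scalerA exy !scalerA -scalerDl.
  by rewrite [denq t * _]mulrC z scale1r.
have n1 : numq t \is a GRing.unit.
  apply: (xp _ (z1 *: x + z2 *: y)).
  rewrite scalerDr !scalerA [numq t * z2]mulrC -[(z2 * _) *: _]scalerA -exy scalerA.
  by rewrite -scalerDl [numq t * _]mulrC z scale1r.
have n0 : 0 < numq t by rewrite numq_gt0.
have := denq_gt0 t; case/orP: d1 => /eqP d1; rewrite d1 // in exy *.
by case/orP: n1 => /eqP n1; rewrite n1 // in exy n0; rewrite !scale1r in exy.
Qed.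

Variables (n : nat) (l : 'I_n.+1 -> nat) (v : 'I_n.+1 -> 'rV[int]_n)
  (u : 'I_n.+1 -> 'cV[rat]_n) (b : 'I_n.+1 -> rat).
Hypotheses (lv : wps_vectors l v) (vub : barycentric (vertQ v) u b)
  (vp : forall i, primitive (v i)).
Local Notation P := (conv_hull (range (vertQ v))).

Definition face_cone (I : {set 'I_n.+1}) : set 'rV[rat]_n :=
  [set x | exists c : 'I_n.+1 -> rat, [/\ forall i, 0 <= c i,
     forall i, i \notin I -> c i = 0 & x = \sum_i c i *: vertQ v i]].

(** At a point of the face the gaps [c - U(v_i)], weighted by its coordinates, sum to zero, so only
    vertices on the face contribute. *)
Lemma conic_hull_face U c (I := [set i | ev U (vertQ v i) == c]%SET) :
  (forall x, P x -> ev U x <= c) ->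
  conic_hull (P `&` [set x | ev U x = c]) = face_cone I.
Proof.
move=> Uc; apply/seteqP; split=> [x [m [k [p [k0 pE ->]]]]|x [k [k0 kI ->]]].
  have p0 j i : 0 <= ev (u i) (p j) + b i.
    by have [/(simplexP vub) + _] := pE j; apply.
  have pI j i : i \notin I -> ev (u i) (p j) + b i = 0.
    move=> iI; have ge0 i' : true ->
        0 <= (ev (u i') (p j) + b i') * (c - ev U (vertQ v i')).
      by move=> _; rewrite mulr_ge0 // subr_ge0 Uc //; exact: vert_in.
    have s0 : \sum_i' (ev (u i') (p j) + b i') * (c - ev U (vertQ v i')) = 0.
      under eq_bigr do rewrite mulrBr.
      rewrite sumrB -mulr_suml (bary_sum1 vub) mul1r.
      have [_ /= <-] := pE j; rewrite -[X in ev U X - _](bary_sum vub) ev_sum.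
      by rewrite -sumrB big1 // => i' _; rewrite evZ subrr.
    have /eqP := psumr_eq0P ge0 s0 (i := i) isT.
    rewrite mulf_eq0 subr_eq0; move: iI; rewrite inE eq_sym => /negbTE ->.
    by rewrite orbF => /eqP.
  exists (fun i => \sum_j k j * (ev (u i) (p j) + b i)); split.
  - by move=> i; rewrite sumr_ge0 // => j _; rewrite mulr_ge0.
  - by move=> i iI; rewrite big1 // => j _; rewrite pI // mulr0.
  under [RHS]eq_bigr do rewrite scaler_suml.
  rewrite exchange_big /=; apply: eq_bigr => j _.
  rewrite -[LHS](congr1 _ (bary_sum vub (p j))) scaler_sumr.
  by apply: eq_bigr => i _; rewrite scalerA.
exists #|I|, (fun j => k (enum_val j)), (fun j => vertQ v (enum_val j)); split=> //.
  by move=> j; split; [exact: vert_in|have := enum_valP j; rewrite inE => /eqP].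
rewrite -(big_enum_val (A := mem I) (fun i => k i *: vertQ v i)) [RHS]big_mkcond.
apply: eq_bigr => i _; case: ifPn => // iI; by rewrite kI // scale0r.
Qed.

Section Cone.
Variables (I : {set 'I_n.+1}) (k : 'I_n.+1).
Hypothesis kI : k \notin I.
Local Notation sigma := (face_cone I).

Lemma cone_uniq (c c' : 'I_n.+1 -> rat) : c k = 0 -> c' k = 0 ->
  \sum_i c i *: vertQ v i = \sum_i c' i *: vertQ v i -> c =1 c'.
Proof.
move=> ck c'k e i; have [|t tE] := wps_kernel lv (c := fun i => c i - c' i).
  by under eq_bigr do rewrite scalerBl; rewrite sumrB e subrr.
have t0 : t = 0.
  have := tE k; rewrite ck c'k subrr => /esym/eqP; rewrite mulf_eq0 => /orP[/eqP //|].
  by have [l0 _ _ _] := lv; rewrite pnatr_eq0 eqn0Ngt l0.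
by have := tE i; rewrite t0 mul0r => /eqP; rewrite subr_eq0 => /eqP.
Qed.

Lemma delta_sum i : \sum_j (j == i)%:R *: vertQ v j = vertQ v i.
Proof.
rewrite (bigD1 i) //= eqxx scale1r big1 ?addr0 // => j /negbTE ->.
by rewrite scale0r.
Qed.

Lemma vert_cone i : i \in I -> sigma (vertQ v i).
Proof.
move=> iI; exists (fun j => (j == i)%:R); split; last by rewrite delta_sum.
  by move=> j; rewrite ler0n.
by move=> j jI; case: eqP => // e; move: jI; rewrite e iI.
Qed.

(** A vertex [k] outside [I] makes the cone simplicial, with unique coefficients. An extremal [rho]
    is proportional to any [v i] occurring in it, and two primitive vectors on one ray are equal. *)
Lemma ray_generatorP rho : ray_generator sigma rho <-> exists2 i, i \in I & rho = v i.
Proof.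
split=> [[rp [c [c0 cI rhoE]] ext]|[i iI ->]].
  have [i ci|no] := pickP (fun i => c i != 0); last first.
    have r0 : rho = 0.
      apply: toQ_inj; rewrite toQ0 rhoE big1 // => i _.
      by have /eqP -> := negbFE (no i); rewrite scale0r.
    have /rp : rho = 0 *: 0 by rewrite scale0r.
    by rewrite unitr0.
  have iI : i \in I by apply: contraNT ci => /cI ->.
  have cip : 0 < c i by rewrite lt_neqAle eq_sym ci c0.
  exists i => //.
  have h1 : sigma (c i *: vertQ v i).
    exists (fun j => c i * (j == i)%:R); split.
    - by move=> j; rewrite mulr_ge0 ?ler0n.
    - by move=> j jI; case: eqP => [e|]; rewrite ?mulr0 //; move: jI; rewrite e iI.
    by rewrite -[in LHS]delta_sum scaler_sumr; apply: eq_bigr => j _; rewrite scalerA.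
  have h2 : sigma (\sum_(j | j != i) c j *: vertQ v j).
    exists (fun j => if j != i then c j else 0); split.
    - by move=> j; case: ifP.
    - by move=> j jI; case: ifP => // _; exact: cI.
    rewrite [LHS]big_mkcond; apply: eq_bigr => j _; by case: ifP; rewrite ?scale0r.
  have [|t t0 tE] := ext _ _ h1 h2; first by rewrite rhoE [RHS](bigD1 i).
  have vE : toQ (v i) = (t / c i) *: toQ rho.
    by rewrite mulrC -scalerA -tE scalerA mulVf ?scale1r.
  have t1 : 0 < t / c i.
    rewrite divr_gt0 // lt_neqAle t0 andbT; apply/eqP => tz.
    have v0 : v i = 0 by apply: toQ_inj; rewrite vE -tz mul0r scale0r toQ0.
    have /vp : v i = 0 *: 0 by rewrite scale0r.
    by rewrite unitr0.
  by apply/esym; apply: primitive_ray t1 vE.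
split=> //; first exact: vert_cone.
move=> x y [c [c0 cI xE]] [c' [c'0 c'I yE]] e.
have cc : (fun j => c j + c' j) =1 (fun j => (j == i)%:R).
  apply: cone_uniq; first by rewrite cI ?c'I ?addr0.
    by case: eqP => // ek; move: kI; rewrite ek iI.
  rewrite delta_sum -[RHS]e xE yE -big_split /=.
  by apply: eq_bigr => j _; rewrite scalerDl.
exists (c i) => //; rewrite xE (bigD1 i) //= big1 ?addr0 // => j ji.
have := cc j; rewrite /= (negbTE ji) mulr0n => h; have -> : c j = 0.
  by have := c0 j; have := c'0 j; lra.
by rewrite scale0r.
Qed.

End Cone.

Lemma not_terminal_edge i j k (x : 'rV[int]_n) (al : rat) : i != j -> k != i -> k != j ->
  0 < al < 1 -> toQ x = al *: vertQ v i + (1 - al) *: vertQ v j ->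
  ~ (forall sigma, face_fan P sigma -> terminal_cone sigma).
Proof.
move=> ij ki kj /andP[al0 al1] xE ter.
(* [U] is maximal on [P] exactly along the edge from [i] to [j], with value [c]; the vertex [k]
   makes this face proper. *)
pose U := u i + u j; pose c := 1 - b i - b j.
have UV t : ev U (vertQ v t) = (i == t)%:R + (j == t)%:R - b i - b j.
  by rewrite /U evDu !(bary_vert vub); ring.
have Uc t : P t -> ev U t <= c.
  move: t; apply: conv_hull_le => _ [t _ <-]; rewrite UV /c.
  have [<-|it] := eqVneq i t; first by rewrite eq_sym (negbTE ij) mulr0n mulr1n; lra.
  by case: (j == t); rewrite ?mulr0n ?mulr1n; lra.
pose I := [set t | ev U (vertQ v t) == c]%SET.
have IE t : (t \in I) = (t == i) || (t == j).
  rewrite inE UV /c; have [->|ti] := eqVneq t i.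
    by rewrite [j == i]eq_sym (negbTE ij) mulr0n mulr1n addr0 eqxx.
  rewrite mulr0n add0r [j == t]eq_sym.
  case: (t == j); rewrite ?mulr0n ?mulr1n ?eqxx //=.
  by apply/eqP; lra.
have kI : k \notin I by rewrite IE (negbTE ki) (negbTE kj).
have iI : i \in I by rewrite IE eqxx.
have jI : j \in I by rewrite IE eqxx orbT.
have /ter : face_fan P (face_cone I).
  rewrite -(conic_hull_face Uc).
  exists (P `&` [set t | ev U t = c]) => //; split; last by exists U, c.
  move=> PE; have : P (vertQ v k) := vert_in v k; rewrite -PE => -[_ /= h].
  by move: kI; rewrite inE h eqxx.
have i_ray : ray_generator (face_cone I) (v i) by apply/(ray_generatorP kI); exists i.
have j_ray : ray_generator (face_cone I) (v j) by apply/(ray_generatorP kI); exists j.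
case=> U' [U'1 /(_ x)[+ _]]; have U'i := U'1 _ i_ray; have U'j := U'1 _ j_ray.
have Ux : ev U' (toQ x) = 1 by rewrite xE evD !evZ U'i U'j; ring.
have sx : face_cone I (toQ x).
  exists (fun t => al * (t == i)%:R + (1 - al) * (t == j)%:R); split.
  - by move=> t; rewrite addr_ge0 // mulr_ge0 ?ler0n //; lra.
  - by move=> t; rewrite IE negb_or => /andP[/negbTE -> /negbTE ->]; rewrite !mulr0 addr0.
  rewrite xE -[vertQ v i in LHS]delta_sum -[vertQ v j in LHS]delta_sum !scaler_sumr.
  by rewrite -big_split /=; apply: eq_bigr => t _; rewrite [RHS]scalerDl !scalerA.
case.
- by split=> //; rewrite Ux.
- by move=> x0; move: Ux; rewrite x0 toQ0 ev0 => /eqP; rewrite eq_sym oner_eq0.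
move=> /(ray_generatorP kI)[t]; rewrite IE => tij xt.
have := congr1 (ev (u i)) xE; rewrite evD !evZ xt -/(vertQ v t) !(bary_vert vub).
rewrite eqxx (negbTE ij); case/orP: tij => /eqP ->; rewrite ?eqxx ?(negbTE ij);
  rewrite ?mulr0n ?mulr1n => h; lra.
Qed.

(* A lattice point [x = sum_i x_i v_i] has [x_i = z_i + s l_i] with integers [z_i];
   since [s T] is an integer, [sum_i x_i] is congruent to [s] modulo 1, as are [x_p]
   and [x_q].  So [x_p + x_q <= sum_i x_i <= 1] forces [s] to be an integer. *)
Lemma terminal_criterion (T : nat) p q : p != q -> l p = 1%N -> l q = 1%N ->
  (forall i, (l i %| T)%N) -> \sum_i l i = T.+1 ->
  forall sigma, face_fan P sigma -> terminal_cone sigma.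
Proof.
move=> pq lp lq lT sT sigma [E [EP [U [c [Uc EE]]]] <-].
rewrite {}EE in EP *; rewrite (conic_hull_face Uc); set I := [set _ | _]%SET.
have [k kI] : exists k, k \notin I.
  have [k kI|all] := pickP (fun k => k \notin I); first by exists k.
  case: EP; apply/seteqP; split=> [x [] //|x Px]; split=> //=.
  rewrite -(bary_sum vub x) ev_sum (eq_bigr (fun i => (ev (u i) x + b i) * c)).
    by rewrite -mulr_suml (bary_sum1 vub) mul1r.
  by move=> i _; rewrite evZ; have /negbFE := all i; rewrite inE => /eqP ->.
(* Coordinate [k] vanishes at all other vertices, so [u k] equals [- b k] there; the rescaling gives
   1 on the facet opposite to [k]. *)
pose U1 := (- (b k)^-1) *: u k.
have bk := bary0_gt0 lv vub k.
have U1E i : i != k -> ev U1 (vertQ v i) = 1.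
  move=> ik; rewrite evZu (bary_vert vub) eq_sym (negbTE ik) mulr0n sub0r.
  by rewrite mulrNN mulVf // gt_eqF.
have Ik i : i \in I -> i != k by move=> iI; apply: contraNneq kI => <-.
exists U1; split=> [rho /(ray_generatorP kI)[i /Ik ik ->]|x]; first exact: U1E.
split=> [[[x_ [x0 xI xE]] x1]|[->|/[dup] [[_ sx _]] /(ray_generatorP kI)[i /Ik ik e]]]; last first.
- by split=> //; rewrite e [X in X <= _]U1E.
- rewrite toQ0 ev0; split=> //; exists (fun=> 0); split=> //.
  by rewrite big1 // => i _; rewrite scale0r.
have s1 : \sum_i x_ i <= 1.
  move: x1; rewrite xE ev_sum (eq_bigr x_) // => i _; rewrite evZ.
  by have [->|ik] := eqVneq i k; [rewrite xI // mul0r|rewrite U1E // mulr1].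
have [_ _ _ gen] := lv; have [z zE] := gen x.
have [|s sE] := wps_kernel lv (c := fun i => x_ i - (z i)%:~R).
  under eq_bigr do rewrite scalerBl.
  rewrite sumrB -xE zE toQ_sum; apply/eqP; rewrite subr_eq0; apply/eqP.
  by apply: eq_bigr => i _; rewrite toQZ.
have x_E i : x_ i = (z i)%:~R + s * (l i)%:R by rewrite -sE addrC subrK.
have [m mE] : exists m : int, s * T%:R = m%:~R.
  have /dvdnP[f ->] := lT k; exists (- z k * f%:Z).
  have := x_E k; rewrite xI // natrM intrM intrN => h.
  have -> : (z k)%:~R = - (s * (l k)%:R) :> rat by lra.
  by rewrite opprK -[f%:Z%:~R]/(f%:R); ring.
have sumE : \sum_i x_ i = (\sum_i z i + m)%:~R + s.
  rewrite (eq_bigr _ (fun i _ => x_E i)) big_split /= -mulr_sumr -natr_sum sT.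
  by rewrite -natr1 mulrDr mE mulr1 intrD rmorph_sum addrA.
have xp : x_ p = (z p)%:~R + s by rewrite x_E lp mulr1.
have xq : x_ q = (z q)%:~R + s by rewrite x_E lq mulr1.
set Z := \sum_i z i + m in sumE.
have ge : x_ p + x_ q <= \sum_i x_ i.
  rewrite (bigD1 p) //= (bigD1 q) 1?eq_sym //= addrA lerDl sumr_ge0 //.
(* From [ge], [x_ q <= Z - z p]. If [z p = Z] then [x_ q = 0]; otherwise [Z + s <= 1] gives
   [x_ p <= 0]. In both cases [s] is minus an integer. *)
have [sz sZ] : exists sz : int, s = sz%:~R.
  have zpZ : z p <= Z.
    have : (z p)%:~R <= Z%:~R :> rat by have := x0 q; lra.
    by rewrite ler_int.
  have [zpE|zpn] := eqVneq (z p) Z.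
    exists (- z q); rewrite intrN; have := x0 q; move: ge; rewrite sumE xp xq -zpE; lra.
  have : (z p + 1)%:~R <= Z%:~R :> rat by rewrite ler_int lezD1 lt_neqAle zpn.
  rewrite intrD => h; exists (- z p); rewrite intrN; have := x0 p; lra.
have x_int i : x_ i = (z i + sz * (l i)%:Z)%:~R by rewrite x_E sZ intrD intrM.
have y0 i : 0 <= z i + sz * (l i)%:Z by rewrite -(ler_int rat) -x_int.
have [i yi|no] := pickP (fun i => x_ i != 0); last first.
  left; apply: toQ_inj; rewrite xE toQ0 big1 // => i _.
  by have /eqP -> := negbFE (no i); rewrite scale0r.
have xi1 : 1 <= x_ i.
  rewrite x_int (ler_int _ 1) -gtz0_ge1 lt_neqAle y0 andbT eq_sym.
  by move: yi; rewrite x_int intr_eq0.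
right; apply/(ray_generatorP kI); exists i.
  by apply: contraNT yi => /xI ->.
apply: toQ_inj; rewrite xE -/(vertQ v i) -(delta_sum i); apply: eq_bigr => j _.
congr (_ *: _); move: s1; rewrite (bigD1 i) //=.
have rest : 0 <= \sum_(j | j != i) x_ j by rewrite sumr_ge0.
move=> s1; have r0 : \sum_(j | j != i) x_ j = 0.
  by move: rest s1 xi1; set R := bigop _ _ _; lra.
have [->|ji] := eqVneq j i; first by rewrite r0 addr0 in s1; rewrite mulr1n; lra.
by rewrite (psumr_eq0P _ r0).
Qed.

End Terminality.

(** * The mutation graph *)

Section LatticePoint.
Local Open Scope ring_scope.

(** With [p = l i %% s], the vector [p v_i + (s - p) v_j] is congruent modulo [s] to the relation
    [sum_k l_k v_k = 0], hence is [s] times a lattice point. *)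
Lemma edge_lattice_point n (l : 'I_n.+1 -> nat) v i j (s : nat) :
  wps_vectors l v -> i != j -> (0 < s)%N -> (s %| l i + l j)%N ->
  (forall k, k != i -> k != j -> (s %| l k)%N) ->
  exists x : 'rV[int]_n,
    s%:Z *: x = (l i %% s)%N%:Z *: v i + (s - l i %% s)%N%:Z *: v j.
Proof.
move=> [_ _ lv0 _] ij s0 sij sk; set p := (l i %% s)%N.
have ps : (p < s)%N by rewrite ltn_mod.
pose T k : int := p%:Z * (k == i)%:R + (s - p)%N%:Z * (k == j)%:R - (l k)%:Z.
have sT k : (s%:Z %| T k)%Z.
  have di : (s%:Z %| p%:Z - (l i)%:Z)%Z.
    have -> : p%:Z - (l i)%:Z = - ((l i %/ s)%N%:Z * s%:Z).
      by rewrite [in X in _ - X](divn_eq (l i) s) PoszD PoszM -/p; ring.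
    by rewrite dvdzE abszN -dvdzE dvdz_mull.
  rewrite /T; have [->|ki] := eqVneq k i.
    by rewrite (negbTE ij) mulr1 mulr0 addr0.
  have [->|kj] := eqVneq k j.
    rewrite mulr0 add0r mulr1.
    have -> : (s - p)%N%:Z - (l j)%:Z = s%:Z - (p%:Z - (l i)%:Z) - (l i + l j)%N%:Z.
      by rewrite -subzn 1?ltnW // PoszD; ring.
    by apply: rpredB; first (by apply: rpredB; rewrite ?dvdzz); rewrite dvdzE.
  by rewrite !mulr0 addr0 sub0r dvdzE abszN sk.
exists (\sum_k (divz (T k) s) *: v k).
rewrite scaler_sumr (eq_bigr (fun k => T k *: v k)); last first.
  by move=> k _; rewrite scalerA mulrC divzK.
rewrite /T; under eq_bigr do rewrite scalerBl scalerDl -!scalerA.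
rewrite sumrB big_split /= -!scaler_sumr lv0 subr0.
have pick x : \sum_k (k == x)%:R *: v k = v x.
  rewrite (bigD1 x) //= eqxx scale1r big1 ?addr0 // => k /negbTE ->.
  by rewrite scale0r.
by rewrite !pick.
Qed.

End LatticePoint.

Section Assembly.
Local Open Scope nat_scope.

Lemma terminal_wps_perm n (l m : n.+1.-tuple nat) : perm_eq l m ->
  terminal_wps l -> terminal_wps m.
Proof. by move=> lm [P lP ter]; exists P => //; exact: wps_polytope_perm lm lP. Qed.

Lemma is_wps_perm n (l m : n.+1.-tuple nat) : perm_eq l m -> is_wps l -> is_wps m.
Proof. by move=> lm [P lP]; exists P; exact: wps_polytope_perm lm lP. Qed.

(** The identity sum 1/y_j = 1 - 1/t with denominators cleared, by induction from [y_m = t_m + 1]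
    and [t_{m+1} = t_m y_m]. *)
Lemma sum_cofactors n : \sum_(j < n.-1) cofactor_syl n j + 1 = sylvester_pred n.-1.
Proof.
rewrite /cofactor_syl; elim: n.-1 => [|m IH]; first by rewrite big_ord0.
have y0 i : 0 < sylvester i := ltnW (sylvester_gt1 i).
have tS : sylvester_pred m.+1 = sylvester_pred m * sylvester m.
  by rewrite !sylvester_predE big_ord_recr.
have yE : sylvester m = (sylvester_pred m).+1.
  by rewrite /sylvester_pred subn1 prednK.
rewrite big_ord_recr /= tS mulnK //.
rewrite (eq_bigr (fun j : 'I_m => (sylvester_pred m %/ sylvester j) * sylvester m)).
  rewrite -big_distrl /= -[in RHS]IH yE -IH; set S := \sum_(_ < _) _; ring.
by move=> j _; rewrite divn_mulAC //; apply: (@sylvester_dvd m.+1).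
Qed.

Definition root_tuple n : n.+1.-tuple nat := [tuple root_weight n i | i < n.+1].

Lemma root_tupleE n : 0 < n -> tval (root_tuple n) = root_list n.
Proof.
move=> n0; rewrite tuple_iota iota_split2 //= /root_list; congr [:: _, _ & _].
rewrite -map_comp; apply: eq_map => j /=; rewrite /root_weight ifN ?addnK //.
by rewrite -leqNgt leq_addl.
Qed.

Definition edge_related n (l m : n.+1.-tuple nat) :=
  exists s : {perm 'I_n.+1}, edge_mutation (tnth l) (tnth m \o s).

Lemma edge_related_sym n (l m : n.+1.-tuple nat) : edge_related l m -> edge_related m l.
Proof.
case=> s /edge_mutation_sym/(edge_mutation_perm (s^-1)%g) h; exists (s^-1)%g.
rewrite (_ : tnth m = (tnth m \o s) \o (s^-1)%g) //.
by apply/funext => i /=; rewrite permKV.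
Qed.

Lemma edge_related_perm n (l l' m : n.+1.-tuple nat) : perm_eq l l' ->
  edge_related l m -> exists2 y, edge_mutation (tnth l') y &
    perm_eq m [tuple y i | i < n.+1].
Proof.
rewrite perm_sym => /tuple_permP[p lE] [s /(edge_mutation_perm p) h].
exists ((tnth m \o s) \o p).
  rewrite (_ : tnth l' = tnth l \o p) //; apply/funext => i /=.
  by rewrite (_ : l' = [tuple tnth l (p i) | i < n.+1]) ?tnth_mktuple //; apply: val_inj.
rewrite perm_sym; apply/tuple_permP; exists (p * s)%g.
by congr tval; apply: eq_from_tnth => i; rewrite !tnth_mktuple /= permM.
Qed.

Variables (n : nat) (hn : 5 <= n) (k : nat -> nat -> nat).
Hypothesis hk : forall a : nat, a <= n - 2 ->
  perm_eq [seq k a i | i <- index_iota 3 n.+1] [seq j <- index_iota 0 n.-1 | j != a].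
Local Notation X a m := (Xma n a (k a) m).

Lemma le_lt a : a <= n - 2 -> a < n.-1.
Proof. lia. Qed.

Lemma n_ge2 : 2 <= n. Proof. by lia. Qed.

Lemma X_branch_list a m : a <= n - 2 -> perm_eq (X a m) (branch_list n a m).
Proof. by move=> an; apply: Xma_branch_list n_ge2 (hk an). Qed.

Lemma X_tnth a m i : tnth (X a m) i =
  branch_weight (cofactor_syl n a) (fun i => cofactor_syl n (k a i)) m i.
Proof. by rewrite tnth_mktuple lambdaE. Qed.

(** Whatever index is left out, two of the pairwise coprime weights r_m^2, [L], r_{m+1}^2 remain. *)
Lemma X_well_formed a m : well_formed (tnth (X a m)).
Proof.
move=> i d dX; set L := cofactor_syl n a.
have dW j : j <= n -> j != i :> nat ->
    d %| branch_weight L (fun i => cofactor_syl n (k a i)) m j.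
  move=> jn ji; have := dX (inord j); rewrite X_tnth inordK //; apply.
  by rewrite -val_eqE /= inordK.
have h0 := dW 0; have h1 := dW 1; have h2 := dW 2; rewrite /= in h0 h1 h2.
have two : d %| branch L m ^ 2 /\ d %| L \/ d %| branch L m ^ 2 /\ d %| branch L m.+1 ^ 2
    \/ d %| L /\ d %| branch L m.+1 ^ 2.
  have [i0|i0] := eqVneq (nat_of_ord i) 0.
    by right; right; split; [apply: h1|apply: h2]; lia.
  have [i1|i1] := eqVneq (nat_of_ord i) 1.
    by right; left; split; [apply: h0|apply: h2]; lia.
  by left; split; [apply: h0|apply: h1]; lia.
have cop x y : coprime x y -> d %| x -> d %| y -> d = 1.
  by move=> c dx dy; apply/eqP; rewrite -dvdn1 -(eqP c) dvdn_gcd dx.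
case: two => [[]|[[]|[]]]; apply: cop.
- by rewrite coprimeXl // branch_coprimeL.
- by rewrite coprimeXl // coprimeXr // branch_coprime.
- by rewrite coprime_sym coprimeXl // branch_coprimeL.
Qed.

Lemma X_is_wps a m : a <= n - 2 -> is_wps (X a m).
Proof.
move=> /[dup] ha /le_lt an; have L0 := cof_gt0 an.
apply: is_wps_exist; last exact: X_well_formed.
  move=> i; rewrite X_tnth; have := ltn_ord i; case: (nat_of_ord i) => [|[|[|j]]] //= jn.
  - by rewrite expn_gt0 branch_gt0.
  - by rewrite expn_gt0 branch_gt0.
  rewrite !muln_gt0 !branch_gt0 !andbT cof_gt0 //.
  by apply: (index_lt (hk ha)); lia.
apply: (@X_well_formed a m ord0) => j _.
by rewrite (bigD1 j) //= dvdn_gcdl.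
Qed.

Lemma X0_root a : a <= n - 2 -> perm_eq (X a 0) (Xroot n).
Proof.
move=> an; apply: perm_trans (X_branch_list 0 an) _.
apply: perm_trans (branch_list0 (le_lt an)) _.
by rewrite perm_sym; apply: Xroot_root_list n_ge2.
Qed.

Lemma root_tuple_perm : perm_eq (root_tuple n) (Xroot n).
Proof.
by rewrite root_tupleE ?(leq_trans _ hn) // perm_sym; apply: Xroot_root_list n_ge2.
Qed.

Lemma edge_related_root (Y Z : n.+1.-tuple nat) : perm_eq Y (Xroot n) -> edge_related Y Z ->
  exists2 a, a <= n - 2 & perm_eq Z (X a 1).
Proof.
move=> Yr YZ.
have [|y ry Zy] := edge_related_perm (l' := root_tuple n) _ YZ.
  by apply: perm_trans Yr _; rewrite perm_sym root_tuple_perm.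
have [|a an yb] := root_neighbour hn _ ry; first by move=> i; rewrite tnth_mktuple.
have an2 : a <= n - 2 by lia.
exists a => //; apply: perm_trans Zy _; apply: perm_trans yb _.
by rewrite perm_sym X_branch_list.
Qed.

Lemma edge_related_branch a m (Y Z : n.+1.-tuple nat) : a <= n - 2 -> 0 < m -> perm_eq Y (X a m) ->
  edge_related Y Z -> perm_eq Z (X a m.-1) \/ perm_eq Z (X a m.+1).
Proof.
move=> an m0 YX YZ; have [y Xy Zy] := edge_related_perm YX YZ.
have [h|h] := branch_neighbour hn (le_lt an) (hk an) m0 Xy; [left|right].
  exact: perm_trans Zy h.
exact: perm_trans Zy h.
Qed.

Lemma X_not_terminal a m : a <= n - 2 -> 0 < m -> ~ terminal_wps (X a m).
Proof.
move=> an m0 [P /wps_polytopeP[v [-> lv vp]] ter].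
set L := cofactor_syl n a; have L0 : 0 < L by exact: cof_gt0 (le_lt an).
have [_ s1] := branch_gt1 L0 m0.
have XW (i : 'I_n.+1) j : nat_of_ord i = j -> tnth (X a m) i =
    branch_weight L (fun i => cofactor_syl n (k a i)) m j by move=> <-; rewrite X_tnth.
have i0 : nat_of_ord (inord 0 : 'I_n.+1) = 0 by rewrite inordK.
have i1 : nat_of_ord (inord 1 : 'I_n.+1) = 1 by rewrite inordK //; lia.
have i2 : nat_of_ord (inord 2 : 'I_n.+1) = 2 by rewrite inordK //; lia.
have [u [b vub]] := wps_bary lv.
(* The modulus r_{m+1} divides all weights with index at least 2, and the sum r_m^2 + L = r_{m-1}
   r_{m+1} of the first two. *)
have [||||x xE] := @edge_lattice_point _ _ _ (inord 0) (inord 1) (branch L m.+1) lv.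
- by rewrite -val_eqE /= i0 i1.
- exact: ltnW.
- rewrite (XW _ _ i0) (XW _ _ i1) /= addnC.
  by case: (m) m0 => // q _; rewrite -branch_prod dvdn_mull.
- move=> j; rewrite -!val_eqE /= i0 i1 X_tnth.
  case: (nat_of_ord j) => [|[|[|q]]] //= _ _; first by rewrite dvdn_exp.
  by rewrite mulnA dvdn_mull.
rewrite (XW _ _ i0) /= in xE; set s := branch L m.+1 in s1 xE.
have s0 : 0 < s by exact: ltnW.
set p := branch L m ^ 2 %% s in xE.
have ps : p < s by rewrite ltn_mod.
(* A zero remainder would make the point a vertex; coprimality of r_m and r_{m+1} > 1 puts it inside
   the edge. *)
have p0 : 0 < p.
  rewrite lt0n; apply/negP => /eqP pz; have sr : s %| branch L m ^ 2 by apply/eqP.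
  have c : coprime s (branch L m ^ 2).
    by rewrite coprimeXr // coprime_sym branch_coprime.
  by move: c; rewrite /coprime (gcdn_idPl sr); lia.
have n10 : (inord 0 : 'I_n.+1) != inord 1 by rewrite -val_eqE /= i0 i1.
have n20 : (inord 2 : 'I_n.+1) != inord 0 by rewrite -val_eqE /= i0 i2.
have n21 : (inord 2 : 'I_n.+1) != inord 1 by rewrite -val_eqE /= i1 i2.
apply: (not_terminal_edge lv vub vp n10 n20 n21 (x := x) (al := (p%:R / s%:R)%R)) ter.
  by rewrite divr_gt0 ?ltr0n //= ltr_pdivrMr ?ltr0n // mul1r ltr_nat.
have sn : (s%:R != 0 :> rat)%R by rewrite pnatr_eq0 -lt0n.
have := congr1 (@toQ 1 n) xE; rewrite toQD !toQZ => h.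
apply: (scalerI sn); rewrite -[LHS]/(s%:Z%:~R *: toQ x)%R h scalerDr !scalerA.
congr (_ *: _ + _ *: _)%R; first by rewrite mulrC divfK.
have -> : ((s - p)%N%:Z%:~R = s%:R - p%:R :> rat)%R by rewrite -natrB ?(ltnW ps).
by rewrite mulrBr mulr1 mulrCA mulfV // mulr1.
Qed.

Lemma root_terminal : terminal_wps (Xroot n).
Proof.
apply: terminal_wps_perm root_tuple_perm _.
have [P lP] : is_wps (root_tuple n).
  apply: (@is_wps_perm _ (X 0 0)); last exact: X_is_wps.
  apply: perm_trans (X0_root _) _ => //; by rewrite perm_sym root_tuple_perm.
exists P => //; have [v [-> lv vp]] := wps_polytopeP lP.
have [u [b vub]] := wps_bary lv.
have i1 : nat_of_ord (inord 1 : 'I_n.+1) = 1 by rewrite inordK //; lia.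
apply: (terminal_criterion lv vub vp (T := sylvester_pred n.-1) (p := ord0) (q := inord 1)).
- by rewrite -val_eqE /= i1.
- by rewrite tnth_mktuple.
- by rewrite tnth_mktuple i1.
- move=> i; rewrite tnth_mktuple /root_weight; case: ifPn => [_|]; first exact: dvd1n.
  rewrite -leqNgt => i2; have hi : i - 2 < n.-1 by have := ltn_ord i; lia.
  by rewrite -(cofE hi) dvdn_mulr.
rewrite (eq_bigr (fun i : 'I_n.+1 => root_weight n i)); last first.
  by move=> i _; rewrite tnth_mktuple.
rewrite -(big_mkord xpredT (root_weight n)) /index_iota subn0 iota_split2; last by lia.
rewrite !big_cons big_map /= -sum_cofactors -(big_mkord xpredT (cofactor_syl n)).
rewrite -[LHS]/(1 + (1 + \sum_(j <- iota 0 n.-1) root_weight n (j + 2))).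
rewrite /index_iota subn0 addn1 !add1n; congr _.+2.
apply: eq_bigr => j _; rewrite /root_weight ifN ?addnK //.
by rewrite -leqNgt leq_addl.
Qed.

End Assembly.

(** * The nodes of the tree are distinct *)

Section Distinct.
Local Open Scope nat_scope.

(** The second factor depends on [n] only, so the multiset of weights determines r_m r_{m+1}. *)
Lemma prod_branch_list n a m : a < n.-1 ->
  \prod_(x <- branch_list n a m) x =
  (branch (cofactor_syl n a) m * branch (cofactor_syl n a) m.+1) ^ n *
  \prod_(j <- iota 0 n.-1) cofactor_syl n j.
Proof.
move=> an; rewrite [X in _ * X](perm_big _ (perm_iota_filter an)) /=.
rewrite /branch_list !big_cons big_map; set L := cofactor_syl n a.
set u := branch L m * branch L m.+1.
rewrite (big_split _ _ _ (fun j => cofactor_syl n j) (fun=> u)) /=.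
rewrite big_const_seq iter_muln_1 count_predT.
have := perm_size (perm_iota_filter an); rewrite size_iota /= => sz.
have -> : u ^ n = u ^ size [seq j <- iota 0 n.-1 | j != a] * u ^ 2.
  rewrite -expnD; congr (_ ^ _); move: sz; move: (size _) => z; lia.
rewrite /u; set c := \prod_(_ <- _) _; set q := expn _ (size _); ring.
Qed.

Lemma branch_prod_lt L m m' : 0 < L -> m < m' ->
  branch L m * branch L m.+1 < branch L m' * branch L m'.+1.
Proof.
move=> L0; elim: m' => // m' IH; rewrite ltnS leq_eqVlt => /orP[/eqP ->|/IH h].
  have := branch_gt1 (m := m'.+1) L0 isT; have := branch_gt0 L m'.
  have := branchS L m'; have := branch_gt0 L m'.+1; nia.
apply: ltn_trans h _.
have := branch_gt1 (m := m'.+1) L0 isT; have := branch_gt0 L m'.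
have := branchS L m'; have := branch_gt0 L m'.+1; nia.
Qed.

(** The product of the weights gives [u = r_m r_{m+1}], and [u = 1] only at the root. Otherwise [L]
    is coprime to [u] and above 1, while every weight of the second list except [L'] is 1 or shares
    a factor with [u]; so [L = L'], and [m] follows because [u] increases with [m]. *)
Lemma branch_list_inj n a a' m m' : 5 <= n -> a < n.-1 -> a' < n.-1 ->
  perm_eq (branch_list n a m) (branch_list n a' m') -> m = m' /\ (m = 0 \/ a = a').
Proof.
move=> n5 an an' h.
set L := cofactor_syl n a; set L' := cofactor_syl n a'.
have L4 : 4 < L by exact: cof_gt4. have L4' : 4 < L' by exact: cof_gt4.
have uu : branch L m * branch L m.+1 = branch L' m' * branch L' m'.+1.
  have : \prod_(x <- branch_list n a m) x = \prod_(x <- branch_list n a' m') x.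
    exact: perm_big.
  rewrite !prod_branch_list // => /eqP; rewrite eqn_pmul2r.
    by rewrite eqn_exp2r; [move/eqP|lia].
  rewrite big_seq; elim/big_rec: _ => // j x; rewrite mem_iota => jn x0.
  by rewrite muln_gt0 x0 cof_gt0 //; lia.
have m0E q K : 0 < K -> branch K q * branch K q.+1 = 1 -> q = 0.
  move=> K0 e; apply/eqP; rewrite -leqn0 leqNgt; apply/negP => q0.
  by have := branch_prod_lt K0 q0; rewrite e.
have [mz|m0] := posnP m.
  split; last by left.
  by rewrite mz; apply/esym; apply: (m0E _ L'); [lia|rewrite -uu mz].
have [mz|m'0] := posnP m'.
  by have := m0E m L ltac:(lia); rewrite uu mz => /(_ erefl) e; rewrite e in m0.
have s1 : 1 < branch L' m'.+1 by have [] := branch_gt1 (m := m') (L := L') ltac:(lia) m'0.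
set u := branch L m * branch L m.+1 in uu.
have cLu : coprime L u.
  by rewrite /u coprimeMr !(coprime_sym L) !branch_coprimeL.
have bad x : 1 < x -> x %| L -> x %| u -> False.
  move=> x1 xL xu; have : x %| gcdn L u by rewrite dvdn_gcd xL.
  by rewrite (eqP cLu) dvdn1; lia.
have LL : L = L'.
  have : L \in branch_list n a' m' by rewrite -(perm_mem h) !inE eqxx orbT.
  rewrite !inE -/L' => /or4P[/eqP e|/eqP //|/eqP e|/mapP[j _ e]].
  - have [r1|r1] := ltnP 1 (branch L' m'); last first.
      have : branch L' m' = 1 by have := branch_gt0 L' m'; lia.
      by move=> r1'; rewrite r1' in e; rewrite e in L4.
    by case: (bad _ r1); [rewrite e dvdn_exp|rewrite uu dvdn_mulr].
  - by case: (bad _ s1); [rewrite e dvdn_exp|rewrite uu dvdn_mull].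
  case: (bad (branch L' m'.+1)) => //; last by rewrite uu dvdn_mull.
  by rewrite e mulnA dvdn_mull.
have aa : a = a' by exact: cof_inj LL.
split; last by right.
rewrite -LL in uu; case: (ltngtP m m') => // lt; exfalso.
  by have := branch_prod_lt (L := L) ltac:(lia) lt; rewrite -/u uu ltnn.
by have := branch_prod_lt (L := L) ltac:(lia) lt; rewrite -/u uu ltnn.
Qed.

End Distinct.

Local Open Scope nat_scope.

Theorem proposition8p1 (n : nat) (hn : 5 <= n) (k : nat -> nat -> nat)
    (hk : forall a : nat, a <= n - 2 ->
       perm_eq [seq k a i | i <- index_iota 3 n.+1]
               [seq j <- index_iota 0 n.-1 | j != a]) :
  (* the lambda_i^(m,a) are integers, and are the weights of a weighted
     projective space *)
  (forall a m : nat, a <= n - 2 ->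
     lambda_exact n a (k a) m /\ is_wps (Xma n a (k a) m)) /\
  (* (i) *)
  (forall a : nat, a <= n - 2 -> perm_eq (Xma n a (k a) 0) (Xroot n)) /\
  (* (ii) *)
  (forall (a m : nat) (X : n.+1.-tuple nat), a <= n - 2 -> 0 < m ->
     wps_mutation X (Xma n a (k a) m) ->
     perm_eq X (Xma n a (k a) m.-1) \/ perm_eq X (Xma n a (k a) m.+1)) /\
  (* (iii) *)
  (forall a m : nat, a <= n - 2 -> 1 <= m ->
     ~ terminal_wps (Xma n a (k a) m)) /\
  (* the mutation graph is a subtree of the tree with root X_n and, for each a,
     one infinite branch: the nodes of that tree are pairwise distinct, ... *)
  (forall a a' m m' : nat, a <= n - 2 -> a' <= n - 2 ->
     perm_eq (Xma n a (k a) m) (Xma n a' (k a') m') ->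
     m = m' /\ (m = 0 \/ a = a')) /\
  (* ... every vertex of the graph is one of them, ... *)
  (forall X : n.+1.-tuple nat, mutation_reachable (Xroot n) X ->
     exists a m : nat, a <= n - 2 /\ perm_eq X (Xma n a (k a) m)) /\
  (* ... and every edge joins two consecutive nodes of a branch *)
  (forall X Y : n.+1.-tuple nat,
     mutation_reachable (Xroot n) X -> mutation_reachable (Xroot n) Y ->
     wps_mutation X Y ->
     exists a m : nat, a <= n - 2 /\
       (perm_eq X (Xma n a (k a) m) /\ perm_eq Y (Xma n a (k a) m.+1) \/
        perm_eq X (Xma n a (k a) m.+1) /\ perm_eq Y (Xma n a (k a) m))) /\
  (* the only terminal vertex of the graph is X_n *)
  (mutation_reachable (Xroot n) (Xroot n) /\
   forall X : n.+1.-tuple nat, mutation_reachable (Xroot n) X ->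
     (terminal_wps X <-> perm_eq X (Xroot n))).
Proof.
have root_perm a : a <= n - 2 -> perm_eq (Xma n a (k a) 0) (Xroot n) := @X0_root n hn k hk a.
have edge X Y : wps_mutation X Y -> @edge_related n X Y.
  by case/wps_mutation_edge.
have not_term a m := @X_not_terminal n hn k a m.
have reach X : mutation_reachable (Xroot n) X ->
    exists a m : nat, a <= n - 2 /\ perm_eq X (Xma n a (k a) m).
  elim=> {X} [X _ rX|X Y _ [a [[|m] [an Xa]]] /edge XY].
  - exists 0, 0; split=> //; rewrite perm_sym; exact: perm_trans (root_perm 0 _) rX.
  - have [a' an' Ya] := edge_related_root hn hk (perm_trans Xa (root_perm a an)) XY.
    by exists a', 1.
  have [Ya|Ya] := edge_related_branch hn hk an (ltn0Sn m) Xa XY.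
    by exists a, m.
  by exists a, m.+2.
split; [|split; [|split; [|split; [|split; [|split; [|split; [|split]]]]]]] => //.
- move=> a m an; split; last exact: X_is_wps.
  apply: lambda_exactP => [|i hi]; first by lia.
  by apply: (index_lt (hk _ _)).
- move=> a m X an m0 /edge/edge_related_sym; exact: edge_related_branch.
- move=> a a' m m' an an' h; apply: (branch_list_inj hn) => //; [lia|lia|].
  apply: perm_trans (perm_trans h (X_branch_list hn hk m' an')).
  by rewrite perm_sym X_branch_list.
- move=> X Y /reach[a [[|m] [an Xa]]] _ /edge XY.
    have [a' an' Ya] := edge_related_root hn hk (perm_trans Xa (root_perm a an)) XY.
    exists a', 0; split=> //; left; split=> //.
    by apply: perm_trans Xa _; apply: perm_trans (root_perm a an) _; rewrite perm_sym root_perm.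
  have [Ya|Ya] := edge_related_branch hn hk an (ltn0Sn m) Xa XY.
    by exists a, m; split=> //; right.
  by exists a, m.+1; split=> //; left.
- apply: reachable_start => //; apply: is_wps_perm (root_perm 0 _) _ => //.
  exact: X_is_wps.
move=> X /reach[a [m [an Xa]]]; split=> [tX|Xr].
  case: m Xa => [|m] Xa; first exact: perm_trans Xa (root_perm a an).
  case: (not_term a m.+1 an) => //; exact: terminal_wps_perm Xa tX.
apply: terminal_wps_perm (root_terminal hn hk); by rewrite perm_sym.
Qed.
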